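(* Let $\pi_1$ and $\pi_2$ be finite abelian groups, $\pi=\pi_1\times\pi_2$, and let $L$ be a Galois extension of the field $K$ with $\pi_1=\operatorname{Gal}(L/K)$. Regard $L$ as a $\pi$-field through the projection $\pi\to\pi_1$. Assume that (i) $\gcd\{|\pi_1|,|\pi_2|\}=1$, (ii) $\operatorname{char} K=0$, or $\operatorname{char} K>0$ with $\operatorname{char} K\nmid|\pi_2|$, and (iii) $K(\zeta_m)$ is a cyclic extension of $K$, where $m$ is the exponent of $\pi_2$. If $M$ is a $\pi$-lattice such that $\rho_\pi(M)$ is an invertible $\pi$-lattice, then $L(M)^\pi$ is retract rational over $K$.
   Context: $\zeta_m$ denotes a primitive $m$-th root of unity in some extension field of $K$. A cyclic extension is a Galois extension with cyclic Galois group. A $\pi$-field is a field on which the group $\pi$ acts by field automorphisms. Lattices. For a finite group $\pi$, a $\pi$-lattice is a finitely generated $\mathbb{Z}[\pi]$-module that is free as an abelian group. It is a permutation lattice if it has a $\mathbb{Z}$-basis permuted by $\pi$; invertible if it is a direct summand of a permutation lattice; flabby if the Tate cohomology group $H^{-1}(\pi',M)=0$ for every subgroup $\pi'$ of $\pi$. Two flabby $\pi$-lattices $E_1,E_2$ are similar if $E_1\oplus P\cong E_2\oplus Q$ for some permutation lattices $P,Q$; $[E]$ denotes the similarity class of $E$. Every $\pi$-lattice $M$ has a flabby resolution, i.e. an exact sequence of $\pi$-lattices $0\to M\to P\to E\to 0$ with $P$ a permutation lattice and $E$ flabby, and the flabby class $\rho_\pi(M):=[E]$ is independent of the choice of resolution.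 ''$\rho_\pi(M)$ is invertible'' means that $E$ is an invertible lattice (this does not depend on the choice of $E$ in its class). Multiplicative action. If $\pi$ acts on a field $L$ by automorphisms and $M=\bigoplus_{1\le i\le n}\mathbb{Z}\cdot x_i$ is a $\pi$-lattice, then $L(M)=L(x_1,\ldots,x_n)$ is the rational function field in $n$ variables, with $\pi$ acting on $L$ as given and $\sigma\cdot x_j=\prod_{i}x_i^{a_{ij}}$ in $L(M)$ whenever $\sigma\cdot x_j=\sum_i a_{ij}x_i$ in $M$. $L(M)^\pi$ is the fixed field. Retract rational: let $K\subset F$ be a field extension. $F$ is retract rational over $K$ if there is a $K$-algebra $R$ contained in $F$ such that (i) $F$ is the quotient field of $R$, and (ii) there are a polynomial ring $K[x_1,\ldots,x_n]$, an element $f\in K[x_1,\ldots,x_n]$, and $K$-algebra homomorphisms $\varphi:R\to K[x_1,\ldots,x_n][1/f]$ and $\psi:K[x_1,\ldots,x_n][1/f]\to R$ satisfying $\psi\circ\varphi=1_R$. *)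

(* Defs.v *)
From HB Require Import structures.
From mathcomp Require Import all_boot all_order all_algebra.
From mathcomp Require Import all_fingroup all_solvable all_field.
From mathcomp.multinomials Require Import mpoly.

Set Implicit Arguments.
Unset Strict Implicit.
Unset Printing Implicit Defensive.

Import GRing.Theory.
Local Open Scope ring_scope.

Definition zbasis (M : zmodType) (n : nat) (b : 'I_n -> M) : Prop :=
  bijective (fun c : {ffun 'I_n -> int} => \sum_(i < n) b i *~ c i).

(* As gT is finite, "finitely generated over Z[gT] and free as an abelian
   group" amounts to the existence of a finite Z-basis. *)
HB.mixin Record isGLattice (gT : finGroupType) M of GRing.Zmodule M := {
  lact : gT -> M -> M;
  lact1 : forall x, lact 1%g x = x;
  lactM : forall g h x, lact (g * h)%g x = lact g (lact h x);
  lactD : forall g, {morph lact g : x y / x + y};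
  lattice_basis : exists (n : nat) (b : 'I_n -> M), zbasis b
}.

#[short(type="glatticeType")]
HB.structure Definition GLattice (gT : finGroupType) :=
  { M of isGLattice gT M & GRing.Zmodule M }.

Section DirectSum.

Variables (gT : finGroupType) (M N : glatticeType gT).

Definition dsum_act (g : gT) (x : M * N) : M * N := (lact g x.1, lact g x.2).

Fact dsum_act1 x : dsum_act 1%g x = x.
Proof. by case: x => x y; rewrite /dsum_act !lact1. Qed.

Fact dsum_actM g h x : dsum_act (g * h)%g x = dsum_act g (dsum_act h x).
Proof. by rewrite /dsum_act !lactM. Qed.

Fact dsum_actD g : {morph dsum_act g : x y / x + y}.
Proof. by move=> x y; rewrite /dsum_act !lactD. Qed.

Fact dsum_basis : exists (n : nat) (b : 'I_n -> (M * N)%type), zbasis b.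
Proof.
have [m [b [bi bK biK]]] := @lattice_basis gT M.
have [n [c [ci cK ciK]]] := @lattice_basis gT N.
pose d (i : 'I_(m + n)) : (M * N)%type :=
  match split i with inl j => (b j, 0) | inr k => (0, c k) end.
have dE (e : {ffun 'I_(m + n) -> int}) : \sum_i d i *~ e i =
    (\sum_(j < m) b j *~ [ffun j => e (lshift n j)] j,
     \sum_(k < n) c k *~ [ffun k => e (rshift m k)] k).
  have s1 (I : finType) (F : I -> (M * N)%type) :
      \sum_i F i = (\sum_i (F i).1, \sum_i (F i).2).
    apply: (big_rec3 (fun u v (p : M * N) => p = (u, v))) => // i u v p _ ->.
    by case: (F i).
  have fz (x : M * N) (k : int) : x *~ k = (x.1 *~ k, x.2 *~ k).
    have fn (l : nat) : x *+ l = (x.1 *+ l, x.2 *+ l).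
      by elim: l => [|l IH] //; rewrite !mulrS IH.
    by case: k => l; rewrite /intmul fn.
  rewrite s1 !big_split_ord /=; congr (_, _).
    rewrite [X in _ + X]big1 ?addr0 => [|k _].
      apply: eq_bigr => j _; rewrite ffunE fz /d.
      by rewrite -[lshift n j]/(unsplit (inl j)) unsplitK.
    by rewrite fz /d -[rshift m k]/(unsplit (inr k)) unsplitK /= mul0rz.
  rewrite big1 ?add0r => [|j _].
    apply: eq_bigr => k _; rewrite ffunE fz /d.
    by rewrite -[rshift m k]/(unsplit (inr k)) unsplitK.
  by rewrite fz /d -[lshift n j]/(unsplit (inl j)) unsplitK /= mul0rz.
exists (m + n)%N, d.
exists (fun x => [ffun i => match split i with
                            | inl j => bi x.1 j | inr k => ci x.2 k end]).
  move=> e; rewrite dE /= (bK [ffun _ => _]) (cK [ffun _ => _]).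
  apply/ffunP => i; rewrite ffunE.
  by case: (splitP i) => j ij; rewrite ffunE; congr (e _); apply: val_inj.
move=> [x y]; rewrite dE; congr (_, _).
  rewrite -[RHS]biK; apply: eq_bigr => j _; rewrite !ffunE.
  by rewrite -[lshift n j]/(unsplit (inl j)) unsplitK.
rewrite -[RHS]ciK; apply: eq_bigr => k _; rewrite !ffunE.
by rewrite -[rshift m k]/(unsplit (inr k)) unsplitK.
Qed.

HB.instance Definition _ := isGLattice.Build gT (M * N)%type
  dsum_act1 dsum_actM dsum_actD dsum_basis.

End DirectSum.

Section Lattices.

Variable gT : finGroupType.
Implicit Types M N P Q E : glatticeType gT.

Definition equivariant M N (f : M -> N) : Prop :=
  forall (g : gT) (x : M), f (lact g x) = lact g (f x).

Definition lattice_iso M N : Prop :=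
  exists f : {additive M -> N}, equivariant f /\ bijective f.

Definition permutation_lattice M : Prop :=
  exists (n : nat) (b : 'I_n -> M),
    zbasis b /\ forall (g : gT) (i : 'I_n), exists j : 'I_n, lact g (b i) = b j.

Definition invertible_lattice M : Prop :=
  exists N P, permutation_lattice P /\ lattice_iso (M * N)%type P.

(* H^{-1}(H, M) is the kernel of the norm x |-> \sum_(h in H) h.x modulo the
   subgroup I_H M generated by all h.y - y; collecting the terms with the same
   h, an element of I_H M is a sum of h.(y h) - y h over h in H. *)
Definition tate_Hm1_trivial M (H : {group gT}) : Prop :=
  forall x : M, \sum_(h in H) lact h x = 0 ->
  exists y : gT -> M, x = \sum_(h in H) (lact h (y h) - y h).

Definition flabby M : Prop := forall H : {group gT}, tate_Hm1_trivial M H.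

Definition similar E1 E2 : Prop :=
  exists P Q, [/\ permutation_lattice P, permutation_lattice Q
                & lattice_iso (E1 * P)%type (E2 * Q)%type].

Definition short_exact M P E (i : M -> P) (p : P -> E) : Prop :=
  [/\ injective i,
      forall y : P, p y = 0 <-> exists x : M, y = i x
    & forall z : E, exists y : P, z = p y].

Definition flabby_resolution M P E : Prop :=
  [/\ permutation_lattice P, flabby E
    & exists (i : {additive M -> P}) (p : {additive P -> E}),
        [/\ equivariant i, equivariant p & short_exact i p]].

(* rho(M), as the set of all flabby lattices similar to the cokernel E of
   some (equivalently, any) flabby resolution of M. *)
Definition flabby_class M (E' : glatticeType gT) : Prop :=
  flabby E' /\ exists P E, flabby_resolution M P E /\ similar E E'.

Definition flabby_class_invertible M : Prop :=
  exists E, flabby_class M E /\ invertible_lattice E.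

End Lattices.

Section MultiplicativeAction.

Variables (L : fieldType) (n : nat).

Local Notation LX := {fraction {mpoly L[n]}}.
Local Notation "p %:F" := (@tofrac {mpoly L[n]} p).

(* c in L is sent to s c and x_j to \prod_i x_i ^ (a i j). *)
Definition mul_subst (s : L -> L) (a : 'M[int]_n) (p : {mpoly L[n]}) : LX :=
  mmap (fun c => (s c)%:MP%:F) (fun j => \prod_(i < n) ('X_i)%:F ^ a i j) p.

(* When s is a field embedding and a is invertible, mul_subst is an injective
   ring morphism, so it extends to the fraction field and the value below does
   not depend on the chosen representative of u. *)
Definition mul_act (s : L -> L) (a : 'M[int]_n) (u : LX) : LX :=
  let r := generic_quotient.repr u in mul_subst s a \n_r / mul_subst s a \d_r.

Definition fixed_field (gT : finGroupType)
    (s : gT -> L -> L) (a : gT -> 'M[int]_n) : {pred LX} :=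
  [pred u | [forall g : gT, mul_act (s g) (a g) u == u]].

End MultiplicativeAction.

Definition const_embed (K : fieldType) (L : fieldExtType K) (n : nat) :
    {rmorphism K -> {fraction {mpoly L[n]}}} :=
  @tofrac {mpoly L[n]} \o (@mpolyC n L \o in_alg L).

Section RetractRational.

Variable K : fieldType.

Definition subalgebra (A : fieldType) (i : K -> A) (R : A -> Prop) : Prop :=
  [/\ forall c : K, R (i c),
      forall x y, R x -> R y -> R (x - y)
    & forall x y, R x -> R y -> R (x * y)].

(* phi is only constrained on R: it restricts to a K-algebra morphism from the
   subalgebra R of A to the subalgebra S of B. *)
Definition subalgebra_hom (A B : fieldType) (iA : K -> A) (iB : K -> B)
    (R : A -> Prop) (S : B -> Prop) (phi : A -> B) : Prop :=
  [/\ forall x, R x -> S (phi x),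
      forall c : K, phi (iA c) = iB c,
      forall x y, R x -> R y -> phi (x + y) = phi x + phi y
    & forall x y, R x -> R y -> phi (x * y) = phi x * phi y].

(* K[x_1, ..., x_n][1/f] as a subring of K(x_1, ..., x_n), for f != 0. *)
Definition localized (n : nat) (f : {mpoly K[n]})
    (u : {fraction {mpoly K[n]}}) : Prop :=
  exists (p : {mpoly K[n]}) (k : nat), u = tofrac p / tofrac f ^+ k.

(* Retract rationality over K of a subfield F of A containing i(K). The case
   f = 0 is excluded as K[x_1, ..., x_n][1/0] is the zero ring, from which
   there is no unital morphism to R. *)
Definition retract_rational (A : fieldType) (i : {rmorphism K -> A})
    (F : {pred A}) : Prop :=
  exists R : A -> Prop,
  [/\ subalgebra i R,
      forall x, R x -> x \in F,
      forall x, x \in F ->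
        exists a b, [/\ R a, R b, b != 0 & x = a / b]
    & exists (n : nat) (f : {mpoly K[n]})
             (phi : A -> {fraction {mpoly K[n]}})
             (psi : {fraction {mpoly K[n]}} -> A),
      let j := fun c : K => tofrac (c%:MP_[n]) in
      [/\ f != 0,
          subalgebra_hom i j R (localized f) phi,
          subalgebra_hom j i (localized f) R psi
        & forall x, R x -> psi (phi x) = x]].

End RetractRational.

Definition cyclic_extension (K : fieldType) (L : splittingFieldType K)
    (E F : {subfield L}) : bool :=
  galois E F && cyclic 'Gal(F / E)%g.

(* Main.v *)
From HB Require Import structures.
From mathcomp Require Import all_boot all_order all_algebra.
From mathcomp Require Import all_fingroup all_solvable all_field.
From mathcomp.multinomials Require Import ssrcomplements mpoly.
From mathcomp Require Import ring.
From Stdlib Require Import Classical ClassicalEpsilon.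
Require Import Defs.

Set Implicit Arguments.
Unset Strict Implicit.
Unset Printing Implicit Defensive.

Import GRing.Theory.
Local Open Scope ring_scope.

(** The field of invariants L(M)^pi is retract rational over K as soon as its
    identity has a section: invariants f_1, ..., f_N and a morphism sg from
    L(M)^pi to K(w_1, ..., w_N) such that each fraction sg u is defined at
    w = f, with value u. Clearing the finitely many denominators involved turns
    sg into a morphism to a localized polynomial ring ([retract_criterion]).
    The proof constructs such a section.

    Adjoining a root of unity to L gives a Galois extension E of K with group
    G1; let H be the image of pi2 in the automorphisms of M. The group G =
    G1 * H acts faithfully on E(M), with the same invariants as pi on L(M)
    ([extend_descent], [fixed_fieldP]).

    The lattice hypothesis enters as follows. Let 0 -> M -> P -> Q -> 0 be a
    flabby resolution; Q is similar to a summand of a permutation lattice. The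
    obstruction to extending the inclusion of M in the group U of units of E(M)
    to an equivariant morphism on P lies in Ext^1_G(Q, U). This is a summand of
    a product of groups H^1(G', U) for subgroups G' of G, which vanish by
    Hilbert's Theorem 90. Hence each x_j is a monomial in an equivariant family
    of units s_c, indexed by a permuted basis of P ([multiplicative_factors]).
    Such a family lifts equivariantly to any ring with an action of G to which
    its invariant coordinates in a suitable system of generators lift
    ([dual_system], [equivariant_lift]); as these coordinates are
    unconstrained, they may be replaced by the indeterminates w.

    The lifts live in a polynomial ring R1 over E[w], in variables X_u that
    carry the same characters of H as chosen eigenvectors e_u in E(M). These
    exist as H is abelian and E contains the roots of unity. It remains to map
    the H-invariants of R1 to E(w), compatibly with G1. The H-invariant
    monomials are given by the lattice J of the exponents x for which the
    character of the product of the e_u ^ x_u is trivial, so the point is to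
    lift equivariantly the morphism J -> U that sends x to the product of the
    e_u ^ x_u. This is again possible if that morphism factors through a
    permutation lattice for G1 ([perm_factors]), and that is what the cyclicity
    of the cyclotomic extension provides. After reduction to characters of
    order q = p ^ a, the group G1 acts on the q-th roots of unity through a
    cyclic group C of order d, with a generator raising them to the t, and J
    becomes the ideal (s - t, q) of Z[C]. If t can be chosen modulo q such that
    (t ^ d - 1) / q is prime to p, then Z[C]^2 -> J splits and J itself is a
    summand of a permutation lattice ([cyclic_regular]). Otherwise p = 2 and
    t = -1 ([order_lift]), and a direct computation applies
    ([quadratic_regular]).

    Finally, an invariant u of E(M) lifts to a quotient of two G-invariant
    elements of R1, and the quotient of their images in E(w) is fixed by G1,
    hence lies in K(w) ([invariant_section], [cyclotomic_section]). *)

(** * Maps out of fraction fields *)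

Section FracLift.

Variable R : idomainType.
Implicit Types u v : {fraction R}.
Local Notation "p %:F" := (@tofrac R p).

Lemma frac_repr u :
  u * (\d_(generic_quotient.repr u))%:F = (\n_(generic_quotient.repr u))%:F.
Proof.
set x := generic_quotient.repr u.
have -> : u = (\pi_{fraction R} x)%qT by rewrite generic_quotient.reprK.
unlock tofrac; rewrite -[LHS]FracField.pi_mul; apply/generic_quotient.eqmodP.
rewrite /= FracField.equivfE /FracField.mulf.
by rewrite !numden_Ratio ?mulr1 ?oner_eq0 ?denom_ratioP // mulrC.
Qed.

Lemma frac_den_neq0 u : (\d_(generic_quotient.repr u))%:F != 0.
Proof. by rewrite tofrac_eq0 denom_ratioP. Qed.

Lemma fracE u : u = (\n_(generic_quotient.repr u))%:F
                    / (\d_(generic_quotient.repr u))%:F.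
Proof. by rewrite -frac_repr mulfK ?frac_den_neq0. Qed.

Lemma fracP u : exists p q, q != 0 /\ u = p%:F / q%:F.
Proof.
exists (\n_(generic_quotient.repr u)), (\d_(generic_quotient.repr u)).
by split; [exact: denom_ratioP | exact: fracE].
Qed.

Variables (F : fieldType) (f : {rmorphism R -> F}).

(** The shape is that of the action of a group element on a rational function
    field in the definition of the fixed field, to which it is convertible. *)
Definition frac_lift of injective f := fun u =>
  f (\n_(generic_quotient.repr u)) / f (\d_(generic_quotient.repr u)).

Variable fI : injective f.

Lemma inj_rmorph_eq0 p : (f p == 0) = (p == 0).
Proof. by rewrite -(rmorph0 f) (inj_eq fI). Qed.

Lemma frac_liftE p q : q != 0 -> frac_lift fI (p%:F / q%:F) = f p / f q.
Proof.
move=> q0; rewrite /frac_lift; set u := p%:F / q%:F.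
have q0' : q%:F != 0 by rewrite tofrac_eq0.
have := frac_repr u; set n := \n_ _; set d := \d_ _ => e.
have d0 : d != 0 by apply: denom_ratioP.
apply/eqP; rewrite eqr_div ?inj_rmorph_eq0 // -!rmorphM (inj_eq fI).
by rewrite -tofrac_eq !tofracM -e /u mulrAC mulfVK.
Qed.

Lemma frac_lift_tofrac p : frac_lift fI p%:F = f p.
Proof.
by have := frac_liftE p (oner_neq0 R); rewrite tofrac1 rmorph1 !divr1.
Qed.

Fact frac_lift_zmod_morphism : zmod_morphism (frac_lift fI).
Proof.
move=> u v; have [a [b [b0 ->]]] := fracP u; have [c [d [d0 ->]]] := fracP v.
have b0' : b%:F != 0 by rewrite tofrac_eq0.
have d0' : d%:F != 0 by rewrite tofrac_eq0.
have -> : a%:F / b%:F - c%:F / d%:F = (a * d - c * b)%:F / (b * d)%:F.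
  rewrite -mulNr addf_div // tofracM tofracB !tofracM mulNr.
  by [].
rewrite !frac_liftE ?mulf_neq0 // -[- (f c / _)]mulNr.
rewrite addf_div ?inj_rmorph_eq0 //.
by rewrite rmorphB !rmorphM mulNr.
Qed.

Fact frac_lift_monoid_morphism : monoid_morphism (frac_lift fI).
Proof.
split=> [|u v]; first by rewrite -tofrac1 frac_lift_tofrac rmorph1.
have [a [b [b0 ->]]] := fracP u; have [c [d [d0 ->]]] := fracP v.
by rewrite mulf_div -!tofracM !frac_liftE ?mulf_neq0 // mulf_div -!rmorphM.
Qed.

HB.instance Definition _ := GRing.isZmodMorphism.Build {fraction R} F
  (frac_lift fI) frac_lift_zmod_morphism.
HB.instance Definition _ := GRing.isMonoidMorphism.Build {fraction R} F
  (frac_lift fI) frac_lift_monoid_morphism.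

End FracLift.

(** * Specialization of fractions *)

(** The graph of the map from the local ring of the kernel of ev onto its
    residue field; a relation because that map is not total. *)
Definition specializes (R : idomainType) (F : fieldType) (ev : R -> F)
    (u : {fraction R}) (v : F) : Prop :=
  exists p q, [/\ ev q != 0, u = tofrac p / tofrac q & v = ev p / ev q].

Section Specialization.

Variables (R : idomainType) (F : fieldType) (ev : {rmorphism R -> F}).
Local Notation "p %:F" := (@tofrac R p).
Local Notation sp := (specializes ev).

Lemma ev_neq0 p : ev p != 0 -> p != 0.
Proof. by apply: contraNneq => ->; rewrite rmorph0. Qed.

Lemma ev_tofrac_neq0 p : ev p != 0 -> p%:F != 0.
Proof. by move/ev_neq0; rewrite tofrac_eq0. Qed.

Lemma sp_tofrac p : sp p%:F (ev p).
Proof.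
by exists p, 1; rewrite rmorph1 tofrac1 !divr1 oner_eq0.
Qed.

Lemma sp0 : sp 0 0. Proof. by have := sp_tofrac 0; rewrite tofrac0 rmorph0. Qed.
Lemma sp1 : sp 1 1. Proof. by have := sp_tofrac 1; rewrite tofrac1 rmorph1. Qed.

Lemma spD u1 v1 u2 v2 : sp u1 v1 -> sp u2 v2 -> sp (u1 + u2) (v1 + v2).
Proof.
move=> [a [b [b0 -> ->]]] [c [d [d0 -> ->]]].
exists (a * d + c * b), (b * d); split; first by rewrite rmorphM mulf_neq0.
  by rewrite addf_div ?ev_tofrac_neq0 // tofracD !tofracM.
by rewrite addf_div // rmorphD !rmorphM.
Qed.

Lemma spM u1 v1 u2 v2 : sp u1 v1 -> sp u2 v2 -> sp (u1 * u2) (v1 * v2).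
Proof.
move=> [a [b [b0 -> ->]]] [c [d [d0 -> ->]]].
exists (a * c), (b * d); split; first by rewrite rmorphM mulf_neq0.
  by rewrite mulf_div !tofracM.
by rewrite mulf_div !rmorphM.
Qed.

Lemma spV u v : v != 0 -> sp u v -> sp u^-1 v^-1.
Proof.
move=> v0 [a [b [b0 uE vE]]]; exists b, a; rewrite uE vE !invf_div; split=> //.
by apply: contraNneq v0 => a0; rewrite vE a0 mul0r.
Qed.

Lemma spX u v k : sp u v -> sp (u ^+ k) (v ^+ k).
Proof.
by move=> h; elim: k => [|k IH]; [exact: sp1 | rewrite !exprS; apply: spM].
Qed.

Lemma spXz u v (k : int) : v != 0 -> sp u v -> sp (u ^ k) (v ^ k).
Proof.
move=> v0 h; case: k => k; first exact: spX.
by rewrite /exprz; apply: spV; [rewrite expf_neq0 | apply: spX].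
Qed.

Lemma sp_sum (I : Type) (r : seq I) (P : pred I) (u : I -> {fraction R}) v :
  (forall i, P i -> sp (u i) (v i)) ->
  sp (\sum_(i <- r | P i) u i) (\sum_(i <- r | P i) v i).
Proof.
by move=> h; elim/big_rec2: _ => [|i x y Pi]; [exact: sp0 | apply: spD; apply: h].
Qed.

Lemma sp_prod (I : Type) (r : seq I) (P : pred I) (u : I -> {fraction R}) v :
  (forall i, P i -> sp (u i) (v i)) ->
  sp (\prod_(i <- r | P i) u i) (\prod_(i <- r | P i) v i).
Proof.
by move=> h; elim/big_rec2: _ => [|i x y Pi]; [exact: sp1 | apply: spM; apply: h].
Qed.

Lemma sp_eq0 v : sp 0 v -> v = 0.
Proof.
move=> [a [b [b0 /esym/eqP + ->]]].
rewrite mulf_eq0 invr_eq0 (negbTE (ev_tofrac_neq0 b0)) orbF tofrac_eq0.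
by move/eqP->; rewrite rmorph0 mul0r.
Qed.

Lemma spN u v : sp u v -> sp (- u) (- v).
Proof.
by move=> [a [b [b0 -> ->]]]; exists (- a), b; rewrite tofracN rmorphN !mulNr.
Qed.

Lemma sp_fun u v1 v2 : sp u v1 -> sp u v2 -> v1 = v2.
Proof.
move=> h1 /spN h2; have := spD h1 h2; rewrite subrr => /sp_eq0/eqP.
by rewrite subr_eq0 => /eqP.
Qed.

Lemma sp_neq0 u v : v != 0 -> sp u v -> u != 0.
Proof. by move=> v0 h; apply: contraNneq v0 => u0; rewrite u0 in h; rewrite (sp_eq0 h). Qed.

End Specialization.

(** * Invariant fractions *)

Section InvariantFractions.

Variables (G : finGroupType) (R : idomainType) (rho : G -> {rmorphism R -> R}).
Hypothesis rho1 : forall p, rho 1%g p = p.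
Hypothesis rhoM : forall g h p, rho (g * h)%g p = rho g (rho h p).

Lemma rhoK g : cancel (rho g) (rho g^-1).
Proof. by move=> p; rewrite -rhoM mulVg rho1. Qed.

Lemma rho_inj g : injective (rho g).
Proof. exact: can_inj (rhoK g). Qed.

Lemma rho_norm g p : rho g (\prod_(h : G) rho h p) = \prod_(h : G) rho h p.
Proof.
rewrite rmorph_prod [RHS](reindex_inj (mulgI g)).
by apply: eq_bigr => h _; rewrite rhoM.
Qed.

(** Multiplying both terms by the conjugates of the denominator turns the
    latter into a norm; then the numerator has to be invariant as well. *)
Lemma invariant_fraction p q : q != 0 ->
  (forall g, p * rho g q = rho g p * q) ->
  exists p' q', [/\ q' = \prod_(g : G) rho g q,
    forall g, rho g p' = p', forall g, rho g q' = q' & p * q' = p' * q].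
Proof.
move=> q0 inv; set q' := \prod_(g : G) rho g q.
have q'E : q' = q * \prod_(g : G | g != 1%g) rho g q.
  by rewrite /q' (bigD1 1%g) //= rho1.
exists (p * \prod_(g : G | g != 1%g) rho g q), q'.
have e : p * q' = p * \prod_(g : G | g != 1%g) rho g q * q.
  by rewrite q'E mulrCA mulrC.
split=> // [g|g]; last exact: rho_norm.
have rq0 : rho g q != 0 by rewrite -(rmorph0 (rho g)) (inj_eq (@rho_inj g)).
apply: (mulIf q0); apply: (mulIf rq0); rewrite -e mulrAC -rmorphM -e rmorphM.
by rewrite rho_norm mulrAC -inv mulrAC.
Qed.

End InvariantFractions.

Lemma norm_neq0 (G : finGroupType) (R : idomainType) (F : fieldType)
    (rho : G -> R -> R) (aF : G -> {rmorphism F -> F}) (ev : R -> F) q :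
  (forall g p, ev (rho g p) = aF g (ev p)) -> ev q != 0 ->
  \prod_(g : G) ev (rho g q) != 0.
Proof.
by move=> evE q0; apply/prodf_neq0 => g _; rewrite evE fmorph_eq0.
Qed.

Lemma mpoly_descent (K L : fieldType) (iK : {rmorphism K -> L}) (T : Type)
    (aL : T -> {rmorphism L -> L}) n (p : {mpoly L[n]}) :
  (forall l, (forall g, aL g l = l) -> exists k, l = iK k) ->
  (forall g, map_mpoly (aL g) p = p) -> exists p0, p = map_mpoly iK p0.
Proof.
move=> fixL fixp.
pose c (l : L) : K := epsilon (inhabits 0) (fun k => l = iK k).
have cE m : p@_m = iK (c p@_m).
  apply: (epsilon_spec (inhabits 0) (fun k => p@_m = iK k)).
  by apply: fixL => g; rewrite -mcoeff_map_mpoly fixp.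
exists (\sum_(m <- msupp p) c p@_m *: 'X_[m]).
rewrite [LHS]mpolyE raddf_sum; apply: eq_bigr => m _ /=.
by rewrite map_mpolyZ map_mpolyX -cE.
Qed.

(** * A faithful finite group of field automorphisms *)

Section Dedekind.

Variables (G : finGroupType) (F : fieldType) (act : G -> {rmorphism F -> F}).
Hypothesis act1 : forall u, act 1%g u = u.
Hypothesis actM : forall g h u, act (g * h)%g u = act g (act h u).
Implicit Types (u v : F).

Definition trace u := \sum_(g : G) act g u.

Lemma trace_fixed h u : act h (trace u) = trace u.
Proof.
rewrite rmorph_sum [RHS](reindex_inj (mulgI h)).
by apply: eq_bigr => g _ /=; rewrite actM.
Qed.

Lemma traceMl u v : (forall g, act g u = u) -> trace (u * v) = u * trace v.
Proof. by move=> fu; rewrite mulr_sumr; apply: eq_bigr => g _; rewrite rmorphM fu. Qed.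

(** For each d the factor x_d g(b_d) + g(a_d) is arranged to be 1 at g = 1 and,
    if d <> 1, to be 0 at g = d; expanding the product of all these factors
    produces the monomials in the x_d and their dual elements. *)
Lemma dual_system (x : G -> F) : (forall g, g != 1%g -> act g (x g) != x g) ->
  exists mu : {set G} -> F, forall g,
    \sum_(A : {set G}) (\prod_(d in A) x d) * act g (mu A) = (g == 1%g)%:R.
Proof.
move=> xP.
pose b d := if d == 1%g then 0 else (x d - act d^-1%g (x d))^-1.
pose a d := if d == 1%g then 1 else - act d^-1%g (x d) * b d.
have xP' d : d != 1%g -> x d - act d^-1%g (x d) != 0.
  move=> d1; rewrite subr_eq0; apply: contraNneq (xP d d1) => e.
  by rewrite {1}e -actM mulgV act1.
pose mu (A : {set G}) := (\prod_(d in A) b d) * \prod_(d in ~: A) a d.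
exists mu => g.
have -> : \sum_(A : {set G}) (\prod_(d in A) x d) * act g (mu A)
    = \prod_(d : G) (x d * act g (b d) + act g (a d)).
  rewrite bigA_distr /=; apply: eq_bigr => A _; rewrite /mu rmorphM !rmorph_prod.
  rewrite mulrA -big_split /= [RHS](bigID (mem A)) /=; congr (_ * _).
    by apply: eq_bigr => d ->.
  rewrite (eq_bigl (fun d => d \notin A)) => [|d]; last by rewrite inE.
  by apply: eq_bigr => d /negbTE->.
have [->|g1] := eqVneq g 1%g.
  rewrite big1 // => d _; rewrite !act1 /a /b.
  have [_|d1] := eqVneq d 1%g; first by rewrite mulr0 add0r.
  by rewrite mulNr -mulrBl mulfV ?xP'.
rewrite (bigD1 g) //= /a /b (negbTE g1) !rmorphM rmorphN -actM mulgV act1.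
by rewrite mulNr addrN mul0r.
Qed.

Hypothesis faithful : forall g, (forall u, act g u = u) -> g = 1%g.

Lemma moved g : exists u, g != 1%g -> act g u != u.
Proof.
apply: NNPP => no; apply: (no); exists 0 => /eqP[].
apply: faithful => u; apply/eqP/negPn/negP => gu.
by apply: no; exists u.
Qed.

(** Independence of the automorphisms: evaluating a relation at the elements of
    a dual system isolates each coefficient. *)
Lemma dedekind (c : G -> F) : (forall u, \sum_g c g * act g u = 0) ->
  forall g, c g = 0.
Proof.
move=> c0 h.
have /fin_all_exists[x xP] := moved; have [mu muP] := dual_system xP.
have : \sum_(A : {set G}) act h (\prod_(d in A) x d) * \sum_g c g * act g (mu A) = 0.
  by apply: big1 => A _; rewrite c0 mulr0.
under eq_bigr => A _ do rewrite mulr_sumr.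
rewrite exchange_big /= (bigD1 h) //= [X in _ + X]big1 ?addr0 => [|g gh].
  under eq_bigr => A _ do rewrite mulrCA.
  have := congr1 (act h) (muP 1%g); rewrite eqxx rmorph1 rmorph_sum => muh.
  rewrite -mulr_sumr; under eq_bigr => A _ do rewrite -rmorphM.
  under eq_bigr => A _ do rewrite -[mu A]act1.
  by rewrite [X in _ * X]muh mulr1.
under eq_bigr => A _ do rewrite mulrCA.
have := congr1 (act h) (muP (h^-1 * g)%g).
rewrite -eq_mulVg1 eq_sym (negbTE gh) rmorph0 rmorph_sum => muh.
rewrite -mulr_sumr [X in _ * X](_ : _ = 0) ?mulr0 // -[RHS]muh.
by apply: eq_bigr => A _; rewrite rmorphM -actM mulKVg.
Qed.

Lemma dedekind_neq0 (c : G -> F) g0 : c g0 != 0 ->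
  exists u, \sum_(g : G) c g * act g u != 0.
Proof.
move=> cg0; apply: NNPP => no; case/eqP: cg0; apply: dedekind g0 => u.
by apply/eqP/negPn/negP => h; apply: no; exists u.
Qed.

Lemma trace1 : exists v, trace v = 1.
Proof.
have [|u u0] := @dedekind_neq0 (fun _ => 1) 1%g; first by rewrite oner_eq0.
have tu : \sum_g 1 * act g u = trace u by apply: eq_bigr => g _; rewrite mul1r.
rewrite tu in u0; exists ((trace u)^-1 * u); rewrite traceMl ?mulVf // => g.
by rewrite fmorphV trace_fixed.
Qed.

End Dedekind.

(** Averaging [v0 * s] writes an equivariant family as a sum of conjugates of
    arbitrary elements, whose coordinates in the dual systems are invariant.
    As those elements are unconstrained, the family can then be lifted
    equivariantly as soon as the invariant coordinates can be lifted. *)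
Lemma equivariant_expansion (G : finGroupType) (F : fieldType)
    (act : G -> {rmorphism F -> F}) (lam mu : {set G} -> F) (v0 : F)
    (C : finType) (aC : G -> C -> C) (s : C -> F) :
  (forall u, act 1%g u = u) ->
  (forall g h u, act (g * h)%g u = act g (act h u)) ->
  (forall g, \sum_(A : {set G}) lam A * act g (mu A) = (g == 1%g)%:R) ->
  trace act v0 = 1 ->
  (forall g c, s (aC g c) = act g (s c)) ->
  (forall c, aC 1%g c = c) -> (forall g h c, aC (g * h)%g c = aC g (aC h c)) ->
  forall c, s c = \sum_g act g
    (\sum_A lam A * trace act (mu A * (v0 * s (aC g^-1%g c)))).
Proof.
move=> act1 actM lamP v0P sE aC1 aCM c.
have expand u : u = \sum_A lam A * trace act (mu A * u).
  under eq_bigr => A _ do rewrite mulr_sumr.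
  rewrite exchange_big (bigD1 1%g) //= [X in _ + X]big1 ?addr0 => [|g g1].
    under eq_bigr => A _ do rewrite rmorphM mulrA.
    by rewrite -mulr_suml lamP eqxx mul1r act1.
  under eq_bigr => A _ do rewrite rmorphM mulrA.
  by rewrite -mulr_suml lamP (negbTE g1) mul0r.
under eq_bigr => g _ do rewrite -expand rmorphM -sE -aCM mulgV aC1.
by rewrite -mulr_suml -/(trace act v0) v0P mul1r.
Qed.

(** Only the coordinates need lifts: whatever these are, the sum over the group
    of the translates of the lifted expansion is equivariant. *)
Lemma equivariant_lift (G : finGroupType) (F : fieldType)
    (act : G -> {rmorphism F -> F}) (lam mu : {set G} -> F) (v0 : F)
    (C : finType) (aC : G -> C -> C) (s : C -> F)
    (R : comNzRingType) (rho : G -> {rmorphism R -> R}) (ev : {rmorphism R -> F})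
    (lt : {set G} -> R) (w : C -> {set G} -> R) :
  (forall u, act 1%g u = u) ->
  (forall g h u, act (g * h)%g u = act g (act h u)) ->
  (forall g, \sum_(A : {set G}) lam A * act g (mu A) = (g == 1%g)%:R) ->
  trace act v0 = 1 ->
  (forall g c, s (aC g c) = act g (s c)) ->
  (forall c, aC 1%g c = c) -> (forall g h c, aC (g * h)%g c = aC g (aC h c)) ->
  (forall g h p, rho (g * h)%g p = rho g (rho h p)) ->
  (forall g p, ev (rho g p) = act g (ev p)) ->
  (forall A, ev (lt A) = lam A) ->
  (forall c A, ev (w c A) = trace act (mu A * (v0 * s c))) ->
  exists st : C -> R, (forall c, ev (st c) = s c)
                   /\ (forall g c, rho g (st c) = st (aC g c)).
Proof.
move=> act1 actM lamP v0P sE aC1 aCM rhoM evG evlt evw.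
exists (fun c => \sum_g rho g (\sum_A lt A * w (aC g^-1%g c) A)); split=> [c|g c].
  rewrite (equivariant_expansion act1 actM lamP v0P sE aC1 aCM c) rmorph_sum.
  apply: eq_bigr => g _; rewrite /= evG rmorph_sum; congr (act g _).
  by apply: eq_bigr => A _; rewrite rmorphM /= evlt evw.
rewrite rmorph_sum [RHS](reindex_inj (mulgI g)) /=.
apply: eq_bigr => k _; rewrite rhoM; congr (rho g (rho k _)).
by apply: eq_bigr => A _; rewrite -aCM invMg mulgKV.
Qed.

(** * A criterion for retract rationality *)

Section Localized.

Variables (K : fieldType) (n : nat) (f : {mpoly K[n]}).
Hypothesis f0 : f != 0.
Local Notation "p %:F" := (@tofrac {mpoly K[n]} p).

Let f0F : f%:F != 0. Proof. by rewrite tofrac_eq0. Qed.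

Lemma localized_tofrac p : localized f p%:F.
Proof. by exists p, 0%N; rewrite expr0 divr1. Qed.

Lemma localizedD u v : localized f u -> localized f v -> localized f (u + v).
Proof.
move=> [p [k ->]] [q [l ->]].
exists (p * f ^+ l + q * f ^+ k), (k + l)%N.
by rewrite addf_div ?expf_neq0 // exprD tofracD !tofracM !tofracXn.
Qed.

Lemma localizedM u v : localized f u -> localized f v -> localized f (u * v).
Proof.
move=> [p [k ->]] [q [l ->]]; exists (p * q), (k + l)%N.
by rewrite mulf_div exprD tofracM.
Qed.

Lemma localizedX u k : localized f u -> localized f (u ^+ k).
Proof.
move=> fu; elim: k => [|k IH]; last by rewrite exprS; apply: localizedM.
by rewrite expr0 -tofrac1; apply: localized_tofrac.
Qed.

Lemma localized_trans f' u : f' != 0 -> localized f' (f%:F)^-1 ->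
  localized f u -> localized f' u.
Proof.
move=> f'0 [p [k e]] [q [l ->]]; exists (q * p ^+ l), (k * l)%N.
by rewrite -exprVn e expr_div_n -exprM tofracM tofracXn mulrA.
Qed.

End Localized.

(** The identity of F is assumed to lift to a section sg with values in the local
    ring of the affine space at the point y. Let b be a common denominator of
    the sg(y_k), and h the numerator of sg(b(y)), a fraction with a power of b
    as denominator. On the ring R generated by y and the inverse of b(y) h(y) the
    section takes values in the polynomial ring localized at b h, and evaluation
    at y maps this back to R. *)
Lemma retract_criterion (K A : fieldType) (i : {rmorphism K -> A})
    (F : {pred A}) N (y : 'I_N -> A) (sg : A -> {fraction {mpoly K[N]}}) :
  (forall c, i c \in F) ->
  (forall u v, u \in F -> v \in F -> u - v \in F) ->
  (forall u v, u \in F -> v \in F -> u * v \in F) ->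
  (forall u, u \in F -> u^-1 \in F) ->
  (forall k, y k \in F) ->
  (forall c, sg (i c) = tofrac c%:MP) ->
  (forall u v, u \in F -> v \in F -> sg (u + v) = sg u + sg v) ->
  (forall u v, u \in F -> v \in F -> sg (u * v) = sg u * sg v) ->
  (forall u, u \in F -> specializes (mmap i y) (sg u) u) ->
  retract_rational i F.
Proof.
move=> Fi FB FM FV Fy sgi sgD sgM sgP.
pose ev : {rmorphism {mpoly K[N]} -> A} := mmap i y.
have F0 : 0 \in F by rewrite -(rmorph0 i).
have F1 : 1 \in F by rewrite -(rmorph1 i).
have FD u v : u \in F -> v \in F -> u + v \in F.
  by move=> Fu Fv; rewrite -[v]opprK; apply: (FB) => //; rewrite -sub0r; apply: (FB).
have FX u k : u \in F -> u ^+ k \in F.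
  by move=> Fu; elim: k => [|k IH]; rewrite ?expr0 // exprS; apply: (FM).
have sg1 : sg 1 = 1 by rewrite -(rmorph1 i) sgi mpolyC1 tofrac1.
have sg0 : sg 0 = 0 by rewrite -(rmorph0 i) sgi mpolyC0 tofrac0.
have sgX u k : u \in F -> sg (u ^+ k) = sg u ^+ k.
  move=> Fu; elim: k => [|k IH]; first by rewrite !expr0.
  by rewrite !exprS sgM ?IH // FX.
have sgV u : u \in F -> u != 0 -> sg u^-1 = (sg u)^-1.
  move=> Fu u0; have e : sg u * sg u^-1 = 1 by rewrite -sgM ?mulfV // FV.
  have su0 : sg u != 0.
    by apply: contra_eqN e => /eqP->; rewrite mul0r eq_sym oner_eq0.
  by apply: (mulfI su0); rewrite e mulfV.
have [b [b0 bP]] : exists b, ev b != 0 /\ forall k, localized b (sg (y k)).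
  have /fin_all_exists[b bP] : forall k : 'I_N, exists b,
      ev b != 0 /\ localized b (sg (y k)).
    move=> k; have [p [q [q0 e _]]] := sgP _ (Fy k).
    by exists q; split=> //; exists p, 1%N; rewrite expr1.
  exists (\prod_k b k); split.
    by rewrite rmorph_prod; apply/prodf_neq0 => k _; case: (bP k).
  move=> k; have [bk0 lk] := bP k; apply: localized_trans lk.
    by apply: (@ev_neq0 _ _ ev); rewrite rmorph_prod; apply/prodf_neq0 => l _; case: (bP l).
  exists (\prod_(l | l != k) b l), 1%N; rewrite expr1 [in X in _ / X](bigD1 k) //= tofracM invfM.
  rewrite mulrCA mulfV ?mulr1 // tofrac_eq0 (@ev_neq0 _ _ ev) // rmorph_prod.
  by apply/prodf_neq0 => l _; case: (bP l).
have nzb : b != 0 := ev_neq0 b0.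
have evF p : ev p \in F.
  elim/mpolyind: p => [|c m p _ _ IH]; first by rewrite rmorph0.
  rewrite rmorphD /=; apply: (FD) => //; rewrite /ev /= mmapZ mmapX; apply: (FM) => //.
  by rewrite /mmap1; elim/big_ind: _ => // k _; apply: (FX).
have locb p : localized b (sg (ev p)).
  elim/mpolyind: p => [|c m p _ _ IH].
    by rewrite rmorph0 sg0 -tofrac0; apply: localized_tofrac.
  have Fm : mmap1 y m \in F.
    by rewrite /mmap1; elim/big_ind: _ => // k _; apply: (FX).
  rewrite rmorphD /=; rewrite sgD ?evF //; apply: localizedD => //.
  rewrite /ev /= mmapZ mmapX sgM // sgi; apply: localizedM.
    exact: localized_tofrac.
  rewrite /mmap1; elim: (index_enum _) => [|k r IHr].
    by rewrite big_nil sg1 -tofrac1; apply: localized_tofrac.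
  have Fr : \prod_(j <- r) y j ^+ m j \in F.
    by elim/big_ind: _ => // j _; apply: (FX).
  by rewrite big_cons sgM ?FX // sgX //; apply: localizedM; first apply: localizedX.
have [h [k hE]] := locb b.
have bF0 : tofrac b != 0 by rewrite tofrac_eq0.
(* specializing sg (b(y)) = h / b ^ k at y shows that h(y) is a power of b(y) *)
have evh : ev h = ev b ^+ k.+1.
  have : specializes ev (sg (ev b)) (ev h / ev b ^+ k).
    exists h, (b ^+ k); split; [by rewrite rmorphXn expf_neq0| |].
      by rewrite hE tofracXn.
    by rewrite rmorphXn.
  move/(sp_fun (sgP _ (evF b))) => e.
  by rewrite exprS {1}e mulfVK ?expf_neq0.
have h0 : ev h != 0 by rewrite evh expf_neq0.
pose f := b * h; have evf0 : ev f != 0 by rewrite rmorphM mulf_neq0.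
have nzf : f != 0 := ev_neq0 evf0.
have nzh : tofrac h != 0 by rewrite tofrac_eq0 (ev_neq0 h0).
have subf u : localized b u -> localized f u.
  apply: localized_trans => //; exists h, 1%N.
  by rewrite expr1 tofracM invfM [RHS]mulrCA (mulfV nzh) mulr1.
have locV : localized f (sg (ev f))^-1.
  have -> : ev f = ev b ^+ k.+2 by rewrite /f rmorphM evh -exprS.
  rewrite sgX // -exprVn; apply: localizedX => //.
  exists (b ^+ k.+1), 1%N.
  rewrite hE invf_div expr1 tofracM !tofracXn exprS invfM.
  by rewrite [RHS]mulrACA (mulfV bF0) mul1r.
clearbody f.
pose psi u : A := epsilon (inhabits 0) (fun v => specializes ev u v).
have psiE u v : specializes ev u v -> psi u = v.
  move=> uv; apply: sp_fun (uv).
  exact: (epsilon_spec (inhabits 0) (fun v => specializes ev u v)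
            (ex_intro _ v uv)).
have locsp u : localized f u -> exists v, specializes ev u v.
  move=> [p [l ->]]; exists (ev p / ev f ^+ l), p, (f ^+ l).
  by rewrite !rmorphXn expf_neq0.
have psiP u : localized f u -> specializes ev u (psi u).
  by move=> /locsp[v uv]; rewrite (psiE _ _ uv).
pose R u := exists p l, u = ev p / ev f ^+ l.
have RF u : R u -> u \in F.
  by move=> [p [l ->]]; rewrite FM ?evF // FV // FX.
exists R; split=> //.
- split=> [c|u v [p [l ->]] [q [m ->]]|u v [p [l ->]] [q [m ->]]].
  + by exists c%:MP, 0%N; rewrite expr0 divr1 /ev /= mmapC.
  + exists (p * f ^+ m - q * f ^+ l), (l + m)%N.
    rewrite -[- (ev q / _)]mulNr addf_div ?expf_neq0 // exprD.
    by rewrite rmorphB !rmorphM !rmorphXn mulNr.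
  + by exists (p * q), (l + m)%N; rewrite mulf_div exprD rmorphM.
- move=> u /sgP[p [q [q0 _ ->]]]; exists (ev p), (ev q); split=> //.
    by exists p, 0%N; rewrite expr0 divr1.
  by exists q, 0%N; rewrite expr0 divr1.
- exists N, f, sg, psi; split=> //.
  + split=> [u [p [l ->]]|c|u v Ru Rv|u v Ru Rv].
    * rewrite sgM ?FV ?FX // sgV ?FX ?expf_neq0 // sgX // -exprVn.
      by apply: localizedM => //; [apply: (subf) | apply: localizedX].
    * exact: sgi.
    * by apply: (sgD); apply: (RF).
    * by apply: (sgM); apply: (RF).
  + split=> [u [p [l ->]]|c|u v lu lv|u v lu lv].
    * exists p, l; apply: psiE; exists p, (f ^+ l).
      by rewrite !rmorphXn expf_neq0.
    * by apply: psiE; have := sp_tofrac ev c%:MP; rewrite /ev /= mmapC.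
    * by apply: psiE; apply: spD; apply: (psiP).
    * by apply: psiE; apply: spM; apply: (psiP).
  + by move=> u /RF/sgP/psiE.
Qed.

(** * Actions on rational function fields by monomial substitutions *)

Lemma rmorph_frac_eq (R : idomainType) (F : fieldType)
    (f g : {rmorphism {fraction R} -> F}) :
  (forall p, f (tofrac p) = g (tofrac p)) -> f =1 g.
Proof. by move=> fg u; have [p [q [_ ->]]] := fracP u; rewrite !fmorph_div !fg. Qed.

Lemma rmorph_mpoly_eq (R : nzRingType) (S : comNzRingType) n
    (f g : {rmorphism {mpoly R[n]} -> S}) :
  (forall c, f c%:MP = g c%:MP) -> (forall i, f 'X_i = g 'X_i) -> f =1 g.
Proof.
move=> fgC fgX; elim/mpolyind => [|c m p _ _ IH]; first by rewrite !rmorph0.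
rewrite !rmorphD /= IH -mul_mpolyC !rmorphM /= fgC mpolyXE_id !rmorph_prod.
by congr (_ * _ + _); apply: eq_bigr => i _; rewrite !rmorphXn fgX.
Qed.

Lemma rmorph_ratfun_eq (L F : fieldType) n
    (f g : {rmorphism {fraction {mpoly L[n]}} -> F}) :
  (forall c, f (tofrac c%:MP) = g (tofrac c%:MP)) ->
  (forall i, f (tofrac 'X_i) = g (tofrac 'X_i)) -> f =1 g.
Proof.
move=> fgC fgX; apply: rmorph_frac_eq => p.
have := @rmorph_mpoly_eq _ _ _ (f \o @tofrac _) (g \o @tofrac _).
by apply.
Qed.

Lemma injective_rmorph (R S : nzRingType) (f : {rmorphism R -> S}) :
  (forall p, f p = 0 -> p = 0) -> injective f.
Proof.
move=> f0 p q /eqP; rewrite -subr_eq0 -rmorphB => /eqP/f0/eqP.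
by rewrite subr_eq0 => /eqP.
Qed.

Lemma prodrXz (F : fieldType) (I : Type) (r : seq I) (P : pred I)
    (x : I -> F) (k : int) :
  \prod_(i <- r | P i) x i ^ k = (\prod_(i <- r | P i) x i) ^ k.
Proof.
apply: (big_rec2 (fun u v => u = v ^ k)); first by rewrite exp1rz.
by move=> i u v _ ->; rewrite expfzMl.
Qed.

Lemma expr_sumz (F : fieldType) (I : Type) (r : seq I) (P : pred I)
    (x : F) (k : I -> int) : x != 0 ->
  \prod_(i <- r | P i) x ^ k i = x ^ (\sum_(i <- r | P i) k i).
Proof.
move=> x0; apply: (big_rec2 (fun u v => u = x ^ v)); first by rewrite expr0z.
by move=> i u v _ ->; rewrite expfzDr.
Qed.

Section MonomialAction.

Variables (L : fieldType) (n : nat) (G : finGroupType).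
Variables (aL : G -> {rmorphism L -> L}) (a : G -> 'M[int]_n).
Hypothesis aL1 : forall l, aL 1%g l = l.
Hypothesis aLM : forall g h l, aL (g * h)%g l = aL g (aL h l).
Hypothesis a1 : a 1%g = 1%:M.
Hypothesis aM : forall g h, a (g * h)%g = a g *m a h.

Local Notation LX := {fraction {mpoly L[n]}}.
Local Notation "p %:F" := (@tofrac {mpoly L[n]} p).

Definition ratfun_const : {rmorphism L -> LX} := @tofrac {mpoly L[n]} \o @mpolyC n L.

Definition laurent (e : 'I_n -> int) : LX := \prod_i ('X_i)%:F ^ e i.

Lemma XF_neq0 i : ('X_i)%:F != 0 :> LX.
Proof. by rewrite tofrac_eq0 -msize_poly_eq0 msizeX. Qed.

Lemma laurent_neq0 e : laurent e != 0.
Proof. by apply/prodf_neq0 => i _; rewrite expfz_neq0 ?XF_neq0. Qed.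

Lemma laurentD e1 e2 : laurent (fun i => e1 i + e2 i) = laurent e1 * laurent e2.
Proof.
by rewrite /laurent -big_split; apply: eq_bigr => i _; rewrite expfzDr ?XF_neq0.
Qed.

Lemma eq_laurent e1 e2 : e1 =1 e2 -> laurent e1 = laurent e2.
Proof. by move=> e; apply: eq_bigr => i _; rewrite e. Qed.

Lemma laurent_mnm (m : 'X_{1..n}) : laurent (fun i => m i : int) = ('X_[m])%:F.
Proof.
by rewrite mpolyXE_id rmorph_prod; apply: eq_bigr => i _ /=; rewrite rmorphXn.
Qed.

Lemma prod_laurent (J : finType) (e : J -> 'I_n -> int) (k : J -> int) :
  \prod_j laurent (e j) ^ k j = laurent (fun i => \sum_j e j i * k j).
Proof.
rewrite /laurent.
under eq_bigr => j _ do rewrite -prodrXz.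
rewrite exchange_big; apply: eq_bigr => i _ /=.
under eq_bigr => j _ do rewrite exprz_exp.
by rewrite expr_sumz ?XF_neq0.
Qed.

Definition subst g : {rmorphism {mpoly L[n]} -> LX} :=
  mmap (ratfun_const \o aL g) (fun j => laurent (fun i => a g i j)).

Lemma substC g c : subst g c%:MP = ratfun_const (aL g c).
Proof. by rewrite /subst /= mmapC. Qed.

Lemma substX g j : subst g 'X_j = laurent (fun i => a g i j).
Proof. by rewrite /subst /= mmapX mmap1U. Qed.

Lemma substXm g m : subst g 'X_[m] = laurent (fun i => \sum_j a g i j * m j).
Proof. by rewrite -(prod_laurent (fun j i => a g i j)) /subst /= mmapX. Qed.

(** The exponents of the image are cleared by a large monomial; the substitution
    of the inverse group element then brings back p times a unit. *)
Lemma subst_inj g : injective (subst g).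
Proof.
apply: injective_rmorph => p gp0.
pose A (m : 'X_{1..n}) i := \sum_j a g i j * m j.
pose B : int := \sum_(m <- msupp p) \sum_i `|A m i|.
pose e (m : 'X_{1..n}) := [multinom absz (B + A m i)%R | i < n].
have eE m i : m \in msupp p -> (e m i : int) = B + A m i.
  move=> mp; rewrite mnmE abszE Num.Theory.ger0_norm //.
  have h (x y : int) : `|y| <= x -> 0 <= x + y.
    by move=> xy; rewrite -Num.Theory.lerBlDr sub0r; have := Num.Theory.ler_norm (- y);
      rewrite Num.Theory.normrN => /Order.POrderTheory.le_trans; apply.
  apply: h; rewrite /B (perm_big _ (perm_to_rem mp)) big_cons (bigD1 i) //=.
  rewrite -addrA Num.Theory.lerDl Num.Theory.addr_ge0 //.
    by apply: Num.Theory.sumr_ge0 => k _; rewrite Num.Theory.normr_ge0.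
  apply: Num.Theory.sumr_ge0 => m' _; apply: Num.Theory.sumr_ge0 => k _.
  exact: Num.Theory.normr_ge0.
have P0 : \sum_(m <- msupp p) aL g p@_m *: 'X_[e m] = 0.
  apply/eqP; rewrite -tofrac_eq0 rmorph_sum; apply/eqP.
  transitivity (laurent (fun _ => B) * subst g p); last by rewrite gp0 mulr0.
  rewrite [in RHS](mpolyE p) rmorph_sum mulr_sumr big_seq [RHS]big_seq.
  apply: eq_bigr => m mp /=; rewrite -!mul_mpolyC !rmorphM /= substC substXm.
  rewrite mulrCA -laurentD -laurent_mnm; congr (_ * _).
  by apply: eq_laurent => i; rewrite eE.
pose D := laurent (fun i => \sum_j a g^-1%g i j * B).
have : D * p%:F = 0.
  transitivity (subst g^-1%g (\sum_(m <- msupp p) aL g p@_m *: 'X_[e m])).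
    rewrite rmorph_sum [in LHS](mpolyE p) rmorph_sum mulr_sumr.
    rewrite big_seq [RHS]big_seq; apply: eq_bigr => m mp /=.
    rewrite -!mul_mpolyC !rmorphM /= substC substXm -aLM mulVg aL1 mulrCA.
    congr (_ * _); rewrite -laurent_mnm -laurentD; apply: eq_laurent => i.
    under [RHS]eq_bigr => j _ do rewrite eE // mulrDr.
    rewrite big_split; congr (_ + _); rewrite /A.
    under eq_bigr => j _ do rewrite mulr_sumr.
    have aV k : \sum_j a g^-1%g i j * a g j k = (i == k)%:R.
      by have /matrixP/(_ i k) := aM g^-1%g g; rewrite mulVg a1 !mxE => <-.
    rewrite exchange_big /= (bigD1 i) //= [X in _ + X]big1 ?addr0.
      under eq_bigr => j _ do rewrite mulrA.
      by rewrite -mulr_suml aV eqxx mul1r.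
    move=> k ki; under eq_bigr => j _ do rewrite mulrA.
    by rewrite -mulr_suml aV eq_sym (negbTE ki) mul0r.
  by rewrite P0 rmorph0.
move/eqP; rewrite mulf_eq0 (negbTE (laurent_neq0 _)) /= tofrac_eq0.
by move/eqP.
Qed.

Definition mono_act g : {rmorphism LX -> LX} := frac_lift (@subst_inj g).

Lemma mono_actE g u : mono_act g u = mul_act (aL g) (a g) u.
Proof. by []. Qed.

Lemma mono_actC g c : mono_act g (ratfun_const c) = ratfun_const (aL g c).
Proof. by rewrite /mono_act /= frac_lift_tofrac substC. Qed.

Lemma mono_actX g j : mono_act g ('X_j)%:F = laurent (fun i => a g i j).
Proof. by rewrite /mono_act /= frac_lift_tofrac substX. Qed.

Lemma mono_act_laurent g e :
  mono_act g (laurent e) = laurent (fun i => \sum_j a g i j * e j).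
Proof.
rewrite -(prod_laurent (fun j i => a g i j)) rmorph_prod.
by apply: eq_bigr => i _; rewrite -[RHS]/(_ ^ _) -mono_actX -fmorphXz.
Qed.

Lemma mono_act1 u : mono_act 1%g u = u.
Proof.
apply: (@rmorph_ratfun_eq _ _ _ (mono_act 1%g) idfun) => [c|i] /=.
  by rewrite mono_actC aL1.
rewrite mono_actX a1 /laurent (bigD1 i) //= mxE eqxx big1 ?mulr1 // => k ki.
by rewrite mxE (negbTE ki).
Qed.

Lemma mono_actM g h u : mono_act (g * h)%g u = mono_act g (mono_act h u).
Proof.
apply: (@rmorph_ratfun_eq _ _ _ (mono_act (g * h)%g)
          (mono_act g \o mono_act h)) => [c|i] /=.
  by rewrite !mono_actC aLM.
rewrite !mono_actX mono_act_laurent; apply: eq_laurent => k.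
by rewrite aM mxE.
Qed.

End MonomialAction.

(** Multiplying by a monomial turns this into the independence of monomials
    with nonnegative exponents. *)
Lemma laurent_inj (L : fieldType) n (e e' : 'I_n -> int) :
  laurent L e = laurent L e' -> e =1 e'.
Proof.
pose pos (k : int) : nat := if k is Posz l then l else 0.
pose neg (k : int) : nat := if k is Negz l then l.+1 else 0.
have pn k : k + neg k = pos k :> int by case: k => l; rewrite ?addr0 // NegzE addNr.
move=> ee' i.
pose mnm (f g : 'I_n -> int) := [multinom (pos (f i) + neg (g i))%N | i < n].
have mE f g : laurent L (fun i => f i + (neg (f i) + neg (g i))%N) = tofrac 'X_[mnm f g].
  rewrite -laurent_mnm; apply: eq_laurent => k.
  by rewrite mnmE !PoszD addrA pn.
have : 'X_[mnm e e'] = 'X_[mnm e' e] :> {mpoly L[n]}.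
  apply/eqP; rewrite -tofrac_eq -!mE !laurentD ee'.
  by apply/eqP; congr (_ * _); apply: eq_laurent => k; rewrite addnC.
move/(congr1 (mcoeff (mnm e e'))); rewrite !mcoeffX eqxx.
case: eqP => [/mnmP/(_ i)|_ /eqP]; last by rewrite oner_eq0.
rewrite !mnmE => /(congr1 Posz) eq _; apply: (addIr (neg (e i) + neg (e' i))%N%:Z).
by rewrite PoszD addrA pn [X in _ = _ + X]addrC addrA pn -!PoszD eq.
Qed.

(** * Extension of scalars *)

Section ScalarExtension.

Variables (L L' : fieldType) (n : nat) (j : {rmorphism L -> L'}).

Local Notation LX := {fraction {mpoly L[n]}}.
Local Notation LX' := {fraction {mpoly L'[n]}}.

Definition extend_poly : {rmorphism {mpoly L[n]} -> LX'} :=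
  @tofrac {mpoly L'[n]} \o map_mpoly j.

Lemma extend_poly_inj : injective extend_poly.
Proof.
apply: injective_rmorph => p /= /eqP; rewrite tofrac_eq0 => /eqP pj0.
apply/mpolyP => m; apply: (fmorph_inj j); rewrite mcoeff0 rmorph0.
by rewrite -mcoeff_map_mpoly pj0 mcoeff0.
Qed.

Definition extend_ratfun : {rmorphism LX -> LX'} := frac_lift extend_poly_inj.

Lemma extend_tofrac p : extend_ratfun (tofrac p) = tofrac (map_mpoly j p).
Proof. exact: frac_lift_tofrac. Qed.

Lemma extend_const l : extend_ratfun (ratfun_const L n l) = ratfun_const L' n (j l).
Proof. by rewrite extend_tofrac map_mpolyC. Qed.

Lemma extendX i : extend_ratfun (tofrac 'X_i) = tofrac 'X_i.
Proof. by rewrite extend_tofrac map_mpolyX. Qed.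

Lemma extend_laurent e : extend_ratfun (laurent L e) = laurent L' e.
Proof.
by rewrite rmorph_prod; apply: eq_bigr => i _; rewrite fmorphXz -extendX.
Qed.

Lemma extend_equivariant (a : 'M[int]_n) (s : L -> L) (s' : L' -> L')
    (act : {rmorphism LX -> LX}) (act' : {rmorphism LX' -> LX'}) :
  (forall l, act (ratfun_const L n l) = ratfun_const L n (s l)) ->
  (forall i, act (tofrac 'X_i) = laurent L (fun k => a k i)) ->
  (forall l, act' (ratfun_const L' n l) = ratfun_const L' n (s' l)) ->
  (forall i, act' (tofrac 'X_i) = laurent L' (fun k => a k i)) ->
  (forall l, s' (j l) = j (s l)) ->
  forall u, extend_ratfun (act u) = act' (extend_ratfun u).
Proof.
move=> actC actX actC' actX' sj.
apply: (@rmorph_ratfun_eq _ _ _ (extend_ratfun \o act) (act' \o extend_ratfun)) => [l|i].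
  rewrite -[LHS]/(extend_ratfun (act (ratfun_const L n l))) actC extend_const.
  by rewrite -sj -actC' -extend_const.
by rewrite -[LHS]/(extend_ratfun (act (tofrac 'X_i))) actX extend_laurent -actX' -extendX.
Qed.

(** An invariant fraction has an expression with invariant terms, whose
    coefficients then lie in L. *)
Lemma extend_descent (G : finGroupType) (aL : G -> {rmorphism L' -> L'})
    (act : G -> {rmorphism LX' -> LX'}) :
  (forall l, aL 1%g l = l) -> (forall g h l, aL (g * h)%g l = aL g (aL h l)) ->
  (forall l, (forall g, aL g l = l) -> exists k, l = j k) ->
  (forall g l, act g (ratfun_const L' n l) = ratfun_const L' n (aL g l)) ->
  (forall g i, act g (tofrac 'X_i) = tofrac 'X_i) ->
  forall u, (forall g, act g u = u) -> exists v, u = extend_ratfun v.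
Proof.
move=> aL1 aLM fixL actC actX u fu.
pose rho g : {rmorphism {mpoly L'[n]} -> {mpoly L'[n]}} := map_mpoly (aL g).
have actp g p : act g (tofrac p) = tofrac (rho g p).
  apply: (@rmorph_mpoly_eq _ _ _ (act g \o @tofrac _) (@tofrac _ \o rho g)) => [c|i].
    by rewrite [LHS](actC g c) /= map_mpolyC.
  by rewrite [LHS](actX g i) /= map_mpolyX.
have rho1 p : rho 1%g p = p.
  by apply/mpolyP => m; rewrite mcoeff_map_mpoly; apply: aL1.
have rhoM g h p : rho (g * h)%g p = rho g (rho h p).
  by apply/mpolyP => m; rewrite !mcoeff_map_mpoly; apply: aLM.
have [p [q [q0 uE]]] := fracP u.
have qF (q1 : {mpoly L'[n]}) : q1 != 0 -> tofrac q1 != 0 by rewrite tofrac_eq0.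
have rho_neq0 g (q1 : {mpoly L'[n]}) : q1 != 0 -> rho g q1 != 0.
  by apply: contraNneq => e; rewrite -(rho1 q1) -(mulVg g) rhoM e rmorph0.
have pq g : p * rho g q = rho g p * q.
  apply/eqP; rewrite -tofrac_eq !tofracM -(eqr_div _ _ (qF _ q0) (qF _ (rho_neq0 g q q0))).
  by rewrite -!actp -fmorph_div -uE fu eqxx.
have [p' [q' [q'E fp fq e]]] := invariant_fraction rho1 rhoM q0 pq.
have [p0 p0E] := mpoly_descent fixL fp.
have [r0 r0E] := mpoly_descent fixL fq.
have q'0 : q' != 0 by rewrite q'E; apply/prodf_neq0 => g _; apply: rho_neq0.
exists (tofrac p0 / tofrac r0); rewrite fmorph_div !extend_tofrac -p0E -r0E uE.
by apply/eqP; rewrite (eqr_div _ _ (qF _ q0) (qF _ q'0)) -!tofracM e.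
Qed.

End ScalarExtension.

(** * Characters of a lattice that factor through a permutation lattice *)

Section PermFactors.

Variables (F : fieldType) (G1 H : finGroupType).
Variable act : G1 * H -> {rmorphism F -> F}.
Hypothesis act1 : forall u, act 1%g u = u.
Hypothesis actM : forall g h u, act (g * h)%g u = act g (act h u).

Definition is_action (T : Type) (aT : G1 -> T -> T) :=
  (forall x, aT 1%g x = x) /\ (forall g h x, aT (g * h)%g x = aT g (aT h x)).

Definition shift (T : finType) (aT : G1 -> T -> T) g (x : {ffun T -> int}) :=
  [ffun u => x (aT g^-1%g u)].

Definition factorization (T : finType) (aT : G1 -> T -> T)
    (J : {ffun T -> int} -> Prop) (phi : {ffun T -> int} -> F)
    (Y : finType) (aY : G1 -> Y -> Y) (eps : Y -> F)
    (kap : {ffun T -> int} -> Y -> int) : Prop :=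
  [/\ is_action aY,
      forall y, eps y != 0 /\ forall g h, act (g, h) (eps y) = eps (aY g y),
      forall x x', J x -> J x' -> forall y, kap (x + x') y = kap x y + kap x' y,
      forall g x, J x -> forall y, kap (shift aT g x) (aY g y) = kap x y
    & forall x, J x -> phi x = \prod_y eps y ^ kap x y].

(** [phi], restricted to a sublattice J of the permutation lattice on T, is the
    composite of an equivariant map from J to the permutation lattice on Y and
    an equivariant map sending Y to the units of the field fixed by H. The
    point is that values on a basis Y can be lifted independently. *)
Definition perm_factors (T : finType) (aT : G1 -> T -> T)
    (J : {ffun T -> int} -> Prop) (phi : {ffun T -> int} -> F) : Prop :=
  exists Y aY eps kap, @factorization T aT J phi Y aY eps kap.

Section Closure.

Variables (T : finType) (aT : G1 -> T -> T).
Implicit Types (J : {ffun T -> int} -> Prop) (phi : {ffun T -> int} -> F).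

Lemma pf_ext J J' phi phi' : (forall x, J' x -> J x) ->
  (forall x, J' x -> phi' x = phi x) ->
  perm_factors aT J phi -> perm_factors aT J' phi'.
Proof.
move=> JJ pp [Y [aY [eps [kap [aYP epsP kD kE kP]]]]].
exists Y, aY, eps, kap; split=> //.
- by move=> x x' /JJ jx /JJ jx'; apply: kD.
- by move=> g x /JJ jx; apply: kE.
- by move=> x jx; rewrite pp // kP //; apply: JJ.
Qed.

Lemma pf_mul J phi phi' : perm_factors aT J phi -> perm_factors aT J phi' ->
  perm_factors aT J (fun x => phi x * phi' x).
Proof.
move=> [Y [aY [eps [kap [[aY1 aYM] epsP kD kE kP]]]]].
move=> [Y' [aY' [eps' [kap' [[aY1' aYM'] epsP' kD' kE' kP']]]]].
pose aS g (y : Y + Y') : Y + Y' :=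
  match y with inl u => inl (aY g u) | inr u => inr (aY' g u) end.
pose eS (y : Y + Y') := match y with inl u => eps u | inr u => eps' u end.
pose kS x (y : Y + Y') := match y with inl u => kap x u | inr u => kap' x u end.
exists (Y + Y')%type, aS, eS, kS; split.
- by split=> [[y|y]|g h [y|y]] /=; rewrite ?aY1 ?aY1' ?aYM ?aYM'.
- by case=> y /=; [case: (epsP y) | case: (epsP' y)] => y0 fy; split=> // g h; rewrite fy.
- by move=> x x' jx jx' [y|y] /=; [apply: kD | apply: kD'].
- by move=> g x jx [y|y] /=; [apply: kE | apply: kE'].
- by move=> x jx; rewrite big_sumType /= kP // kP'.
Qed.

Lemma pf_exp J phi (k : int) : perm_factors aT J phi ->
  perm_factors aT J (fun x => phi x ^ k).
Proof.
move=> [Y [aY [eps [kap [aYP epsP kD kE kP]]]]].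
exists Y, aY, eps, (fun x y => kap x y * k); split=> //.
- by move=> x x' jx jx' y; rewrite kD // mulrDl.
- by move=> g x jx y; rewrite kE.
- by move=> x jx; rewrite kP // -prodrXz; apply: eq_bigr => y _; rewrite exprz_exp.
Qed.

End Closure.

Definition push (T T' : finType) (f : T -> T') (x : {ffun T -> int}) :
  {ffun T' -> int} := [ffun u => \sum_(v | f v == u) x v].

Lemma pushD (T T' : finType) (f : T -> T') x y :
  push f (x + y) = push f x + push f y.
Proof.
apply/ffunP => u; rewrite !ffunE -big_split.
by apply: eq_bigr => v _; rewrite ffunE.
Qed.

Lemma prod_push (T T' : finType) (f : T -> T') (w : T' -> F) x :
  (forall u, w u != 0) ->
  \prod_u w u ^ push f x u = \prod_v w (f v) ^ x v.
Proof.
move=> w0; rewrite [RHS](partition_big f xpredT) //=.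
apply: eq_bigr => u _; rewrite ffunE -expr_sumz //.
by apply: eq_bigr => v /eqP->.
Qed.

Lemma sum_push (T T' : finType) (f : T -> T') (w : T' -> int) x :
  \sum_u w u * push f x u = \sum_v w (f v) * x v.
Proof.
rewrite [RHS](partition_big f xpredT) //=.
apply: eq_bigr => u _; rewrite ffunE mulr_sumr.
by apply: eq_bigr => v /eqP->.
Qed.

Lemma push_shift (T T' : finType) (aT : G1 -> T -> T) (aT' : G1 -> T' -> T')
    (f : T -> T') g x :
  is_action aT -> is_action aT' -> (forall g u, f (aT g u) = aT' g (f u)) ->
  push f (shift aT g x) = shift aT' g (push f x).
Proof.
move=> [aT1 aTM] [aT1' aTM'] fE; apply/ffunP => u; rewrite !ffunE.
have aTK h : cancel (aT h) (aT h^-1%g) by move=> v; rewrite -aTM mulVg aT1.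
have aTK' h : cancel (aT' h) (aT' h^-1%g) by move=> v; rewrite -aTM' mulVg aT1'.
rewrite [RHS](reindex_inj (can_inj (aTK g^-1%g))) /=.
apply: eq_big => [v|v _]; last by rewrite ffunE.
by rewrite fE (inj_eq (can_inj (aTK' _))).
Qed.

Lemma pf_push (T T' : finType) (aT : G1 -> T -> T) (aT' : G1 -> T' -> T')
    (f : T -> T') J phi :
  is_action aT -> is_action aT' -> (forall g u, f (aT g u) = aT' g (f u)) ->
  perm_factors aT' J phi ->
  perm_factors aT (fun x => J (push f x)) (fun x => phi (push f x)).
Proof.
move=> aTP aTP' fE [Y [aY [eps [kap [aYP epsP kD kE kP]]]]].
exists Y, aY, eps, (fun x => kap (push f x)); split=> //.
- by move=> x x' jx jx' y; rewrite pushD kD.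
- by move=> g x jx y; rewrite (push_shift _ _ aTP aTP' fE) kE.
- by move=> x jx; rewrite kP.
Qed.

Lemma pf_free (T : finType) (aT : G1 -> T -> T) (w : T -> F) J :
  is_action aT ->
  (forall u, w u != 0 /\ forall g h, act (g, h) (w u) = w (aT g u)) ->
  perm_factors aT J (fun x => \prod_u w u ^ x u).
Proof.
move=> aTP wP; exists T, aT, w, (fun x u => x u); split=> //.
  by move=> x x' _ _ u; rewrite ffunE.
by move=> g x _ u; case: aTP => a1 aM; rewrite ffunE -aM mulVg a1.
Qed.

Lemma pf_family (I : finType) (J : I -> {ffun G1 -> int} -> Prop)
    (phi : I -> {ffun G1 -> int} -> F) (lm : G1 -> G1 -> G1) :
  (forall i, perm_factors lm (J i) (phi i)) ->
  let comp (x : {ffun I * G1 -> int}) i := [ffun g => x (i, g)] in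
  perm_factors (fun g (u : I * G1) => (u.1, lm g u.2))
    (fun x => forall i, J i (comp x i)) (fun x => \prod_i phi i (comp x i)).
Proof.
move=> pf comp.
pose R (i : I) (S : {Y : finType & ((G1 -> Y -> Y) * (Y -> F)
                        * ({ffun G1 -> int} -> Y -> int))%type}) :=
  let: existT Y (aY, eps, kap) := S in
  factorization lm (J i) (phi i) aY eps kap.
have /fin_all_exists[S SP] : forall i, exists S, R i S.
  move=> i; have [Y [aY [eps [kap h]]]] := pf i.
  by exists (existT _ Y (aY, eps, kap)).
pose Y i := projT1 (S i).
pose aY i : G1 -> Y i -> Y i := (projT2 (S i)).1.1.
pose eps i : Y i -> F := (projT2 (S i)).1.2.
pose kap i : {ffun G1 -> int} -> Y i -> int := (projT2 (S i)).2.
have P i : factorization lm (J i) (phi i) (aY i) (eps i) (kap i).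
  by have := SP i; rewrite /R /kap /eps /aY /Y; case: (S i) => ? [[? ?] ?].
pose YY := {i : I & Y i}.
pose aYY g (y : YY) : YY := Tagged Y (aY _ g (tagged y)).
exists YY, aYY, (fun y => eps _ (tagged y)),
  (fun x (y : YY) => kap _ (comp x (tag y)) (tagged y)); split.
- split=> [[i y]|g h [i y]]; rewrite /aYY /=; case: (P i) => [[a1 aM] _ _ _ _].
    by rewrite a1.
  by rewrite aM.
- by move=> [i y] /=; case: (P i) => _ /(_ y).
- move=> x x' jx jx' [i y] /=; case: (P i) => _ _ kD _ _.
  have -> : comp (x + x') i = comp x i + comp x' i.
    by apply/ffunP => g; rewrite !ffunE.
  exact: kD.
- move=> g x jx [i y] /=; case: (P i) => _ _ _ kE _.
  have -> : comp (shift (fun g (u : I * G1) => (u.1, lm g u.2)) g x) i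
            = shift lm g (comp x i).
    by apply/ffunP => k; rewrite !ffunE.
  exact: kE.
- move=> x jx; rewrite -(sig_big_dep xpredT (fun _ => xpredT)
    (fun i y => eps i y ^ kap i (comp x i) y)) /=.
  by apply: eq_bigr => i _; case: (P i) => _ _ _ _ ->.
Qed.

End PermFactors.

(** * Orders modulo prime powers *)

Section Orders.

Local Open Scope nat_scope.

(** In the binomial expansion of (1 + v) ^ p all terms beyond 1 + p v are
    multiples of p ^ 2 v, the last one because p > 2. *)
Lemma prime_lift_one p a v : prime p -> odd p -> p %| v ->
  p * p ^ a %| v.+1 ^ p - 1 -> p ^ a %| v.
Proof.
move=> pp po pv; have p2 : 2 < p by rewrite odd_prime_gt2.
have [k kE] : exists k, v.+1 ^ p - 1 = p * v * (1 + p * k).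
  have : p * (p * v) %| \sum_(i < p.-1) 'C(p, i.+2) * v ^ i.+2.
    apply: dvdn_sum => i _.
    have [/eqP ip|ip] := boolP (i.+2 == p :> nat).
      have i0 : 0 < i by rewrite -ip in p2.
      apply: dvdn_mull; rewrite expnS expnSr; apply: dvdn_mul => //.
      by apply: dvdn_mul => //; rewrite dvdn_exp.
    have lip : i.+2 < p.
      by rewrite ltn_neqAle ip -ltn_predRL ltn_ord.
    apply: dvdn_mul; first by rewrite prime_dvd_bin.
    by rewrite !expnS mulnA dvdn_mulr // dvdn_mul.
  case/dvdnP=> k kE; exists k.
  rewrite -addn1 addnC expnDn -(ltn_predK p2) /=.
  rewrite !big_ord_recl /= bin0 subn0 exp1n expn0 !muln1 /bump /=.
  rewrite addKn addn0 bin1 exp1n expn1 mul1n (ltn_predK p2).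
  under eq_bigr => i _ do rewrite exp1n mul1n !add1n.
  by rewrite kE; ring.
rewrite kE -mulnA dvdn_pmul2l ?prime_gt0 // Gauss_dvdl // coprimeXl //.
by rewrite prime_coprime // dvdn_addl ?dvdn_mulr // dvdn1; case: p p2 {pp po pv kE} => [|[]].
Qed.

(** If every lift t' of t has t' ^ d = 1 modulo p ^ (a+1), then p divides d and
    s = t ^ (d / p) is a nontrivial p-th root of 1 modulo p ^ (a+1) which is
    not 1 modulo p ^ a. That is impossible for odd p and forces s = -1 for
    p = 2; as -1 is no square modulo 4, the order of t is then 2. *)
Lemma order_lift p a t d : prime p -> 0 < a -> 0 < d -> t ^ d = 1 %[mod p ^ a] ->
  (forall k, 0 < k < d -> t ^ k <> 1 %[mod p ^ a]) ->
  (exists t' r, [/\ t' = t %[mod p ^ a], t' ^ d = 1 + p ^ a * r & coprime r p])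
  \/ [/\ p = 2, d = 2 & p ^ a %| t.+1].
Proof.
move=> pp a0 d0 td dmin; set q := p ^ a in td dmin *.
have q1 : 1 < q by rewrite -(exp1n a) ltn_exp2r ?prime_gt1.
have pq : p %| q by rewrite dvdn_exp.
have lift t' : t' = t %[mod q] -> exists r, t' ^ d = 1 + q * r.
  move=> t't; have e : t' ^ d = 1 %[mod q] by rewrite -modnXm t't modnXm.
  exists (t' ^ d %/ q); rewrite {1}(divn_eq (t' ^ d) q) e modn_small //.
  by rewrite addnC mulnC.
have [r0 r0E] := lift t erefl.
have [r1 r1E] := lift (t + q) (modnDr t q).
have [c0|c0] := boolP (coprime r0 p); first by left; exists t, r0.
have [c1|c1] := boolP (coprime r1 p).
  by left; exists (t + q), r1; rewrite modnDr.
right; move: c0 c1; rewrite ![coprime _ p]coprime_sym !prime_coprime // !negbK => pr0 pr1.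
have pt : ~~ (p %| t).
  apply/negP => pt; have : p %| 1 + q * r0 by rewrite -r0E dvdn_exp.
  by rewrite dvdn_addl ?dvdn_mulr // dvdn1 => /eqP p1; rewrite p1 in pp.
have pd : p %| d.
  have : p * q %| (t + q) ^ d - t ^ d.
    by rewrite r1E r0E subnDl -mulnBr mulnC dvdn_mul // dvdn_sub.
  rewrite subn_exp addKn [q * _]mulnC dvdn_pmul2r ?(ltnW q1) //.
  have e : \sum_(i < d) (t + q) ^ (d.-1 - i) * t ^ i = d * t ^ d.-1 %[mod p].
    have -> : d * t ^ d.-1 = \sum_(i < d) t ^ d.-1 by rewrite sum_nat_const card_ord.
    apply: (big_rec2 (fun x y => x = y %[mod p])) => // i x y _ xy.
    rewrite -modnDm xy modnDm; apply/eqP; rewrite eqn_modDr; apply/eqP.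
    have -> : t ^ d.-1 = t ^ (d.-1 - i) * t ^ i.
      by rewrite -expnD subnK // -ltnS prednK.
    by rewrite -[LHS]modnMml -modnXm -(modnDmr t) (eqP pq) addn0 modnXm modnMml.
  by rewrite /dvdn e -/(dvdn _ _) Euclid_dvdM // Euclid_dvdX // (negbTE pt) /= orbF.
case/dvdnP: pd => e de; have e0 : 0 < e by case: e de d0 => // ->.
have ed : e < d by rewrite de -{1}[e]muln1 ltn_pmul2l ?prime_gt1.
have t0 : 0 < t by case: t pt {td dmin lift r0E r1E}; rewrite ?dvdn0.
have [v vE] : exists v, t ^ e = v.+1 by exists (t ^ e).-1; rewrite prednK ?expn_gt0 ?t0.
have nv : ~~ (q %| v).
  apply/negP => qv; case: (dmin e); first by rewrite e0.
  by rewrite vE -addn1 -modnDml (eqP qv).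
have sp : p * q %| v.+1 ^ p - 1.
  by rewrite -vE -expnM -de r0E addKn mulnC dvdn_mul.
have [po|po] := boolP (odd p).
  case/negP: nv; apply: (prime_lift_one pp po) => //.
  have : p %| v.+1 ^ p - 1 by apply: dvdn_trans sp; apply: dvdn_mulr.
  rewrite -eqn_mod_dvd ?expn_gt0 // => /eqP e1.
  have := fermat_little v.+1 pp; rewrite e1 => /eqP.
  by rewrite eq_sym eqn_mod_dvd // subn1.
have p2 : p = 2 by case: (even_prime pp) => // po'; rewrite po' in po.
have q_2 : q = 2 ^ a by rewrite /q p2.
have vodd : ~~ odd v.
  have : odd (t ^ e) by rewrite oddX -[odd t]negbK -dvdn2 -p2 pt orbT.
  by rewrite vE.
have [w wE] : exists w, v = w.*2 by exists v./2; rewrite even_halfK.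
have sq : q %| w * (w + 1) * 2.
  have e4 : v.+1 ^ p = 1 + 2 * (w * (w + 1) * 2).
    by rewrite p2 wE -addn1 -muln2; ring.
  by move: sp; rewrite e4 addKn p2 dvdn_pmul2l.
have wodd : odd w.
  apply/negPn/negP => we; case/negP: nv.
  move: sq; rewrite mulnAC Gauss_dvdl; first by rewrite wE -muln2.
  by rewrite q_2 coprimeXl // coprime2n addn1 /= we.
have qt : q %| v.+2.
  move: sq; rewrite -mulnA Gauss_dvdr; first by rewrite wE addn1 muln2 doubleS.
  by rewrite q_2 coprimeXl // coprime2n.
have e1 : e = 1.
  have eodd : odd e.
    apply/negPn/negP => ee; have : odd (t ^ e./2) by
      rewrite oddX -[odd t]negbK -dvdn2 -p2 pt orbT.
    move=> to; have : v.+1 = ((t ^ e./2) ^ 2) by rewrite -expnM muln2 even_halfK // vE.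
    rewrite -(odd_double_half (t ^ e./2)) to; set k := _./2 => /= vk.
    have wk : w = (k * k.+1).*2.
      by apply: double_inj; rewrite -wE; apply: succn_inj; rewrite vk -!muln2; ring.
    by rewrite wk odd_double in wodd.
  have : t ^ totient q = 1 %[mod q].
    by apply: Euler_exp_totient; rewrite q_2 coprimeXr // -p2 coprime_sym prime_coprime.
  have -> : t ^ totient q = (t ^ d) ^ (totient q %/ d) * t ^ (totient q %% d).
    by rewrite -expnM -expnD [d * _]mulnC -divn_eq.
  rewrite -modnMml -modnXm td modnXm exp1n modnMml mul1n.
  move=> e2; have : totient q %% d == 0.
    apply/negPn; rewrite -lt0n; apply/negP => h; apply: (dmin _ _ e2).
    by rewrite h ltn_mod.
  rewrite -/(dvdn _ _) q_2 totient_pfactor // mul1n => dd.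
  have /dvdn_trans/(_ dd) : e %| d by rewrite de dvdn_mulr.
  case/(dvdn_pfactor _ _ (isT : prime 2)) => -[//|k] _ ek.
  by rewrite ek oddX in eodd.
split=> //; first by rewrite de e1 p2.
by move: qt; rewrite -vE e1 expn1.
Qed.

End Orders.

(** * The Kummer lattice of a cyclic group of prime power order *)

Section CyclicLattice.

Variables (F : fieldType) (G1 H : finGroupType).
Variable act : G1 * H -> {rmorphism F -> F}.
Hypothesis actM : forall g h u, act (g * h)%g u = act g (act h u).

Variables (d' : nat) (kg : G1 -> 'I_d'.+1).
Hypothesis kgM : forall g h, kg (g * h)%g = kg g + kg h.
Local Notation d := d'.+1.

Variable E : 'I_d -> F.
Hypothesis E_neq0 : forall j, E j != 0.
Hypothesis EG : forall g j, act (g, 1%g) (E j) = E (kg g + j).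

Let aT g (j : 'I_d) := kg g + j.

Lemma kg_action : is_action aT.
Proof.
split=> [j|g h j]; last by rewrite /aT kgM addrA.
have := kgM 1%g 1%g; rewrite mulg1 -{1}[kg 1%g]addr0 => /addrI e.
by rewrite /aT -e add0r.
Qed.

Lemma act_pair g h u : act (g, h) u = act (g, 1%g) (act (1%g, h) u).
Proof.
by rewrite -actM; congr (act _ _); congr (_, _); rewrite ?mulg1 ?mul1g.
Qed.

Let gen : 'I_d := inZp 1.

Lemma gen_mulrn i : gen *+ i = inZp i.
Proof.
elim: i => [|i IH]; first by apply: val_inj; rewrite /= mod0n.
by rewrite mulrS IH; apply: val_inj; rewrite /= modnDm add1n.
Qed.

Lemma gen_mulrn_d : gen *+ d = 0.
Proof. by rewrite gen_mulrn; apply: val_inj; rewrite /= modnn. Qed.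

Lemma ord_gen (j : 'I_d) : j = gen *+ j.
Proof. by rewrite gen_mulrn valZpK. Qed.

Variables (z : F) (o t : nat) (c : H -> nat).
Hypothesis o_gt0 : (0 < o)%N.
Hypothesis zo : z ^+ o = 1.
Hypothesis EH : forall h j, act (1%g, h) (E j) = z ^+ (t ^ j * c h) * E j.

Let J (x : {ffun 'I_d -> int}) := (o%:Z %| \sum_(j < d) t%:Z ^+ j * x j)%Z.

Section Regular.

Variables (r : nat) (r' k0 : int).
Hypothesis td : (t ^ d = 1 + o * r)%N.
Hypothesis rP : r%:Z * r' = 1 + o%:Z * k0.

Lemma zexp_gen (j : 'I_d) : z ^+ (t ^ (j + gen)%R) = z ^+ (t ^ j * t).
Proof.
rewrite /= modnDmr addn1 -expnSr.
have [jd|jd] := ltnP j d'; first by rewrite modn_small.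
have -> : nat_of_ord j = d' by apply/eqP; rewrite eqn_leq jd -ltnS ltn_ord.
by rewrite modnn td expn0 exprD exprM zo expr1n mulr1.
Qed.

Let theta (x : {ffun 'I_d -> int}) l := \sum_(i < d) t%:Z ^+ (d' - i) * x (l - gen *+ i).

Lemma theta_rec x l : theta x (l - gen) - t%:Z * theta x l = - (o * r)%:Z * x l.
Proof.
pose f i : int := t%:Z ^+ (d - i) * x (l - gen *+ i).
have -> : theta x (l - gen) = \sum_(i < d) f i.+1.
  by apply: eq_bigr => i _; rewrite /f subSS mulrS opprD addrA.
have -> : t%:Z * theta x l = \sum_(i < d) f i.
  rewrite mulr_sumr; apply: eq_bigr => i _.
  by rewrite /f subSn ?exprS ?mulrA // -ltnS.
rewrite -sumrB -(big_mkord xpredT (fun i => f i.+1 - f i)) telescope_sumr //.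
rewrite /f subnn gen_mulrn_d subn0 mulr0n subr0 mul1r.
have -> : t%:Z ^+ d = 1 + (o * r)%:Z by rewrite -PoszD -td -rmorphXn.
by ring.
Qed.

Lemma theta_dvd x l : J x -> (o%:Z %| theta x l)%Z.
Proof.
move=> jx; have -> : l = ord_max - gen *+ (d' - l).
  rewrite [ord_max]ord_gen -mulrnBr ?leq_subr // /= subKn; first exact: ord_gen.
  by rewrite -ltnS.
elim: (d' - l)%N => [|k IH].
  suff -> : theta x (ord_max - gen *+ 0) = \sum_(j < d) t%:Z ^+ j * x j by [].
  rewrite mulr0n subr0 /theta [RHS](reindex_inj rev_ord_inj) /=.
  apply: eq_bigr => i _; rewrite subSS; congr (_ * x _).
  rewrite [ord_max]ord_gen -mulrnBr /=; last by rewrite -ltnS.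
  by rewrite [RHS]ord_gen /= subSS.
rewrite mulrSr opprD addrA.
have -> : theta x (ord_max - gen *+ k - gen) = t%:Z * theta x (ord_max - gen *+ k)
    + - (o * r)%:Z * x (ord_max - gen *+ k).
  by rewrite -theta_rec addrCA subrr addr0.
apply: rpredD; first exact: dvdz_mull.
rewrite mulNr rpredN PoszM -mulrA.
exact: dvdz_mulr.
Qed.

(** Inside Z[C], with C cyclic of order d and generator s, the lattice J is the
    ideal (s - t, o). With Theta the sum of the t^(d-1-i) s^i one has
    Theta (s - t) = - o r, whence x = (- r' Theta x / o) (s - t) - (k0 x) o for
    x in J: the surjection from Z[C]^2 to J splits equivariantly. *)
Lemma cyclic_regular : perm_factors act aT J (fun x => \prod_j E j ^ x j).
Proof.
pose eps (y : 'I_d + 'I_d) := match y with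
  | inl l => E (l + gen) / E l ^+ t | inr l => E l ^+ o end.
pose A x l : int := - r' * (theta x l %/ o%:Z)%Z.
pose aY g (y : 'I_d + 'I_d) : 'I_d + 'I_d :=
  match y with inl l => inl (aT g l) | inr l => inr (aT g l) end.
pose kap x (y : 'I_d + 'I_d) := match y with
  | inl l => A x l | inr l => - k0 * x l end.
have [a1 aM] := kg_action.
have o0 : o%:Z != 0 by rewrite eqz_nat -lt0n.
exists ('I_d + 'I_d)%type, aY, eps, kap; split.
- by split=> [[l|l]|g h [l|l]] /=; rewrite ?a1 ?aM.
- case=> l /=; split; rewrite ?mulf_neq0 ?invr_eq0 ?expf_neq0 // => g h.
    have -> : act (g, h) (E (l + gen) / E l ^+ t)
            = act (g, 1%g) (E (l + gen) / E l ^+ t).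
      rewrite act_pair; congr (act _ _).
      rewrite fmorph_div rmorphXn !EH exprM zexp_gen -exprM exprMn -exprM.
      rewrite [(_ * c h * t)%N]mulnAC -mulf_div mulfV ?mul1r // expf_neq0 //.
      apply/negP => /eqP z0; move/eqP: zo.
      by rewrite z0 expr0n -[o]prednK // eq_sym oner_eq0.
    by rewrite fmorph_div rmorphXn !EG /aT addrA.
  rewrite act_pair rmorphXn EH exprMn -exprM [(_ * o)%N]mulnC exprM zo expr1n mul1r.
  by rewrite rmorphXn EG.
- move=> x x' jx jx' [l|l] /=; last by rewrite ffunE mulrDr.
  rewrite /A -mulrDr -divzDl ?theta_dvd //; congr (_ * (_ %/ _)%Z).
  by rewrite -big_split; apply: eq_bigr => i _; rewrite ffunE mulrDr.
- have sh g x l : shift aT g x (aT g l) = x l.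
    by rewrite ffunE -aM mulVg a1.
  move=> g x jx [l|l] /=; last by rewrite sh.
  congr (_ * (_ %/ _)%Z); apply: eq_bigr => i _; congr (_ * _).
  by rewrite -[RHS](sh g) /aT addrA.
- move=> x jx; rewrite big_sumType /=.
  have AE l : A x (l - gen) - t%:Z * A x l - o%:Z * (k0 * x l) = x l.
    apply: (mulIf o0); rewrite /A !mulrBl -!mulrA.
    rewrite divzK ?theta_dvd //.
    rewrite [(theta x l %/ _)%Z * _]divzK ?theta_dvd //.
    have := theta_rec x l; rewrite PoszM => /(congr1 (fun y => - r' * y)).
    rewrite (_ : - r' * (- (o%:Z * r) * x l) = r%:Z * r' * o%:Z * x l); last by ring.
    rewrite rP => e.
    transitivity (- r' * (theta x (l - gen) - t%:Z * theta x l)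
                  - o%:Z * (k0 * (x l * o%:Z))); first by ring.
    by rewrite e; ring.
  have -> : \prod_l (E (l + gen) / E l ^+ t) ^ A x l
     = \prod_l E l ^ (A x (l - gen) - t%:Z * A x l).
    transitivity ((\prod_l E (l + gen) ^ A x l) * \prod_l E l ^ (- t%:Z * A x l)).
      rewrite -big_split; apply: eq_bigr => l _ /=.
      by rewrite expfzMl exprz_inv -[_ ^+ t]/(_ ^ t%:Z) exprz_exp mulrN mulNr.
    rewrite [X in X * _](reindex_inj (addIr (- gen))) -big_split.
    by apply: eq_bigr => l _ /=; rewrite subrK expfzDr ?mulNr.
  rewrite -big_split; apply: eq_bigr => l _ /=.
  rewrite -[_ ^+ o]/(_ ^ o%:Z) exprz_exp -expfzDr // -{1}(AE l).
  by congr (_ ^ _); ring.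
Qed.

End Regular.

End CyclicLattice.

Section QuadraticLattice.

Variables (F : fieldType) (G1 H : finGroupType).
Variable act : G1 * H -> {rmorphism F -> F}.
Hypothesis actM : forall g h u, act (g * h)%g u = act g (act h u).

Variable kg : G1 -> 'I_2.
Hypothesis kgM : forall g h, kg (g * h)%g = kg g + kg h.

Variable E : 'I_2 -> F.
Hypothesis E_neq0 : forall j, E j != 0.
Hypothesis EG : forall g j, act (g, 1%g) (E j) = E (kg g + j).

Variables (Z : 'I_2 -> F) (k : nat).
Hypothesis k_gt0 : (0 < k)%N.
Hypothesis ZH : forall h j, act (1%g, h) (Z j) = Z j.
Hypothesis ZG : forall g j, act (g, 1%g) (Z j) = Z (kg g + j).
Hypothesis Z01 : Z 0 != Z 1.
Hypothesis EH : forall h j, act (1%g, h) ((E j / E (j + 1)) ^+ k) = (E j / E (j + 1)) ^+ k.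
Hypothesis EH' : forall h, act (1%g, h) (E 0 * E 1) = E 0 * E 1.

Let aT g (j : 'I_2) := kg g + j.

Let I2E (j : 'I_2) : j = 0 \/ j = 1.
Proof. by case: j => -[|[]] // ?; [left | right]; apply: val_inj. Qed.

Let I2_2 (j : 'I_2) : j + 1 + 1 = j.
Proof. by case: (I2E j) => ->; apply: val_inj. Qed.

Let I2_11 : 1 + 1 = 0 :> 'I_2. Proof. exact: val_inj. Qed.

Let big2 (R : Type) (idx : R) (op : Monoid.law idx) (f : 'I_2 -> R) :
  \big[op/idx]_j f j = op (f 0) (f 1).
Proof.
rewrite !big_ord_recl big_ord0 Monoid.mulm1; congr (op (f _) (f _)).
exact: val_inj.
Qed.

Let beta := (E 0 / E 1) ^+ k.

Lemma EV j : (E (j + 1) / E (j + 1 + 1)) ^+ k = ((E j / E (j + 1)) ^+ k)^-1.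
Proof. by rewrite I2_2 -exprVn invf_div. Qed.

(** Explicit form of Hilbert 90 for the quadratic extension moved by G1: the
    element beta, which has norm 1, is a quotient of conjugates. *)
Lemma hilbert90_quadratic : exists ga : 'I_2 -> F,
  [/\ forall j, ga j != 0, forall g j, act (g, 1%g) (ga j) = ga (kg g + j),
      forall h j, act (1%g, h) (ga j) = ga j & ga 1 / ga 0 = beta].
Proof.
have b0 : beta != 0 by rewrite expf_neq0 // mulf_neq0 ?invr_eq0.
have [bm|bm] := eqVneq beta (-1).
  exists (fun j => Z j - Z (j + 1)); split.
  - have n0 : Z 0 - Z 1 != 0 by rewrite subr_eq0.
    move=> j; case: (I2E j) => ->; first by rewrite add0r.
    by rewrite I2_11 -oppr_eq0 opprB.
  - by move=> g j; rewrite rmorphB /= !ZG addrA.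
  - by move=> h j; rewrite rmorphB /= !ZH.
  - rewrite bm I2_11 add0r -opprB mulNr divff //.
    by rewrite subr_eq0.
exists (fun j => 1 + (E (j + 1) / E (j + 1 + 1)) ^+ k); split.
- move=> j; rewrite addrC addr_eq0; case: (I2E j) => ->.
    rewrite EV add0r -/beta; apply: contra bm => /eqP e.
    by rewrite -[beta]invrK [beta^-1]e; apply/eqP; rewrite invrN invr1.
  by rewrite I2_11 add0r.
- by move=> g j; rewrite rmorphD rmorph1 rmorphXn fmorph_div /= !EG !addrA.
- by move=> h j; rewrite rmorphD rmorph1 EH.
- rewrite I2_11 EV !add0r -/beta.
  have n0 : 1 + beta != 0 by rewrite addrC addr_eq0.
  have -> : 1 + beta^-1 = (1 + beta) / beta.
    by rewrite mulrDl mul1r mulfV // addrC.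
  by rewrite invf_div mulrCA mulfV ?mulr1.
Qed.

Let o := (2 * k)%N.
Let J (x : {ffun 'I_2 -> int}) := (o%:Z %| x 0%R - x 1%R)%Z.

Let Jsum x : J x -> exists c, [/\ x 0 = x 1 + o%:Z * c, ((x 0%R - x 1%R) %/ o%:Z)%Z = c
  & ((x 0%R + x 1%R) %/ 2)%Z = x 1 + k%:Z * c].
Proof.
case/dvdzP=> c e; exists c.
have e0 : x 0 = x 1 + o%:Z * c by rewrite mulrC -e addrCA subrr addr0.
split=> //; first by rewrite e mulzK // /o; case: k k_gt0.
by rewrite e0 (_ : _ + _ = (x 1 + k%:Z * c) * 2) ?mulzK // /o PoszM; ring.
Qed.

(** Here t = -1, the lattice J is spanned by the invariant element (1, 1) and
    the anti-invariant element (k, -k); the latter contributes beta, which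
    is a quotient of two conjugates. *)
Lemma quadratic_regular : perm_factors act aT J (fun x => \prod_j E j ^ x j).
Proof.
have [ga [ga0 gaG gaH gab]] := hilbert90_quadratic.
pose eps (y : unit + 'I_2) := match y with inl _ => E 0 * E 1 | inr j => ga j end.
pose aY g (y : unit + 'I_2) : unit + 'I_2 :=
  match y with inl u => inl u | inr l => inr (aT g l) end.
pose kap (x : {ffun 'I_2 -> int}) (y : unit + 'I_2) := match y with
  | inl _ => ((x 0%R + x 1%R) %/ 2)%Z | inr j => ((x (j + 1)%R - x j) %/ o%:Z)%Z end.
have [a1 aM] : is_action aT := kg_action kgM.
have sw (j : 'I_2) : (j = 0 /\ j + 1 = 1) \/ (j = 1 /\ j + 1 = 0).
  by case: (I2E j) => ->; [left | right]; split=> //; apply: val_inj.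
have dvd2 x : J x -> (2 %| x 0%R + x 1%R)%Z.
  move=> jx; have [c [-> _ _]] := Jsum jx; apply/dvdzP; exists (x 1 + k%:Z * c).
  by rewrite /o PoszM; ring.
have dvdo x j : J x -> (o%:Z %| x (j + 1)%R - x j)%Z.
  by move=> jx; case: (sw j) => -[-> ->] //; rewrite -opprB rpredN.
exists (unit + 'I_2)%type, aY, eps, kap; split.
- by split=> [[u|l]|g h [u|l]] //=; congr inr; [exact: a1 | exact: aM].
- case=> [u|j] /=; split; rewrite ?mulf_neq0 // => g h.
    rewrite (act_pair actM) EH' rmorphM /= !EG.
    case: (sw (kg g)) => -[e1 e2]; first by rewrite e2 e1 add0r.
    by rewrite e2 e1 addr0 mulrC.
  by rewrite (act_pair actM) gaH gaG.
- move=> x x' jx jx' [u|j] /=; rewrite !ffunE -divzDl ?dvd2 ?dvdo //.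
    by rewrite addrACA.
  by rewrite opprD addrACA.
- have sh g x l : shift aT g x (aT g l) = x l.
    by rewrite ffunE -aM mulVg a1.
  move=> g x jx [u|j] /=; last by rewrite -[aT g j + 1]addrA !sh.
  have sumE (y : {ffun 'I_2 -> int}) : y 0 + y 1 = \sum_j y j by rewrite big2.
  rewrite !sumE (reindex_inj (addrI (kg g))) /=.
  by under eq_bigr => j _ do rewrite [shift _ _ _ _]sh.
- move=> x jx; rewrite big_sumType /= big_const card_unit /= mulr1.
  rewrite !big2 /=.
  have [c [e0 ec e2]] := Jsum jx.
  rewrite I2_11 add0r ec e2.
  have -> : ((x 1%R - x 0%R) %/ o%:Z)%Z = - c.
    by rewrite e0 opprD addrA subrr add0r -mulrN mulrC mulzK // /o; case: k k_gt0.
  rewrite -exprz_inv -expfzMl [(ga 0)^-1 * _]mulrC gab /beta -[_ ^+ k]/(_ ^ k%:Z) exprz_exp.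
  rewrite !expfzMl exprz_inv mulrACA -!expfzDr //.
  by congr (_ ^ _ * _ ^ _); rewrite ?e0 /o ?PoszM; ring.
Qed.

End QuadraticLattice.

(** * Kummer lattices factor through permutation lattices *)

Lemma prim_expz_eq1 (F : fieldType) (o : nat) (z : F) (k : int) :
  o.-primitive_root z -> (z ^ k == 1) = (o%:Z %| k)%Z.
Proof.
move=> zP; case: k => k.
  by rewrite -[z ^ k]/(z ^+ k) -(prim_order_dvd zP).
by rewrite NegzE -exprnN invr_eq1 -(prim_order_dvd zP) rpredN.
Qed.

Section Kummer.

Variables (F : fieldType) (G1 H : finGroupType).
Variable act : G1 * H -> {rmorphism F -> F}.
Hypothesis act1 : forall u, act 1%g u = u.
Hypothesis actM : forall g h u, act (g * h)%g u = act g (act h u).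
Hypothesis faithful : forall g, (forall u, act g u = u) -> g = 1%g.

Let lm (g k : G1) := (g * k)%g.

Lemma lm_action : is_action lm.
Proof. by split=> [x|g h x]; rewrite /lm ?mul1g ?mulgA. Qed.

Definition orbit_prod (e : F) (x : {ffun G1 -> int}) :=
  \prod_g act (g, 1%g) e ^ x g.

Lemma orbit_prodM e1 e2 x : orbit_prod (e1 * e2) x = orbit_prod e1 x * orbit_prod e2 x.
Proof.
by rewrite -big_split; apply: eq_bigr => g _; rewrite rmorphM expfzMl.
Qed.

Lemma orbit_prodXz e (k : int) x : orbit_prod (e ^ k) x = orbit_prod e x ^ k.
Proof.
rewrite -prodrXz; apply: eq_bigr => g _.
by rewrite fmorphXz !exprz_exp mulrC.
Qed.

Lemma act_swap g h u : act (1%g, h) (act (g, 1%g) u) = act (g, 1%g) (act (1%g, h) u).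
Proof. by rewrite -!actM; congr (act _ _); congr (_, _); rewrite ?mulg1 ?mul1g. Qed.

Lemma actM1 g k u : act (g, 1%g) (act (k, 1%g) u) = act ((g * k)%g, 1%g) u.
Proof. by rewrite -actM; congr (act _ _); congr (_, _); rewrite mulg1. Qed.

Lemma pf_orbit_prod (w : F) J : w != 0 -> (forall h, act (1%g, h) w = w) ->
  perm_factors act lm J (orbit_prod w).
Proof.
move=> w0 wH; apply: (pf_free (w := fun k => act (k, 1%g) w)) lm_action _ => k.
split=> [|g h]; first by rewrite fmorph_eq0.
by rewrite (act_pair actM) act_swap wH actM1.
Qed.

(** For e with character h |-> z ^ c(h) on H, the element [orbit_prod e x]
    is fixed by H when [orbit_prod z x = 1]. *)
Definition kummer_lattice z (x : {ffun G1 -> int}) := orbit_prod z x = 1.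

Section PrimePower.

Variables (p a : nat) (z e : F) (tau : G1) (t : nat) (c : H -> nat).
Hypothesis pp : prime p.
Hypothesis a_gt0 : (0 < a)%N.
Let o := (p ^ a)%N.
Hypothesis zP : o.-primitive_root z.
Hypothesis zH : forall h, act (1%g, h) z = z.
Hypothesis ztau : act (tau, 1%g) z = z ^+ t.
Hypothesis zG1 : forall g, exists k, act (g, 1%g) z = z ^+ (t ^ k).
Hypothesis e0 : e != 0.
Hypothesis eH : forall h, act (1%g, h) e = z ^+ c h * e.

Let zmod i j : (z ^+ i == z ^+ j) = (i == j %[mod o]).
Proof. exact: eq_prim_root_expr zP i j. Qed.

Let z_neq0 : z != 0.
Proof.
apply/negP => /eqP z0; have := prim_expr_order zP; rewrite z0 expr0n.
by rewrite gtn_eqF ?(prim_order_gt0 zP) // => /eqP; rewrite eq_sym oner_eq0.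
Qed.

Let ztauX k : act ((tau ^+ k)%g, 1%g) z = z ^+ (t ^ k).
Proof.
elim: k => [|k IH]; first by rewrite expg0 act1 expn0.
by rewrite expgS -actM1 IH rmorphXn ztau -exprM -expnS.
Qed.

(** Averaging over H and the stabilizer of z produces an element with the same
    character as e whose conjugates only depend on the conjugates of z. *)
Lemma stable_eigenvector : exists e1, [/\ e1 != 0,
  forall h, act (1%g, h) e1 = z ^+ c h * e1
  & forall g, act (g, 1%g) z = z -> act (g, 1%g) e1 = e1].
Proof.
have cM h k : z ^+ c (h * k)%g = z ^+ c h * z ^+ c k.
  apply: (mulIf e0); rewrite -eH -mulrA -eH.
  have -> : (1%g, (h * k)%g) = ((1%g, h) * (1%g, k))%g :> G1 * H.
    by congr (_, _); rewrite mulg1.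
  by rewrite actM eH [in LHS]rmorphM rmorphXn zH eH mulrCA.
pose f (u : G1 * H) := if act (u.1, 1%g) z == z then z ^- c u.2 else 0.
have f1 : f 1%g != 0 by rewrite /f act1 eqxx invr_eq0 expf_neq0.
have [v v0] := dedekind_neq0 act1 actM faithful f1.
exists (\sum_g f g * act g v); split=> // [h|g gz].
  rewrite rmorph_sum mulr_sumr [RHS](reindex_inj (mulgI (1%g, h))) /=.
  apply: eq_bigr => -[k l] _ /=; rewrite actM rmorphM mulrA; congr (_ * _).
  rewrite /f /= mul1g; case: eqP => _; last by rewrite rmorph0 mulr0.
  by rewrite fmorphV rmorphXn zH cM invfM mulrA mulfV ?mul1r // expf_neq0.
rewrite rmorph_sum [RHS](reindex_inj (mulgI (g, 1%g))) /=.
apply: eq_bigr => -[k l] _ /=; rewrite actM rmorphM; congr (_ * _).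
rewrite /f /= mul1g -actM1.
have -> : (act (g, 1%g) (act (k, 1%g) z) == z) = (act (k, 1%g) z == z).
  by rewrite -{2}gz (inj_eq (fmorph_inj _)).
by case: eqP => _; rewrite ?rmorph0 // fmorphV rmorphXn gz.
Qed.

(** Up to a factor fixed by H, e is stable under the stabilizer of z. Its
    conjugates are then indexed by those of z, that is by a cyclic group of order
    d, and collecting the exponents of equal conjugates reduces the claim to the
    cyclic lattice, or to the quadratic one when for no lift t' of t modulo o
    the quotient of t' ^ d - 1 by o is prime to p. *)
Lemma kummer_prime_power :
  perm_factors act lm (kummer_lattice z) (orbit_prod e).
Proof.
have [e1 [e10 e1H e1G]] := stable_eigenvector.
have w0 : e / e1 != 0 by rewrite mulf_neq0 ?invr_eq0.
have wH h : act (1%g, h) (e / e1) = e / e1.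
  by rewrite fmorph_div eH e1H -mulf_div mulfV ?mul1r // expf_neq0.
suff pf1 : perm_factors act lm (kummer_lattice z) (orbit_prod e1).
  apply: pf_ext (pf_mul pf1 (pf_orbit_prod _ w0 wH)) => // x _.
  by rewrite -orbit_prodM mulrCA mulfV ?mulr1.
have [d d0 dP] : exists2 d, (0 < d)%N & t ^ d = 1 %[mod o] /\
    forall k, (0 < k < d)%N -> t ^ k <> 1 %[mod o].
  have ex : exists d, (0 < d)%N && (t ^ d == 1 %[mod o]).
    exists #[tau]%g; rewrite order_gt0 -zmod -ztauX expg_order.
    by rewrite act1 expr1 eqxx.
  case: (ex_minnP ex) => d /andP[d0 /eqP td] dmin; exists d => //; split=> // k.
  by case/andP=> k0 kd /eqP tk; have := dmin k; rewrite k0 tk leqNgt kd => /(_ isT).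
case: d d0 dP => // d' _; set d := d'.+1 => -[td dmin].
have tmod k : z ^+ (t ^ (k %% d)) = z ^+ (t ^ k).
  have -> : (t ^ k = (t ^ d) ^ (k %/ d) * t ^ (k %% d))%N.
    by rewrite -expnM -expnD [(d * _)%N]mulnC -divn_eq.
  apply/eqP; rewrite zmod eq_sym -modnMml -modnXm td modnXm exp1n.
  by rewrite modnMml mul1n.
have tinj (i j : 'I_d) : z ^+ (t ^ i) = z ^+ (t ^ j) -> i = j.
  wlog ij : i j / (i <= j)%N.
    move=> w zij; have [ij|/ltnW ji] := leqP i j; first exact: w.
    by apply/esym/w.
  rewrite -!ztauX -{1}(subnKC ij) expgD -actM1 => /fmorph_inj/esym/eqP.
  rewrite ztauX -{2}[z]expr1 zmod => /eqP tij; apply: val_inj; apply/eqP.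
  rewrite eqn_leq ij /= leqNgt; apply/negP => lij.
  apply: (dmin (j - i)%N) tij.
  by rewrite subn_gt0 lij (leq_ltn_trans (leq_subr _ _)).
have /fin_all_exists[kg kgP] : forall g, exists j : 'I_d, act (g, 1%g) z = z ^+ (t ^ j).
  move=> g; have [k kE] := zG1 g; exists (inZp k).
  by rewrite kE /= tmod.
have kgM g h : kg (g * h)%g = kg g + kg h.
  apply: tinj; rewrite -kgP -actM1 kgP rmorphXn kgP -exprM -expnD addnC.
  by rewrite /= tmod addnC.
pose E (j : 'I_d) := act ((tau ^+ j)%g, 1%g) e1.
have E0 j : E j != 0 by rewrite fmorph_eq0.
have EE g h : act (g, 1%g) z = act (h, 1%g) z -> act (g, 1%g) e1 = act (h, 1%g) e1.
  move=> gh; apply: (fmorph_inj (act (g^-1%g, 1%g))).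
  rewrite !actM1 mulVg act1 e1G // -actM1 -gh actM1 mulVg.
  by rewrite act1.
have EG g j : act (g, 1%g) (E j) = E (kg g + j).
  rewrite /E actM1; apply: EE; rewrite ztauX -actM1 ztauX rmorphXn kgP -exprM.
  by rewrite /= tmod expnD.
have EkG g : act (g, 1%g) e1 = E (kg g).
  have -> : e1 = E 0 by rewrite /E expg0 act1.
  by rewrite EG addr0.
have EH h (j : 'I_d) : act (1%g, h) (E j) = z ^+ (t ^ j * c h) * E j.
  by rewrite /E act_swap e1H rmorphM rmorphXn ztauX -exprM.
have prodE x : orbit_prod e1 x = \prod_j E j ^ push kg x j.
  by rewrite (prod_push _ _ E0); apply: eq_bigr => g _; rewrite EkG.
have latE x t' : t' = t %[mod o] -> kummer_lattice z x ->
    (o%:Z %| \sum_(j < d) t'%:Z ^+ j * push kg x j)%Z.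
  move=> tt; rewrite /kummer_lattice /orbit_prod => /eqP.
  have -> : \prod_g act (g, 1%g) z ^ x g = z ^ (\sum_g t'%:Z ^+ kg g * x g).
    rewrite -expr_sumz //; apply: eq_bigr => g _.
    rewrite kgP -exprz_exp; congr (_ ^ _); apply/eqP.
    by rewrite -rmorphXn /= -[z ^ _]/(z ^+ _) zmod -[(t' ^ _ %% _)%N]modnXm tt modnXm.
  by rewrite (prim_expz_eq1 _ zP) (sum_push kg (fun j : 'I_d => t'%:Z ^+ j)).
have [[t' [r [tt td' rp]]]|[p2 d2 ot]] := order_lift pp a_gt0 (ltn0Sn d') td dmin.
  have /coprimezP[[u v] /= uv] : coprimez r%:Z o%:Z.
    by rewrite coprimezE; exact: (coprimeXr a rp).
  have EH' h (j : 'I_d) : act (1%g, h) (E j) = z ^+ (t' ^ j * c h) * E j.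
    rewrite EH; congr (_ * _); apply/eqP; rewrite zmod.
    by rewrite -modnMml -modnXm -tt modnXm modnMml.
  have rP : r%:Z * u = 1 + o%:Z * (- v).
    by rewrite -uv; ring.
  have := cyclic_regular actM kgM E0 EG (prim_order_gt0 zP) (prim_expr_order zP) EH' td' rP.
  move/(pf_push lm_action (kg_action kgM) kgM).
  by apply: pf_ext => x; [apply: latE | rewrite prodE].
pose k := (2 ^ a.-1)%N; have ok : o = (2 * k)%N by rewrite /o p2 -expnS prednK.
have k0 : (0 < k)%N by rewrite expn_gt0.
have d1 : d' = 1%N by case: d2.
subst d'.
have tmod2 i : z ^+ (t ^ (i %% 2)) = z ^+ (t ^ i) := tmod i.
have todd : odd t.
  move: ot; rewrite -/o ok => /(dvdn_trans (dvdn_mulr k (dvdnn 2))).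
  by rewrite dvdn2 /= negbK.
pose Z (j : 'I_2) := z ^+ (t ^ j).
have ZS (j : 'I_2) : z ^+ (t ^ (j + 1)%R) = z ^+ (t ^ j * t).
  by rewrite -[nat_of_ord (j + 1)%R]/((j + 1) %% 2)%N tmod2 addn1 expnSr.
have ZH h j : act (1%g, h) (Z j) = Z j by rewrite /Z rmorphXn zH.
have ZG g j : act (g, 1%g) (Z j) = Z (kg g + j).
  by rewrite /Z rmorphXn kgP -exprM /= tmod2 expnD.
have Z01 : Z 0 != Z 1.
  rewrite /Z zmod; apply/negP => /eqP e01.
  by apply: (dmin 1%N) => //; rewrite -[RHS]e01.
have EHk h j : act (1%g, h) ((E j / E (j + 1)) ^+ k) = (E j / E (j + 1)) ^+ k.
  rewrite rmorphXn fmorph_div !EH -mulf_div exprMn; set q := (_ / _) ^+ k.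
  suff -> : q = 1 by rewrite mul1r.
  rewrite /q expr_div_n [z ^+ (t ^ (j + 1)%R * _)]exprM ZS -!exprM.
  have -> : z ^+ (t ^ j * t * c h * k) = z ^+ (t ^ j * c h * k).
    apply/eqP; rewrite zmod ok -!muln_modl eqn_pmul2r //.
    by rewrite mulnAC -modnMmr (modn2 t) todd muln1.
  by rewrite mulfV // expf_neq0.
have EH2 h : act (1%g, h) (E 0 * E 1) = E 0 * E 1.
  rewrite rmorphM !EH mulrACA -exprD -[LHS]mul1r -[RHS]mul1r.
  rewrite mulrA mul1r; congr (_ * _).
  rewrite -mulnDl /= expn0 expn1 add1n exprM.
  by case/dvdnP: ot => q ->; rewrite mulnC exprM (prim_expr_order zP) !expr1n.
have := quadratic_regular actM kgM E0 EG k0 ZH ZG Z01 EHk EH2.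
move/(pf_push lm_action (kg_action kgM) kgM).
apply: pf_ext => x; last by rewrite prodE.
move/(latE x t erefl); rewrite !big_ord_recl big_ord0 addr0 /= expr0 mul1r expr1 -ok.
have -> : lift ord0 ord0 = 1 :> 'I_2 by apply: val_inj.
set y0 := push kg x 0; set y1 := push kg x 1.
have -> : y0 + t%:Z * y1 = (y0 - y1) + t.+1%:Z * y1 by rewrite -addn1 PoszD; ring.
by rewrite rpredDr // dvdz_mulr.
Qed.

End PrimePower.

(** General case: if o factors into coprime parts, Bezout's identity writes e as
    a product of powers of elements whose characters have smaller orders. *)
Lemma kummer_factors o z e tau t (c : H -> nat) :
  o.-primitive_root z -> (forall h, act (1%g, h) z = z) ->
  act (tau, 1%g) z = z ^+ t ->
  (forall g, exists k, act (g, 1%g) z = z ^+ (t ^ k)) ->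
  e != 0 -> (forall h, act (1%g, h) e = z ^+ c h * e) ->
  perm_factors act lm (kummer_lattice z) (orbit_prod e).
Proof.
have [m] := ubnP o; elim: m => // m IH in o z e *; rewrite ltnS => om.
move=> zP zH ztau zG e0 eH; have o0 := prim_order_gt0 zP.
have [o1|o1] := leqP o 1%N.
  apply: pf_orbit_prod => // h; rewrite eH.
  have oE : o = 1%N by apply/eqP; rewrite eqn_leq o1.
  have := prim_expr_order zP; rewrite oE expr1 => ->.
  by rewrite expr1n mul1r.
have pp := pdiv_prime o1; set p := pdiv o in pp.
have po : (0 < logn p o)%N by rewrite logn_gt0 mem_primes pp o0 pdiv_dvd.
have oE := partnC (p : nat_pred) o0.
have [q1|q1] := eqVneq (o`_p^')%N 1%N.
  have oE' : o = (p ^ logn p o)%N by rewrite -p_part -[LHS]oE q1 muln1.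
  rewrite oE' in zP.
  exact: (kummer_prime_power pp po zP zH ztau zG e0 eH).
set o1' := (o`_p)%N in oE; set o2' := (o`_p^')%N in q1 oE.
have o1'1 : (1 < o1')%N by rewrite /o1' p_part -(exp1n (logn p o)) ltn_exp2r ?prime_gt1.
have o2'1 : (1 < o2')%N by rewrite ltn_neqAle eq_sym q1 part_gt0.
have co : coprime o1' o2' by apply: coprime_partC.
have /coprimezP[[u v] /= uv] : coprimez o1'%:Z o2'%:Z by rewrite coprimezE.
have step q q' : (q * q' = o)%N -> (1 < q)%N -> (1 < q')%N ->
    perm_factors act lm (kummer_lattice z) (orbit_prod (e ^+ q)).
  move=> qq q_1 q'_1; have q0 := ltnW q_1; have q'0 := ltnW q'_1.
  have zP' : q'.-primitive_root (z ^+ q).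
    by have := exp_prim_root zP q; rewrite -qq gcdnMr mulKn.
  have lt : (q' < m)%N by apply: leq_trans om; rewrite -qq ltn_Pmull.
  have zH' h : act (1%g, h) (z ^+ q) = z ^+ q by rewrite rmorphXn zH.
  have zt' : act (tau, 1%g) (z ^+ q) = (z ^+ q) ^+ t.
    by rewrite rmorphXn ztau -!exprM mulnC.
  have zG' g : exists k, act (g, 1%g) (z ^+ q) = (z ^+ q) ^+ (t ^ k).
    by have [k kE] := zG g; exists k; rewrite rmorphXn kE -!exprM mulnC.
  have eH' h : act (1%g, h) (e ^+ q) = (z ^+ q) ^+ c h * e ^+ q.
    by rewrite rmorphXn eH exprMn -!exprM mulnC.
  apply: pf_ext (IH _ _ _ lt zP' zH' zt' zG' (expf_neq0 q e0) eH') => // x.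
  rewrite /kummer_lattice -[z ^+ q]/(z ^ q%:Z) orbit_prodXz => ->.
  by rewrite exp1rz.
have pf1 := step _ _ oE o1'1 o2'1.
have pf2 := step o2' o1' (etrans (mulnC _ _) oE) o2'1 o1'1.
apply: pf_ext (pf_mul (pf_exp u pf1) (pf_exp v pf2)) => // x _.
rewrite -!orbit_prodXz -orbit_prodM; congr (orbit_prod _ x).
rewrite -[e ^+ o1']/(e ^ o1'%:Z) -[e ^+ o2']/(e ^ o2'%:Z) !exprz_exp -expfzDr //.
by rewrite [_ * u]mulrC [_ * v]mulrC uv expr1z.
Qed.

End Kummer.

(** * A dual basis of a finite abelian group *)

Lemma dual_basis_dprod (gT : finGroupType) (b : seq gT) (D : {group gT}) :
  (\big[dprod/1]_(x <- b) <[x]>)%g = D ->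
  exists (I : finType) (h : I -> gT) (c : I -> gT -> nat),
  [/\ forall i, h i \in D,
      forall i x y, x \in D -> y \in D -> c i (x * y)%g = c i x + c i y %[mod #[h i]%g],
      forall i k, c i (h k) = (i == k) %[mod #[h i]%g]
    & forall x, x \in D -> (forall i, c i x = 0 %[mod #[h i]%g]) -> x = 1%g].
Proof.
elim: b D => [|x b IH] D.
  rewrite big_nil => D1; exists void, (fun _ => 1%g), (fun _ _ => 0%N).
  by split=> [[]|[]|[]|y]; rewrite -D1 inE => /eqP.
rewrite big_cons => /dprodP[[A B eA eB] defD cAB tiAB].
have [I [h [c [hD cM ch c1]]]] := IH B eB.
rewrite eA eB in defD cAB tiAB.
pose c0 y := epsilon (inhabits 0%N) (fun k => divgr A B y = (x ^+ k)%g).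
have c0P y : y \in D -> divgr A B y = (x ^+ c0 y)%g.
  move=> yD; apply: (epsilon_spec (inhabits 0%N) (fun k => divgr A B y = (x ^+ k)%g)).
  by apply/cycleP; rewrite eA mem_divgr // defD.
have split y : y \in D -> y = (divgr A B y * remgr A B y)%g by move=> _; rewrite -divgr_eq.
have dA y : y \in D -> divgr A B y \in A by move=> yD; rewrite mem_divgr // defD.
have rB y : y \in D -> remgr A B y \in B by move=> yD; rewrite mem_remgr // defD.
have com u v : u \in A -> v \in B -> (u * v = v * u)%g.
  by move=> uA vB; apply/esym/(centsP cAB).
have prodE y1 y2 : y1 \in D -> y2 \in D -> (y1 * y2 =
    (divgr A B y1 * divgr A B y2) * (remgr A B y1 * remgr A B y2))%g.
  have com4 (u1 v1 u2 v2 : gT) : (u2 * v1 = v1 * u2)%g ->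
      ((u1 * v1) * (u2 * v2) = (u1 * u2) * (v1 * v2))%g.
    by move=> uv; rewrite -!mulgA [(v1 * (u2 * _))%g]mulgA -uv -mulgA.
  move=> D1 D2; rewrite -com4; last exact: com (dA _ D2) (rB _ D1).
  by rewrite -!split.
have dM y1 y2 : y1 \in D -> y2 \in D ->
    divgr A B (y1 * y2)%g = (divgr A B y1 * divgr A B y2)%g.
  move=> D1 D2; rewrite {1}prodE //.
  by apply: (divgrMid tiAB); apply: groupM; rewrite ?dA ?rB.
have rM y1 y2 : y1 \in D -> y2 \in D ->
    remgr A B (y1 * y2)%g = (remgr A B y1 * remgr A B y2)%g.
  move=> D1 D2; rewrite {1}prodE //.
  by apply: (remgrMid tiAB); apply: groupM; rewrite ?dA ?rB.
have xA : x \in A by rewrite -eA cycle_id.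
have AD u : u \in A -> u \in D by move=> uA; rewrite -[u]mulg1 -defD mem_mulg.
have BD u : u \in B -> u \in D by move=> uA; rewrite -[u]mul1g -defD mem_mulg.
have dB u : u \in B -> divgr A B u = 1%g.
  by move=> uB; have := divgrMid tiAB (group1 A) uB; rewrite mul1g.
have rA u : u \in A -> remgr A B u = 1%g.
  by move=> uA; have := remgrMid tiAB uA (group1 B); rewrite mulg1.
have dAE u : u \in A -> divgr A B u = u.
  by move=> uA; have := divgrMid tiAB uA (group1 B); rewrite mulg1.
have rBE u : u \in B -> remgr A B u = u.
  by move=> uB; have := remgrMid tiAB (group1 A) uB; rewrite mul1g.
pose h' (i : option I) := if i is Some j then h j else x.
pose c' (i : option I) y := if i is Some j then c j (remgr A B y) else c0 y.
exists (option I), h', c'; split.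
- by case=> [i|] /=; [apply: BD | apply: AD].
- move=> [i|] y1 y2 D1 D2 /=; first by rewrite rM // cM ?rB.
  apply/eqP; rewrite -eq_expg_mod_order expgD -!c0P ?groupM //.
  by rewrite dM.
- move=> [i|] [k|] //=.
  + by rewrite rBE // ch; congr (nat_of_bool _ %% _)%N.
  + have c10 : c i 1%g = 0 %[mod #[h i]%g].
      have := cM i 1%g 1%g (group1 B) (group1 B); rewrite mulg1 => /eqP.
      by rewrite -{1}[c i 1%g]addn0 eqn_modDl => /eqP.
    by rewrite rA // c10.
  + apply/eqP; rewrite -eq_expg_mod_order -c0P ?BD // dB //.
  + apply/eqP; rewrite -eq_expg_mod_order -c0P ?AD // dAE //.
- move=> y yD cy; rewrite (split y yD).
  have -> : remgr A B y = 1%g by apply: c1; [exact: rB|move=> i; exact: (cy (Some i))].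
  rewrite mulg1 c0P //; have /eqP := cy None.
  by rewrite -eq_expg_mod_order => /eqP->.
Qed.

(** The c i are exponents: composed with a root of unity of order that of h i
    they become characters, dual to the cyclic factors generated by the h i. *)
Lemma dual_basis (gT : finGroupType) : abelian [set: gT] ->
  exists (I : finType) (h : I -> gT) (c : I -> gT -> nat),
  [/\ forall i x y, c i (x * y)%g = c i x + c i y %[mod #[h i]%g],
      forall i k, c i (h k) = (i == k) %[mod #[h i]%g]
    & forall x, (forall i, c i x = 0 %[mod #[h i]%g]) -> x = 1%g].
Proof.
move=> /abelian_structure[b bE _]; have [I [h [c [_ cM ch c1]]]] := dual_basis_dprod bE.
exists I, h, c; split=> // [i x y|x cx]; first by rewrite cM ?inE.
by apply: c1; rewrite ?inE.
Qed.

(** * Linear maps given on monomials *)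

Section MonomialLinear.

Variables (n : nat) (R S : comNzRingType) (f : {rmorphism R -> S}).
Variable g : 'X_{1..n} -> S.
Implicit Types p q : {mpoly R[n]}.

Definition mlin p := \sum_(m <- msupp p) f p@_m * g m.

Lemma mlinE p i : (msize p <= i)%N ->
  mlin p = \sum_(m : 'X_{1..n < i}) f p@_m * g m.
Proof.
move=> le_pi; set I : subFinType _ := 'X_{1..n < i}.
rewrite /mlin (big_mksub I) ?msupp_uniq //=; first last.
  by move=> x /msize_mdeg_lt /leq_trans; apply.
rewrite big_rmcond //= => j /memN_msupp_eq0 ->.
by rewrite raddf0 mul0r.
Qed.

Fact mlin_is_zmod_morphism : zmod_morphism mlin.
Proof.
move=> p q; pose k := maxn (msize p) (msize q).
have hp : (msize p <= k)%N by rewrite leq_maxl.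
have hq : (msize q <= k)%N by rewrite leq_maxr.
have hpq : (msize (p - q) <= k)%N.
  by apply: leq_trans (msizeD_le _ _) _; rewrite msizeN.
rewrite !(mlinE _ (i := k)) // -sumrB; apply: eq_bigr => m _.
by rewrite mcoeffB rmorphB mulrBl.
Qed.

HB.instance Definition _ :=
  GRing.isZmodMorphism.Build {mpoly R[n]} S mlin mlin_is_zmod_morphism.

Lemma mlinZX c m : mlin (c *: 'X_[m]) = f c * g m.
Proof.
have [->|c0] := eqVneq c 0; first by rewrite scale0r raddf0 rmorph0 mul0r.
by rewrite /mlin (msuppMCX _ c0) big_seq1 mcoeffZ mcoeffX eqxx mulr1.
Qed.

(** The exponents that occur may be confined to a subgroup on which alone g is
    multiplicative. *)
Lemma mlinM p q :
  (forall m m', m \in msupp p -> m' \in msupp q -> g (m + m')%MM = g m * g m') ->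
  mlin (p * q) = mlin p * mlin q.
Proof.
move=> gM; rewrite {1}[p]mpolyE {1}[q]mpolyE mulr_suml raddf_sum mulr_suml.
rewrite big_seq [RHS]big_seq; apply: eq_bigr => m mp.
rewrite mulr_sumr raddf_sum mulr_sumr big_seq [RHS]big_seq.
apply: eq_bigr => m' mq /=.
rewrite -scalerAl -scalerAr scalerA -mpolyXD mlinZX gM // rmorphM.
by rewrite mulrACA.
Qed.

End MonomialLinear.

Lemma mcoeff_sum_mono (n : nat) (R : comNzRingType) (s : seq 'X_{1..n}) (c : 'X_{1..n} -> R) m :
  uniq s -> m \in s -> (\sum_(k <- s) c k *: 'X_[k])@_m = c m.
Proof.
move=> us ms; rewrite raddf_sum (bigD1_seq m) //= mcoeffZ mcoeffX eqxx mulr1.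
rewrite big1 ?addr0 // => k km; rewrite mcoeffZ mcoeffX (negbTE km) mulr0 //.
Qed.

(** * Lifting the Galois extension to a local ring *)

Section LocalLift.

Variables (L Lam : fieldType) (iL : {rmorphism L -> Lam}) (G1 H : finGroupType).
Variable aL : G1 -> {rmorphism L -> L}.
Hypothesis aL1 : forall l, aL 1%g l = l.
Hypothesis aLM : forall g h l, aL (g * h)%g l = aL g (aL h l).
Hypothesis aL_faithful : forall g, (forall l, aL g l = l) -> g = 1%g.

Local Notation G := (G1 * H)%type.
Variable act : G -> {rmorphism Lam -> Lam}.
Hypothesis act1 : forall u, act 1%g u = u.
Hypothesis actM : forall g h u, act (g * h)%g u = act g (act h u).
Hypothesis actL : forall g l, act g (iL l) = iL (aL g.1 l).

Variables (T : finType) (aT : G1 -> T -> T) (chi : T -> H -> L) (e : T -> Lam).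
Hypothesis aTP : is_action aT.
Hypothesis e_neq0 : forall u, e u != 0.
Hypothesis eG : forall g u, act (g, 1%g) (e u) = e (aT g u).
Hypothesis eH : forall h u, act (1%g, h) (e u) = iL (chi u h) * e u.
Hypothesis chi_faithful : forall h, (forall u, chi u h = 1) -> h = 1%g.

Definition char_lattice (x : {ffun T -> int}) := forall h, \prod_u chi u h ^ x u = 1.
Hypothesis lattice_factors : perm_factors act aT char_lattice (fun x => \prod_u e u ^ x u).

Variables (C : finType) (aC : G -> C -> C) (s : C -> Lam).
Hypothesis aC1 : forall c, aC 1%g c = c.
Hypothesis aCM : forall g h c, aC (g * h)%g c = aC g (aC h c).
Hypothesis sE : forall g c, s (aC g c) = act g (s c).

Lemma chiM u h k : chi u (h * k)%g = chi u h * chi u k.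
Proof.
apply: (fmorph_inj iL); apply: (mulIf (e_neq0 u)); rewrite -eH.
have -> : (1%g, (h * k)%g) = ((1%g, h) * (1%g, k))%g :> G.
  by congr (_, _); rewrite mulg1.
by rewrite actM eH rmorphM actL aL1 eH rmorphM mulrCA mulrA.
Qed.

Lemma chi1 u : chi u 1%g = 1.
Proof.
apply: (fmorph_inj iL); apply: (mulIf (e_neq0 u)); rewrite -eH.
by rewrite act1 rmorph1 mul1r.
Qed.

Lemma chiG g u h : aL g (chi u h) = chi (aT g u) h.
Proof.
apply: (fmorph_inj iL); apply: (mulIf (e_neq0 (aT g u))); rewrite -eH -eG.
by rewrite act_swap // eH rmorphM actL.
Qed.

Definition elt (x : L + T) : Lam := match x with inl l => iL l | inr u => e u end.

(** Each group element moves an element of L or an eigenvector; both kinds have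
    an evident lift to a polynomial ring. *)
Lemma separating : exists x : G -> L + T,
  forall g, g != 1%g -> act g (elt (x g)) != elt (x g).
Proof.
apply: (@fin_all_exists _ _ (fun g x => g != 1%g -> act g (elt x) != elt x)) => -[g h].
have [->|g1] := eqVneq g 1%g.
  apply: NNPP => no; apply: (no); exists (inl 0) => /eqP[].
  congr (_, _); apply: chi_faithful => u; apply/eqP/negPn/negP => uh.
  apply: no; exists (inr u) => _ /=; rewrite eH -[X in _ != X]mul1r.
  by rewrite (inj_eq (mulIf (e_neq0 u))) -(rmorph1 iL) (inj_eq (fmorph_inj _)).
apply: NNPP => no; case/eqP: g1; apply: aL_faithful => l; apply/eqP/negPn/negP => gl.
apply: no; exists (inl l) => _ /=.
by rewrite actL (inj_eq (fmorph_inj _)).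
Qed.

Section Kap.

Variables (mu : {set G} -> Lam) (v0 : Lam) (x : G -> L + T).
Let xv g := elt (x g).
Let lam (A : {set G}) := \prod_(d in A) xv d.
Hypothesis muP : forall g,
  \sum_(A : {set G}) lam A * act g (mu A) = (g == 1%g)%:R.
Hypothesis v0P : trace act v0 = 1.

Variables (Y : finType) (aY : G1 -> Y -> Y) (eps : Y -> Lam).
Variable kp : {ffun T -> int} -> Y -> int.
Hypothesis aYP : is_action aY.
Hypothesis eps_neq0 : forall y, eps y != 0.
Hypothesis kpD : forall x x', char_lattice x -> char_lattice x' ->
  forall y, kp (x + x') y = kp x y + kp x' y.
Hypothesis kpE : forall g x, char_lattice x -> forall y, kp (shift aT g x) (aY g y) = kp x y.
Hypothesis kpP : forall x, char_lattice x -> \prod_u e u ^ x u = \prod_y eps y ^ kp x y.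

Variables (R0 : idomainType) (cL : {rmorphism L -> R0}) (ev0 : {rmorphism R0 -> Lam}).
Variables (a0 : G1 -> {rmorphism R0 -> R0}) (w : C -> {set G} -> R0) (Yt : Y -> R0).
Hypothesis ev0C : forall l, ev0 (cL l) = iL l.
Hypothesis a0C : forall g l, a0 g (cL l) = cL (aL g l).
Hypothesis a01 : forall p, a0 1%g p = p.
Hypothesis a0M : forall g h p, a0 (g * h)%g p = a0 g (a0 h p).
Hypothesis ev0G : forall g p, ev0 (a0 g.1 p) = act g (ev0 p).
Hypothesis ev0w : forall c A, ev0 (w c A) = trace act (mu A * (v0 * s c)).
Hypothesis YtG : forall g y, a0 g (Yt y) = Yt (aY g y).
Hypothesis ev0Y : forall y, ev0 (Yt y) = eps y.

(** Over R0 the Galois extension lifts to the polynomial ring R1 in variables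
    specializing to the eigenvectors e, and the family s lifts equivariantly to
    it. On H-invariants, the map kap replaces the monomials of the Kummer
    lattice by products of the lifts of the elements eps. *)
Lemma lift_with_kummer :
  exists (R1 : idomainType) (cR : {rmorphism L -> R1}) (ev1 : {rmorphism R1 -> Lam})
    (rho : G -> {rmorphism R1 -> R1}) (st : C -> R1) (kap : R1 -> {fraction R0}),
  let Hinv P := forall h, rho (1%g, h) P = P in
  [/\ [/\ forall P, rho 1%g P = P, forall g h P, rho (g * h)%g P = rho g (rho h P)
        & forall g P, ev1 (rho g P) = act g (ev1 P)],
      (forall l, ev1 (cR l) = iL l) /\ (forall g l, rho g (cR l) = cR (aL g.1 l)),
      (forall c, ev1 (st c) = s c) /\ (forall g c, rho g (st c) = st (aC g c))
    & [/\ forall P Q, Hinv P -> Hinv Q -> kap (P + Q) = kap P + kap Q,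
          forall P Q, Hinv P -> Hinv Q -> kap (P * Q) = kap P * kap Q,
          forall l, kap (cR l) = tofrac (cL l),
          forall P, Hinv P -> specializes ev0 (kap P) (ev1 P)
        & forall g P p q, Hinv P -> q != 0 -> kap P = tofrac p / tofrac q ->
            kap (rho (g, 1%g) P) = tofrac (a0 g p) / tofrac (a0 g q)]].
Proof.
have Yt0 y : tofrac (Yt y) != 0.
  by rewrite tofrac_eq0 (@ev_neq0 _ _ ev0) // ev0Y.
have eps_sp y : specializes ev0 (tofrac (Yt y)) (eps y).
  by rewrite -ev0Y; apply: sp_tofrac.
pose q := #|{: T}|; pose X u : {mpoly R0[q]} := 'X_(enum_rank u).
pose R1 := {mpoly R0[q]}.
pose ev1 : {rmorphism R1 -> Lam} := mmap ev0 (fun k => e (enum_val k)).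
pose rhoX (g : G) (k : 'I_q) : R1 :=
  (cL (chi (aT g.1 (enum_val k)) g.2))%:MP * X (aT g.1 (enum_val k)).
pose rho (g : G) : {rmorphism R1 -> R1} := mmap (@mpolyC q _ \o a0 g.1) (rhoX g).
have ev1C p : ev1 p%:MP = ev0 p by rewrite /ev1 /= mmapC.
have ev1X u : ev1 (X u) = e u by rewrite /ev1 /= mmapX mmap1U enum_rankK.
have rhoC g p : rho g p%:MP = (a0 g.1 p)%:MP by rewrite /rho /= mmapC.
have rhoXE g u : rho g (X u) = (cL (chi (aT g.1 u) g.2))%:MP * X (aT g.1 u).
  by rewrite /rho /= mmapX mmap1U /rhoX enum_rankK.
have R1_eq (S : comNzRingType) (h1 h2 : {rmorphism R1 -> S}) :
    (forall p, h1 p%:MP = h2 p%:MP) -> (forall u, h1 (X u) = h2 (X u)) -> h1 =1 h2.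
  move=> hC hX; apply: rmorph_mpoly_eq => // k.
  by rewrite -[k]enum_valK -/(X _).
pose mx (m : 'X_{1..q}) := [ffun u => m (enum_rank u) : int] : {ffun T -> int}.
have XmE m : 'X_[m] = \prod_u X u ^+ m (enum_rank u).
  rewrite mpolyXE_id (reindex_onto enum_rank enum_val) /=; last first.
    by move=> k _; rewrite enum_valK.
  by apply: eq_bigl => u; rewrite enum_rankK eqxx.
have XmN0 u : X u != 0 by rewrite -msize_poly_eq0 msizeX.
clearbody ev1 rho X.
have rho1 P : rho 1%g P = P.
  apply: (R1_eq _ (rho 1%g) idfun) => [p|u] /=; first by rewrite rhoC a01.
  by rewrite rhoXE /= (proj1 aTP) chi1 rmorph1 mpolyC1 mul1r.
have G1E (g h : G) : (g * h)%g.1 = (g.1 * h.1)%g by [].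
have G2E (g h : G) : (g * h)%g.2 = (g.2 * h.2)%g by [].
have rhoM g h P : rho (g * h)%g P = rho g (rho h P).
  apply: (R1_eq _ (rho (g * h)%g) (rho g \o rho h)) => [p|u] /=.
    by rewrite !rhoC G1E a0M.
  rewrite !rhoXE rmorphM rhoC a0C rhoXE G1E G2E (proj2 aTP) chiM chiG.
  by rewrite rmorphM mpolyCM mulrA; congr (_ * _); rewrite mulrC.
have ev1G g P : ev1 (rho g P) = act g (ev1 P).
  apply: (R1_eq _ (ev1 \o rho g) (act g \o ev1)) => [p|u] /=.
    by rewrite rhoC !ev1C ev0G.
  case: g => g h; rewrite rhoXE rmorphM /= ev1C ev0C !ev1X.
  by rewrite (act_pair actM) -act_swap // eG eH.
(* a dual system made of elements of L and eigenvectors lifts to R1 *)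
pose xt g : R1 := match x g with inl l => (cL l)%:MP | inr u => X u end.
have ev1xt g : ev1 (xt g) = xv g.
  by rewrite /xt /xv /elt; case: (x g) => [l|u]; rewrite ?ev1C ?ev0C ?ev1X.
have ev1lt (A : {set G}) : ev1 (\prod_(d in A) xt d) = lam A.
  by rewrite rmorph_prod; apply: eq_bigr => d _; rewrite ev1xt.
have ev1w c A : ev1 (w c A)%:MP = trace act (mu A * (v0 * s c)) by rewrite ev1C ev0w.
have [st [ev1s rhos]] := equivariant_lift act1 actM muP v0P sE aC1 aCM rhoM ev1G ev1lt ev1w.
(* kp is additive on the lattice only, but H-invariance keeps monomials in it *)
pose kmon (m : 'X_{1..q}) := \prod_y tofrac (Yt y) ^ kp (mx m) y.
pose kap (P : R1) := mlin (@tofrac _) kmon P.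
have chi_neq0 u h : chi u h != 0.
  apply/negP => /eqP c0; have := chiM u h h^-1%g.
  by rewrite mulgV chi1 c0 mul0r => /eqP; rewrite oner_eq0.
have JD y y' : char_lattice y -> char_lattice y' -> char_lattice (y + y').
  move=> jy jy' h; transitivity ((\prod_u chi u h ^ y u) * \prod_u chi u h ^ y' u).
    by rewrite -big_split; apply: eq_bigr => u _; rewrite ffunE expfzDr.
  by rewrite jy jy' mulr1.
have mxD m m' : mx (m + m')%MM = mx m + mx m'.
  by apply/ffunP => u; rewrite !ffunE mnmDE PoszD.
have rhoXm h m : rho (1%g, h) 'X_[m] = (cL (\prod_u chi u h ^ mx m u))%:MP * 'X_[m].
  rewrite XmE !rmorph_prod -big_split; apply: eq_bigr => u _ /=.
  rewrite rmorphXn rhoXE (proj1 aTP) ffunE exprMn; congr (_ * _).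
  by rewrite -[_ ^ _]/(_ ^+ _) !rmorphXn.
have HinvJ P : (forall h, rho (1%g, h) P = P) -> forall m, m \in msupp P ->
    char_lattice (mx m).
  move=> PH m mP h; have := congr1 (mcoeff m) (PH h).
  rewrite {1}[P]mpolyE rmorph_sum.
  rewrite (eq_bigr (fun k => (P@_k * cL (\prod_u chi u h ^ mx k u)) *: 'X_[k])); last first.
    by move=> k _; rewrite -mul_mpolyC rmorphM rhoC a01 rhoXm mulrA -mpolyCM mul_mpolyC.
  have P0 : P@_m != 0 by rewrite -mcoeff_msupp.
  rewrite mcoeff_sum_mono // -[in RHS](mulr1 P@_m) => /(mulfI P0)/eqP.
  by rewrite -(rmorph1 cL) (inj_eq (fmorph_inj cL)) => /eqP.
have kmonD m m' : char_lattice (mx m) -> char_lattice (mx m') ->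
    kmon (m + m')%MM = kmon m * kmon m'.
  move=> jm jm'; rewrite /kmon -big_split; apply: eq_bigr => y _.
  by rewrite mxD kpD // expfzDr.
have kmon0 : kmon 0%MM = 1.
  have j0 : char_lattice (mx 0%MM).
    by move=> h; apply: big1 => u _; rewrite ffunE mnm0E expr0z.
  apply: big1 => y _; have := kpD j0 j0 y; rewrite -mxD addm0.
  by rewrite -[LHS]addr0 => /addrI <-; rewrite expr0z.
have kmon_sp m : char_lattice (mx m) ->
    specializes ev0 (kmon m) (\prod_u e u ^ mx m u).
  by move=> jm; rewrite kpP //; apply: sp_prod => y _; apply: spXz.
have a0_inj g : injective (@tofrac R0 \o a0 g).
  apply: injective_rmorph => p /eqP; rewrite /= tofrac_eq0 => /eqP p0.
  by rewrite -(a01 p) -(mulVg g) a0M p0 rmorph0.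
pose aF g : {rmorphism {fraction R0} -> {fraction R0}} :=
  frac_lift (@a0_inj g).
have kapG g P : (forall h, rho (1%g, h) P = P) -> kap (rho (g, 1%g) P) = aF g (kap P).
  move=> /HinvJ PJ; rewrite {1}[P]mpolyE /kap rmorph_sum raddf_sum /mlin rmorph_sum.
  rewrite big_seq [RHS]big_seq; apply: eq_bigr => m /PJ jm.
  pose gm := [multinom m (enum_rank (aT g^-1%g (enum_val k))) | k < q].
  have mxg : mx gm = shift aT g (mx m).
    by apply/ffunP => u; rewrite !ffunE mnmE enum_rankK.
  have -> : rho (g, 1%g) (P@_m *: 'X_[m]) = a0 g P@_m *: 'X_[gm].
    rewrite -!mul_mpolyC rmorphM rhoC !XmE rmorph_prod; congr (_ * _).
    have aTK h : cancel (aT h) (aT h^-1%g).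
      by move=> v; rewrite -(proj2 aTP) mulVg (proj1 aTP).
    rewrite [RHS](reindex_inj (can_inj (aTK g))); apply: eq_bigr => u _ /=.
    by rewrite rmorphXn rhoXE chi1 rmorph1 mpolyC1 mul1r mnmE enum_rankK aTK.
  rewrite [LHS]mlinZX rmorphM; congr (_ * _).
    by rewrite /aF /= frac_lift_tofrac.
  rewrite rmorph_prod /kmon mxg.
  have aYK h : cancel (aY h) (aY h^-1%g).
    by move=> v; rewrite -(proj2 aYP) mulVg (proj1 aYP).
  rewrite [LHS](reindex_inj (can_inj (aYK g))); apply: eq_bigr => y _ /=.
  by rewrite kpE // -YtG fmorphXz /aF /= frac_lift_tofrac.
have kap_sp P : (forall h, rho (1%g, h) P = P) -> specializes ev0 (kap P) (ev1 P).
  move=> /HinvJ PJ; rewrite {2}[P]mpolyE rmorph_sum /kap /mlin.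
  rewrite big_seq [X in specializes _ _ X]big_seq; apply: sp_sum => m /PJ jm.
  rewrite -mul_mpolyC rmorphM ev1C; apply: spM; first exact: sp_tofrac.
  rewrite XmE rmorph_prod (eq_bigr (fun u => e u ^ mx m u)); first exact: kmon_sp.
  by move=> u _; rewrite rmorphXn /= ev1X ffunE.
exists R1, (@mpolyC q R0 \o cL), ev1, rho, st, kap; split.
- split; [exact: rho1 | exact: rhoM | exact: ev1G].
- by split=> [l|g l] /=; [rewrite ev1C ev0C | rewrite rhoC a0C].
- by split; [exact: ev1s | exact: rhos].
- split=> [P Q _ _|P Q PH QH|l|P PH|g P p q' PH q0 kP].
  + exact: raddfD.
  + by apply: mlinM => m m' mP mQ; apply: kmonD; [apply: (HinvJ P)|apply: (HinvJ Q)].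
  + by rewrite /kap /= -[(cL l)%:MP]mulr1 -mpolyX0 mul_mpolyC mlinZX kmon0 mulr1.
  + exact: kap_sp.
  + by rewrite kapG // kP /aF /= frac_liftE.
Qed.

End Kap.

(** One indeterminate of R0 is taken for each invariant coordinate, in a dual
    system, of the family s (for G) and of the family eps (for G1): both
    families then have equivariant lifts. *)
Lemma local_lift :
  exists (N : nat) (f : 'I_N -> Lam)
    (R1 : idomainType) (cR : {rmorphism L -> R1}) (ev1 : {rmorphism R1 -> Lam})
    (rho : G -> {rmorphism R1 -> R1}) (st : C -> R1)
    (kap : R1 -> {fraction {mpoly L[N]}}),
  let Hinv P := forall h, rho (1%g, h) P = P in
  (forall g k, act g (f k) = f k) /\
  [/\ [/\ forall P, rho 1%g P = P, forall g h P, rho (g * h)%g P = rho g (rho h P)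
        & forall g P, ev1 (rho g P) = act g (ev1 P)],
      (forall l, ev1 (cR l) = iL l) /\ (forall g l, rho g (cR l) = cR (aL g.1 l)),
      (forall c, ev1 (st c) = s c) /\ (forall g c, rho g (st c) = st (aC g c))
    & [/\ forall P Q, Hinv P -> Hinv Q -> kap (P + Q) = kap P + kap Q,
          forall P Q, Hinv P -> Hinv Q -> kap (P * Q) = kap P * kap Q,
          forall l, kap (cR l) = tofrac l%:MP,
          forall P, Hinv P -> specializes (mmap iL f) (kap P) (ev1 P)
        & forall g P p q, Hinv P -> q != 0 -> kap P = tofrac p / tofrac q ->
            kap (rho (g, 1%g) P) = tofrac (map_mpoly (aL g) p)
                                   / tofrac (map_mpoly (aL g) q)]].
Proof.
case: lattice_factors => Y [aY [eps [kp [aYP epsP kpD kpE kpP]]]].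
have eps_neq0 y : eps y != 0 by case: (epsP y).
have epsG g h y : act (g, h) (eps y) = eps (aY g y) by case: (epsP y).
have act_faithful (g : G) : (forall u, act g u = u) -> g = 1%g.
  have [x xP] := separating => gu; apply/eqP/negPn/negP => /xP /=.
  by rewrite gu eqxx.
have [x xP] := separating.
have [mu muP] := dual_system act1 actM xP.
have [v0 v0P] := trace1 act1 actM act_faithful.
have /fin_all_exists[x1 x1P] := moved aL_faithful.
have [mu1 mu1P] := dual_system aL1 aLM x1P.
have [v1 v1P] := trace1 aL1 aLM aL_faithful.
pose act' g : {rmorphism Lam -> Lam} := act (g, 1%g).
pose lam1 (A : {set G1}) := \prod_(d in A) x1 d.
pose fv (v : (C * {set G}) + (Y * {set G1})) := match v with
  | inl (c, A) => trace act (mu A * (v0 * s c))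
  | inr (y, A) => trace act' (iL (mu1 A) * (iL v1 * eps y)) end.
pose V := ((C * {set G}) + (Y * {set G1}))%type.
pose N := #|{: V}|; pose f (k : 'I_N) := fv (enum_val k).
pose w (v : V) : {mpoly L[N]} := 'X_(enum_rank v).
have fvP g v : act g (fv v) = fv v.
  case: v => -[c A] /=; first by rewrite trace_fixed.
  case: g => g h; rewrite (act_pair actM).
  have -> : act (1%g, h) (trace act' (iL (mu1 A) * (iL v1 * eps c)))
      = trace act' (iL (mu1 A) * (iL v1 * eps c)).
    rewrite rmorph_sum; apply: eq_bigr => k _ /=; rewrite /act' act_swap //.
    by rewrite !rmorphM !actL !aL1 epsG (proj1 aYP).
  by apply: (@trace_fixed _ _ act') => k l u; rewrite /act' actM1.
pose ev0 : {rmorphism {mpoly L[N]} -> Lam} := mmap iL f.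
pose a0 g : {rmorphism {mpoly L[N]} -> {mpoly L[N]}} := map_mpoly (aL g).
have ev0C l : ev0 l%:MP = iL l by rewrite /ev0 /= mmapC.
have ev0w v : ev0 (w v) = fv v by rewrite /ev0 /= mmapX mmap1U /f enum_rankK.
have a0C g l : a0 g l%:MP = (aL g l)%:MP by rewrite /a0 /= map_mpolyC.
have a0X g k : a0 g 'X_k = 'X_k by rewrite /a0 /= map_mpolyX.
have a01 p : a0 1%g p = p.
  by apply/mpolyP => m; rewrite mcoeff_map_mpoly; apply: aL1.
have a0M g h p : a0 (g * h)%g p = a0 g (a0 h p).
  by apply/mpolyP => m; rewrite !mcoeff_map_mpoly; apply: aLM.
have ev0G g p : ev0 (a0 g.1 p) = act g (ev0 p).
  apply: (@rmorph_mpoly_eq _ _ _ (ev0 \o a0 g.1) (act g \o ev0)) => [l|k] /=.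
    by rewrite a0C !ev0C actL.
  by rewrite a0X -[k]enum_valK -/(w _) !ev0w fvP.
have [Yt [ev0Y YtG]] : exists Yt, (forall y, ev0 (Yt y) = eps y) /\
    (forall g y, a0 g (Yt y) = Yt (aY g y)).
  have act'1 u : act' 1%g u = u by rewrite /act' act1.
  have act'M g h u : act' (g * h)%g u = act' g (act' h u) by rewrite /act' actM1.
  have lamP g : \sum_(A : {set G1}) iL (lam1 A) * act' g (iL (mu1 A)) = (g == 1%g)%:R.
    have := congr1 iL (mu1P g); rewrite rmorph_nat => <-.
    rewrite rmorph_sum; apply: eq_bigr => A _ /=.
    by rewrite rmorphM /act' actL.
  have v1P' : trace act' (iL v1) = 1.
    rewrite -(rmorph1 iL) -v1P rmorph_sum; apply: eq_bigr => g _.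
    by rewrite /act' actL.
  have ev0G' g p : ev0 (a0 g p) = act' g (ev0 p) by apply: (ev0G (g, 1%g)).
  exact: (@equivariant_lift _ _ act' _ _ _ _ aY eps _ a0 ev0 (fun A => (lam1 A)%:MP)
    (fun y A => w (inr (y, A))) act'1 act'M lamP v1P' (fun g y => esym (epsG g 1%g y))
    (proj1 aYP) (proj2 aYP) a0M ev0G' (fun A => ev0C (lam1 A)) (fun y A => ev0w (inr (y, A)))).
pose cL : {rmorphism L -> {mpoly L[N]}} := @mpolyC N L.
have [R1 [cR [ev1 [rho [st [kap h]]]]]] := @lift_with_kummer mu v0 x muP v0P Y aY eps kp
  aYP eps_neq0 kpD kpE kpP {mpoly L[N]} cL ev0 a0 (fun c A => w (inl (c, A))) Yt
  ev0C a0C a01 a0M ev0G (fun c A => ev0w (inl (c, A))) YtG ev0Y.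
by exists N, f, R1, cR, ev1, rho, st, kap; split=> // g k; apply: fvP.
Qed.

End LocalLift.

(** * The section on the invariant field *)

Section InvariantSection.

Variables (K L : fieldType) (iK : {rmorphism K -> L}) (G1 H : finGroupType).
Variable aL : G1 -> {rmorphism L -> L}.
Hypothesis aL1 : forall l, aL 1%g l = l.
Hypothesis aLM : forall g h l, aL (g * h)%g l = aL g (aL h l).
Hypothesis fixL : forall l, (forall g, aL g l = l) -> exists k, l = iK k.
Hypothesis aLK : forall g k, aL g (iK k) = iK k.

Local Notation G := (G1 * H)%type.
Variables (n : nat) (a : G -> 'M[int]_n).

Local Notation Lam := {fraction {mpoly L[n]}}.
Local Notation iL := (ratfun_const L n).

Variable act : G -> {rmorphism Lam -> Lam}.
Hypothesis act_const : forall g l, act g (iL l) = iL (aL g.1 l).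
Hypothesis act_var : forall g j, act g (tofrac 'X_j) = laurent L (fun i => a g i j).

Variables (C : finType) (aC : G -> C -> C) (s : C -> Lam) (b : 'I_n -> C -> int).
Hypothesis aC1 : forall c, aC 1%g c = c.
Hypothesis aCM : forall g h c, aC (g * h)%g c = aC g (aC h c).
Hypothesis s_neq0 : forall c, s c != 0.
Hypothesis s_var : forall j, tofrac 'X_j = \prod_c s c ^ b j c.
Hypothesis bE : forall g j c, \sum_i a g i j * b i (aC g c) = b j c.

Variables (N : nat) (f : 'I_N -> Lam) (R1 : idomainType) (cR : {rmorphism L -> R1}).
Variables (ev1 : {rmorphism R1 -> Lam}) (rho : G -> {rmorphism R1 -> R1}).
Variables (st : C -> R1) (kap : R1 -> {fraction {mpoly L[N]}}).

Let Hinv P := forall h, rho (1%g, h) P = P.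

Hypothesis rho1 : forall P, rho 1%g P = P.
Hypothesis rhoM : forall g h P, rho (g * h)%g P = rho g (rho h P).
Hypothesis ev1G : forall g P, ev1 (rho g P) = act g (ev1 P).
Hypothesis ev1C : forall l, ev1 (cR l) = iL l.
Hypothesis rhoC : forall g l, rho g (cR l) = cR (aL g.1 l).
Hypothesis ev1s : forall c, ev1 (st c) = s c.
Hypothesis rhos : forall g c, rho g (st c) = st (aC g c).
Hypothesis kapD : forall P Q, Hinv P -> Hinv Q -> kap (P + Q) = kap P + kap Q.
Hypothesis kapM : forall P Q, Hinv P -> Hinv Q -> kap (P * Q) = kap P * kap Q.
Hypothesis kapC : forall l, kap (cR l) = tofrac l%:MP.
Hypothesis kap_sp : forall P, Hinv P -> specializes (mmap iL f) (kap P) (ev1 P).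
Hypothesis kapG : forall g P p q, Hinv P -> q != 0 -> kap P = tofrac p / tofrac q ->
  kap (rho (g, 1%g) P) = tofrac (map_mpoly (aL g) p) / tofrac (map_mpoly (aL g) q).

Let ev0 : {rmorphism {mpoly L[N]} -> Lam} := mmap iL f.
Let st_neq0 c : tofrac (st c) != 0.
Proof. by apply: (@ev_tofrac_neq0 _ _ ev1); rewrite ev1s s_neq0. Qed.

(** The variables are Laurent monomials in the s c; replacing these by their
    lifts gives an equivariant section of ev1. *)
Let psi0 : {rmorphism {mpoly L[n]} -> {fraction R1}} :=
  mmap (@tofrac R1 \o cR) (fun j => \prod_c tofrac (st c) ^ b j c).

Let psi0C l : psi0 l%:MP = tofrac (cR l).
Proof. by rewrite /psi0 /= mmapC. Qed.

Let psi0X j : psi0 'X_j = \prod_c tofrac (st c) ^ b j c.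
Proof. by rewrite /psi0 /= mmapX mmap1U. Qed.

Lemma psi0_sp p : specializes ev1 (psi0 p) (tofrac p).
Proof.
elim/mpolyind: p => [|c m p _ _ IH]; first by rewrite !rmorph0; apply: sp0.
rewrite !rmorphD /=; apply: spD => //; rewrite -mul_mpolyC !rmorphM /=.
apply: spM; first by rewrite psi0C -[tofrac c%:MP]ev1C; apply: sp_tofrac.
rewrite mpolyXE_id !rmorph_prod; apply: sp_prod => j _; rewrite !rmorphXn /=.
rewrite psi0X s_var; apply: spX; apply: sp_prod => c' _; apply: spXz; first exact: s_neq0.
by rewrite -ev1s; apply: sp_tofrac.
Qed.

Lemma psi0_inj : injective psi0.
Proof.
apply: injective_rmorph => p p0; have := psi0_sp p.
by rewrite p0 => /sp_eq0/eqP; rewrite tofrac_eq0 => /eqP.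
Qed.

Let psi : {rmorphism Lam -> {fraction R1}} := frac_lift psi0_inj.

Lemma psi_sp u : specializes ev1 (psi u) u.
Proof.
have [p [q [q0 ->]]] := fracP u.
rewrite /psi /= frac_liftE //; apply: spM; first exact: psi0_sp.
by apply: spV; [rewrite tofrac_eq0 | apply: psi0_sp].
Qed.

Lemma rho_frac_inj g : injective (@tofrac R1 \o rho g).
Proof.
apply: injective_rmorph => P /eqP; rewrite /= tofrac_eq0 => /eqP P0.
by rewrite -(rho1 P) -(mulVg g) rhoM P0 rmorph0.
Qed.

Let rhoF g : {rmorphism {fraction R1} -> {fraction R1}} := frac_lift (@rho_frac_inj g).

Lemma psiG g u : psi (act g u) = rhoF g (psi u).
Proof.
apply: (@rmorph_ratfun_eq _ _ _ (psi \o act g) (rhoF g \o psi)) => [l|j] /=.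
  rewrite -/(iL l) act_const /psi /rhoF /= !frac_lift_tofrac !psi0C.
  by rewrite frac_lift_tofrac /= rhoC.
have psiX i : psi (tofrac 'X_i) = \prod_c tofrac (st c) ^ b i c.
  by rewrite /psi /= frac_lift_tofrac psi0X.
rewrite act_var psiX /laurent !rmorph_prod.
have aCK h : cancel (aC h) (aC h^-1%g) by move=> c; rewrite -aCM mulVg aC1.
transitivity (\prod_c tofrac (st c) ^ (\sum_i a g i j * b i c)).
  under eq_bigr => i _ do rewrite fmorphXz psiX -prodrXz.
  rewrite exchange_big; apply: eq_bigr => c _ /=.
  rewrite -expr_sumz //; apply: eq_bigr => i _.
  by rewrite exprz_exp mulrC.
rewrite (reindex_inj (can_inj (aCK g))); apply: eq_bigr => c _.
by rewrite bE fmorphXz /rhoF /= frac_lift_tofrac /= rhos.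
Qed.

Definition fixed u := forall g, act g u = u.

Lemma fixed_psi u : fixed u -> exists P Q,
  [/\ forall g, rho g P = P, forall g, rho g Q = Q, ev1 Q != 0
    & psi u = tofrac P / tofrac Q].
Proof.
move=> fu; have [P [Q [Q0 uE _]]] := psi_sp u.
have nzQ := ev_neq0 Q0.
have rQ0 g : rho g Q != 0.
  by apply: (@ev_neq0 _ _ ev1); rewrite ev1G fmorph_eq0.
have inv g : P * rho g Q = rho g P * Q.
  have := psiG g u; rewrite fu uE /rhoF /= frac_liftE //= => /eqP.
  by rewrite eqr_div ?tofrac_eq0 // -!tofracM tofrac_eq => /eqP.
have [P' [Q' [Q'E P'i Q'i e]]] := invariant_fraction rho1 rhoM nzQ inv.
have Q'0 : ev1 Q' != 0.
  by rewrite Q'E rmorph_prod; exact: (norm_neq0 (rho := fun g => rho g) ev1G Q0).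
exists P', Q'; split=> //; rewrite uE; apply/eqP.
by rewrite eqr_div ?tofrac_eq0 ?(ev_neq0 Q'0) // -!tofracM tofrac_eq e.
Qed.

Definition related u v := exists P Q,
  [/\ forall g, rho g P = P, forall g, rho g Q = Q, ev1 Q != 0,
      psi u = tofrac P / tofrac Q & v = kap P / kap Q].

Let inv_Hinv P : (forall g, rho g P = P) -> Hinv P. Proof. by move=> Pi h. Qed.

Let kap_invM P Q : (forall g, rho g P = P) -> (forall g, rho g Q = Q) ->
  kap (P * Q) = kap P * kap Q.
Proof. by move=> Pi Qi; apply: kapM; apply: inv_Hinv. Qed.

Lemma kap_neq0 Q : (forall g, rho g Q = Q) -> ev1 Q != 0 -> kap Q != 0.
Proof.
move=> Qi Q0; have := kap_sp (inv_Hinv Qi); exact: sp_neq0.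
Qed.

Lemma related_fun u v v' : related u v -> related u v' -> v = v'.
Proof.
move=> [P [Q [Pi Qi Q0 uE ->]]] [P' [Q' [Pi' Qi' Q0' uE' ->]]].
have [nzQ nzQ'] := (ev_tofrac_neq0 Q0, ev_tofrac_neq0 Q0').
have [kQ kQ'] := (kap_neq0 Qi Q0, kap_neq0 Qi' Q0').
have : tofrac P / tofrac Q == tofrac P' / tofrac Q' by rewrite -uE uE'.
rewrite (eqr_div _ _ nzQ nzQ') -!tofracM tofrac_eq => /eqP e.
apply/eqP; rewrite (eqr_div _ _ kQ kQ').
by rewrite -(kap_invM Pi Qi') -(kap_invM Pi' Qi) e.
Qed.

Lemma relatedD u1 v1 u2 v2 : related u1 v1 -> related u2 v2 ->
  related (u1 + u2) (v1 + v2).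
Proof.
move=> [P [Q [Pi Qi Q0 uE ->]]] [P' [Q' [Pi' Qi' Q0' uE' ->]]].
have [nzQ nzQ'] := (ev_tofrac_neq0 Q0, ev_tofrac_neq0 Q0').
have [kQ kQ'] := (kap_neq0 Qi Q0, kap_neq0 Qi' Q0').
exists (P * Q' + P' * Q), (Q * Q'); split.
- by move=> g; rewrite rmorphD !rmorphM Pi Qi Pi' Qi'.
- by move=> g; rewrite !rmorphM Qi Qi'.
- rewrite rmorphM; exact: mulf_neq0 Q0 Q0'.
- by rewrite rmorphD uE uE' (addf_div _ _ nzQ nzQ') tofracD !tofracM.
- have M X Y : (forall g, rho g X = X) -> (forall g, rho g Y = Y) ->
    Hinv (X * Y) by move=> Xi Yi h; rewrite rmorphM Xi Yi.
  rewrite kapD; [|exact: M|exact: M].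
  by rewrite (kap_invM Pi Qi') (kap_invM Pi' Qi) (kap_invM Qi Qi') (addf_div _ _ kQ kQ').
Qed.

Lemma relatedM u1 v1 u2 v2 : related u1 v1 -> related u2 v2 ->
  related (u1 * u2) (v1 * v2).
Proof.
move=> [P [Q [Pi Qi Q0 uE ->]]] [P' [Q' [Pi' Qi' Q0' uE' ->]]].
have [nzQ nzQ'] := (ev_tofrac_neq0 Q0, ev_tofrac_neq0 Q0').
have [kQ kQ'] := (kap_neq0 Qi Q0, kap_neq0 Qi' Q0').
exists (P * P'), (Q * Q'); split.
- by move=> g; rewrite !rmorphM Pi Pi'.
- by move=> g; rewrite !rmorphM Qi Qi'.
- rewrite rmorphM; exact: mulf_neq0 Q0 Q0'.
- by rewrite rmorphM uE uE' mulf_div !tofracM.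
- by rewrite (kap_invM Pi Pi') (kap_invM Qi Qi') mulf_div.
Qed.

Lemma relatedC k : related (iL (iK k)) (tofrac (iK k)%:MP).
Proof.
exists (cR (iK k)), (cR 1); split.
- by move=> g; rewrite rhoC aLK.
- by move=> g; rewrite rhoC rmorph1.
- by rewrite ev1C rmorph1 oner_eq0.
- by rewrite rmorph1 tofrac1 divr1 /psi /= frac_lift_tofrac psi0C.
- by rewrite !kapC mpolyC1 tofrac1 divr1.
Qed.

Lemma related_sp u v : related u v -> specializes ev0 v u.
Proof.
move=> [P [Q [Pi Qi Q0 uE ->]]].
have -> : u = ev1 P / ev1 Q.
  apply: sp_fun (psi_sp u) _; rewrite uE; apply: spM; first exact: sp_tofrac.
  by apply: spV Q0 _; apply: sp_tofrac.
apply: spM; first exact: kap_sp (inv_Hinv Pi).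
by apply: spV Q0 _; apply: kap_sp (inv_Hinv Qi).
Qed.

Let a0 g : {rmorphism {mpoly L[N]} -> {mpoly L[N]}} := map_mpoly (aL g).

Let a0C g l : a0 g l%:MP = (aL g l)%:MP.
Proof. by rewrite /a0 /= map_mpolyC. Qed.

Let a0X g k : a0 g 'X_k = 'X_k. Proof. by rewrite /a0 /= map_mpolyX. Qed.

Let ev0C l : ev0 l%:MP = iL l. Proof. by rewrite /ev0 /= mmapC. Qed.

Let ev0X k : ev0 'X_k = f k. Proof. by rewrite /ev0 /= mmapX mmap1U. Qed.

Let a0_1 p : a0 1%g p = p.
Proof. by apply/mpolyP => m; rewrite mcoeff_map_mpoly; apply: aL1. Qed.

Let a0_M g h p : a0 (g * h)%g p = a0 g (a0 h p).
Proof. by apply/mpolyP => m; rewrite !mcoeff_map_mpoly; apply: aLM. Qed.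

Lemma a0_frac_inj g : injective (@tofrac {mpoly L[N]} \o a0 g).
Proof.
apply: injective_rmorph => p /eqP; rewrite /= tofrac_eq0 => /eqP p0.
by rewrite -(a0_1 p) -(mulVg g) a0_M [a0 g p]p0 rmorph0.
Qed.

Let aF g : {rmorphism {fraction {mpoly L[N]}} -> {fraction {mpoly L[N]}}} :=
  frac_lift (@a0_frac_inj g).

Lemma related_fixed u v g : related u v -> aF g v = v.
Proof.
move=> [P [Q [Pi Qi Q0 uE ->]]].
have kF X : (forall g, rho g X = X) -> aF g (kap X) = kap X.
  move=> Xi; have [p [q [q0 e]]] := fracP (kap X).
  have := @kapG g X p q (fun h => Xi _) q0 e; rewrite Xi => e'.
  by rewrite {1}e /aF /= frac_liftE.
by rewrite fmorph_div !kF.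
Qed.

Hypothesis f_fixed : forall g k, act g (f k) = f k.

Let ev0G g p : ev0 (a0 g p) = act (g, 1%g) (ev0 p).
Proof.
apply: (@rmorph_mpoly_eq _ _ _ (ev0 \o a0 g) (act (g, 1%g) \o ev0)) => [l|k] /=.
  by rewrite a0C !ev0C act_const.
by rewrite a0X !ev0X f_fixed.
Qed.

Let jF := extend_ratfun N iK.

Lemma mmap_map_mpoly p : ev0 (map_mpoly iK p) = mmap (iL \o iK) f p.
Proof.
apply: (@rmorph_mpoly_eq _ _ _ (ev0 \o map_mpoly iK)
  (mmap (iL \o iK) f : {rmorphism {mpoly K[N]} -> Lam})) => [l|k] /=.
  by rewrite map_mpolyC ev0C mmapC.
by rewrite map_mpolyX ev0X mmapX mmap1U.
Qed.

Lemma related_descent u v : related u v ->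
  exists v0, v = jF v0 /\ specializes (mmap (iL \o iK) f) v0 u.
Proof.
move=> uv; have [p [q [q0 vE uE]]] := related_sp uv.
have nzq := ev_neq0 q0.
have inv g : p * a0 g q = a0 g p * q.
  have rq0 : a0 g q != 0 by apply: (@ev_neq0 _ _ ev0); rewrite ev0G fmorph_eq0.
  have : tofrac (a0 g p) / tofrac (a0 g q) == tofrac p / tofrac q.
    by rewrite -vE -(related_fixed g uv) vE /aF /= frac_liftE.
  rewrite eq_sym eqr_div ?tofrac_eq0 ?nzq ?rq0 // -!tofracM tofrac_eq.
  by move/eqP.
have [p' [q' [q'E p'i q'i e]]] := invariant_fraction a0_1 a0_M nzq inv.
have q'0 : ev0 q' != 0.
  rewrite q'E rmorph_prod.
  exact: (@norm_neq0 _ _ _ (fun g => a0 g) (fun g => act (g, 1%g)) ev0 q ev0G q0).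
have [p0 p0E] := mpoly_descent fixL p'i.
have [q0' q0'E] := mpoly_descent fixL q'i.
have vE' : v = tofrac p' / tofrac q'.
  rewrite vE; apply/eqP.
  by rewrite eqr_div ?tofrac_eq0 ?(ev_neq0 q'0) // -!tofracM tofrac_eq e.
have nzq0 : q0' != 0.
  by apply: contraNneq q'0 => z0; rewrite q0'E z0 !rmorph0.
exists (tofrac p0 / tofrac q0'); split.
  by rewrite vE' fmorph_div !extend_tofrac -p0E -q0'E.
exists p0, q0'; rewrite -!mmap_map_mpoly -p0E -q0'E; split=> //.
have := congr1 ev0 e; rewrite !rmorphM uE => e'.
by apply/eqP; rewrite eqr_div // e' //.
Qed.

(** The lift psi u of an invariant u is a quotient P / Q of invariant elements of
    R1. The fraction kap P / kap Q is fixed by G1, which acts on its coefficients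
    only, hence has coefficients in K. *)
Lemma invariant_section : exists sg : Lam -> {fraction {mpoly K[N]}},
  [/\ forall k, sg (iL (iK k)) = tofrac k%:MP,
      forall u v, fixed u -> fixed v -> sg (u + v) = sg u + sg v,
      forall u v, fixed u -> fixed v -> sg (u * v) = sg u * sg v
    & forall u, fixed u -> specializes (mmap (iL \o iK) f) (sg u) u].
Proof.
pose good u v0 := related u (jF v0) /\ specializes (mmap (iL \o iK) f) v0 u.
pose sg u := epsilon (inhabits 0) (good u).
have sgP u : fixed u -> good u (sg u).
  move=> /fixed_psi[P [Q [Pi Qi Q0 uE]]].
  have uv : related u (kap P / kap Q) by exists P, Q.
  have [v0 [vE sp]] := related_descent uv.
  apply: (epsilon_spec (inhabits 0) (good u)); exists v0; split=> //.
  by rewrite -vE.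
exists sg; split.
- move=> k; have kf : fixed (iL (iK k)) by move=> g; rewrite act_const aLK.
  have [r _] := sgP _ kf; apply: (fmorph_inj jF).
  by rewrite (related_fun r (relatedC k)) extend_tofrac map_mpolyC.
- move=> u v fu fv; have [ru _] := sgP _ fu; have [rv _] := sgP _ fv.
  have fuv : fixed (u + v) by move=> g; rewrite rmorphD fu fv.
  have [ruv _] := sgP _ fuv; apply: (fmorph_inj jF); rewrite rmorphD.
  exact: related_fun ruv (relatedD ru rv).
- move=> u v fu fv; have [ru _] := sgP _ fu; have [rv _] := sgP _ fv.
  have fuv : fixed (u * v) by move=> g; rewrite rmorphM fu fv.
  have [ruv _] := sgP _ fuv; apply: (fmorph_inj jF); rewrite rmorphM.
  exact: related_fun ruv (relatedM ru rv).
- by move=> u /sgP[].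
Qed.

End InvariantSection.

(** * The section when L contains enough roots of unity *)

Local Notation ratfun L n := {fraction {mpoly L[n]}}.

(** H is abelian and L contains enough roots of unity, so that there are
    eigenvectors for a basis of the characters of H. The exponents of the
    H-invariant monomials in their conjugates belong to Kummer lattices, one for
    each basic character, and the latter factor through permutation lattices. *)
Lemma cyclotomic_section (K L : fieldType) (iK : {rmorphism K -> L})
    (G1 H : finGroupType) (aL : G1 -> {rmorphism L -> L}) n
    (a : G1 * H -> 'M[int]_n)
    (act : G1 * H -> {rmorphism ratfun L n -> ratfun L n})
    m (z : L) (tau : G1) t
    (C : finType) (aC : G1 * H -> C -> C) (s : C -> ratfun L n)
    (b : 'I_n -> C -> int) :
  (forall l, aL 1%g l = l) -> (forall g h l, aL (g * h)%g l = aL g (aL h l)) ->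
  (forall g, (forall l, aL g l = l) -> g = 1%g) ->
  (forall l, (forall g, aL g l = l) -> exists k, l = iK k) ->
  (forall g k, aL g (iK k) = iK k) ->
  (forall u, act 1%g u = u) -> (forall g h u, act (g * h)%g u = act g (act h u)) ->
  (forall g, (forall u, act g u = u) -> g = 1%g) ->
  (forall g l, act g (ratfun_const L n l) = ratfun_const L n (aL g.1 l)) ->
  (forall g j, act g (tofrac 'X_j) = laurent L (fun i => a g i j)) ->
  abelian [set: H] -> (forall h : H, h ^+ m = 1)%g -> m.-primitive_root z ->
  aL tau z = z ^+ t -> (forall g, exists k, aL g z = z ^+ (t ^ k)) ->
  (forall c, aC 1%g c = c) -> (forall g h c, aC (g * h)%g c = aC g (aC h c)) ->
  (forall c, s c != 0) -> (forall g c, s (aC g c) = act g (s c)) ->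
  (forall j, tofrac 'X_j = \prod_c s c ^ b j c) ->
  (forall g j c, \sum_i a g i j * b i (aC g c) = b j c) ->
  exists N (f : 'I_N -> ratfun L n)
    (sg : ratfun L n -> {fraction {mpoly K[N]}}),
  let fixed u := forall g, act g u = u in
  (forall k, fixed (f k)) /\
  [/\ forall k, sg (ratfun_const L n (iK k)) = tofrac k%:MP,
      forall u v, fixed u -> fixed v -> sg (u + v) = sg u + sg v,
      forall u v, fixed u -> fixed v -> sg (u * v) = sg u * sg v
    & forall u, fixed u ->
        specializes (mmap (ratfun_const L n \o iK) f) (sg u) u].
Proof.
move=> aL1 aLM aLf fixL aLK act1 actM actf actL actX abH Hm zP ztau zG.
move=> aC1 aCM s0 sE sX bE.
pose iL : {rmorphism L -> ratfun L n} := ratfun_const L n.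
have [I [h [c [cM ch c1]]]] := dual_basis abH.
have m0 := prim_order_gt0 zP.
pose o i := #[h i]%g.
have om i : (o i %| m)%N by rewrite order_dvdn Hm.
pose zi i := iL (z ^+ (m %/ o i)).
have ziP i : (o i).-primitive_root (zi i).
  rewrite fmorph_primitive_root.
  have mo : (m = m %/ o i * o i)%N by rewrite divnK ?om.
  have mo0 : (0 < m %/ o i)%N by rewrite divn_gt0 ?order_gt0 // dvdn_leq ?om.
  have := exp_prim_root zP (m %/ o i).
  have -> : gcdn (m %/ o i) m = (m %/ o i)%N.
    by apply/gcdn_idPl/dvdnP; exists (o i); rewrite {1}mo mulnC.
  by rewrite {1}mo mulKn.
have z_fix i k : act (1%g, k) (zi i) = zi i by rewrite /zi actL aL1.
have ziG i g : act (g, 1%g) (zi i) = iL (aL g (z ^+ (m %/ o i))) by rewrite /zi actL.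
have zitau i : act (tau, 1%g) (zi i) = zi i ^+ t.
  by rewrite ziG rmorphXn ztau exprAC -rmorphXn.
have ziGk i g : exists k, act (g, 1%g) (zi i) = zi i ^+ (t ^ k).
  by have [k kE] := zG g; exists k; rewrite ziG rmorphXn kE exprAC -rmorphXn.
(* an eigenvector is a nonzero value of the projector on the character *)
have /fin_all_exists[e0 e0P] : forall i, exists e : ratfun L n,
    e != 0 /\ forall k, act (1%g, k) e = zi i ^+ c i k * e.
  move=> i.
  pose actH k : {rmorphism ratfun L n -> ratfun L n} := act (1%g, k).
  have actH1 u : actH 1%g u = u by rewrite /actH act1.
  have actHM k l u : actH (k * l)%g u = actH k (actH l u).
    rewrite /actH -actM; congr (act _ _); congr (_, _); by rewrite mulg1.
  have actHf k : (forall u, actH k u = u) -> k = 1%g by move=> /actf[].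
  have zn0 k : zi i ^- c i k != 0.
    rewrite invr_eq0 expf_neq0 //; apply/negP => /eqP z0.
    have := prim_expr_order (ziP i); rewrite z0 expr0n.
    by rewrite gtn_eqF ?order_gt0 // => /eqP; rewrite eq_sym oner_eq0.
  have [v v0] := @dedekind_neq0 _ _ actH actH1 actHM actHf (fun k => zi i ^- c i k) _ (zn0 1%g).
  exists (\sum_k zi i ^- c i k * actH k v); split=> // k.
  rewrite rmorph_sum mulr_sumr [RHS](reindex_inj (mulgI k)) /=.
  apply: eq_bigr => l _; rewrite rmorphM -/(actH k) actHM mulrA; congr (_ * _).
  have -> : actH k (zi i ^- c i l) = zi i ^- c i l by rewrite fmorphV rmorphXn /actH z_fix.
  have -> : zi i ^+ c i (k * l)%g = zi i ^+ c i k * zi i ^+ c i l.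
    by rewrite -exprD; apply/eqP; rewrite (eq_prim_root_expr (ziP i)); apply/eqP; apply: cM.
  have zk0 : zi i ^+ c i k != 0 by have := zn0 k; rewrite invr_eq0.
  by rewrite invfM mulrA (mulfV zk0) mul1r.
pose T := (I * G1)%type.
pose aT g (u : T) : T := (u.1, (g * u.2)%g).
pose e (u : T) : ratfun L n := act (u.2, 1%g) (e0 u.1).
pose chi (u : T) k : L := aL u.2 (z ^+ (m %/ o u.1)) ^+ c u.1 k.
have aTP : is_action aT.
  by split=> [[i g]|k l [i g]]; rewrite /aT /= ?mul1g ?mulgA.
have e_neq0 u : e u != 0 by rewrite fmorph_eq0; case: (e0P u.1).
have eG g u : act (g, 1%g) (e u) = e (aT g u) by rewrite /e actM1.
have eH k u : act (1%g, k) (e u) = iL (chi u k) * e u.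
  rewrite /e act_swap //; have [_ ->] := e0P u.1.
  by rewrite rmorphM rmorphXn ziG -rmorphXn.
have chif k : (forall u, chi u k = 1) -> k = 1%g.
  move=> ck; apply: c1 => i; have := ck (i, 1%g); rewrite /chi /= aL1.
  move/(congr1 iL); rewrite rmorph1 rmorphXn => /eqP.
  by rewrite -(prim_order_dvd (ziP i)) => /eqP->; rewrite mod0n.
have pairE (w : T -> ratfun L n) : \prod_u w u = \prod_i \prod_g w (i, g).
  by rewrite pair_bigA; apply: eq_bigr => -[].
have lat : perm_factors act aT (char_lattice chi) (fun x => \prod_u e u ^ x u).
  have pfi i : perm_factors act (fun g k : G1 => (g * k)%g)
      (kummer_lattice act (zi i)) (orbit_prod act (e0 i)).
    have [ei0 eiH] := e0P i.
    exact: (kummer_factors act1 actM actf (ziP i) (z_fix i) (zitau i) (ziGk i) ei0 eiH).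
  apply: pf_ext (pf_family pfi) => x; last first.
    by move=> _; rewrite pairE; apply: eq_bigr => i _;
       apply: eq_bigr => g _; rewrite ffunE.
  move=> jx i; have := congr1 iL (jx (h i)).
  rewrite rmorph1 rmorph_prod /= pairE (bigD1 i) //= [X in _ * X]big1 ?mulr1.
    move=> e1; rewrite /kummer_lattice -[RHS]e1; apply: eq_bigr => g _.
    rewrite ffunE -[RHS]/(iL (chi (i, g) (h i) ^ x (i, g))) fmorphXz; congr (_ ^ _).
    rewrite ziG; apply: (congr1 iL); rewrite -[RHS]rmorphXn; apply: (congr1 (aL g)).
    apply: (fmorph_inj iL); rewrite [RHS]rmorphXn -[LHS]expr1 -/(zi i); apply/eqP.
    by rewrite (eq_prim_root_expr (ziP i)) ch eqxx.
  move=> k ki; apply: big1 => g _.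
  rewrite -[LHS]/(iL (chi (k, g) (h i) ^ x (k, g))) /chi /= -[_ ^+ c _ _]rmorphXn.
  have -> : (z ^+ (m %/ o k)) ^+ c k (h i) = 1.
    apply: (fmorph_inj iL); rewrite rmorph1 rmorphXn -/(zi k); apply/eqP.
    by rewrite -(prim_order_dvd (ziP k)) /dvdn ch (negbTE ki) mod0n.
  by rewrite rmorph1 exp1rz.
have [N [f [R1 [cR [ev1 [rho [st [kap]]]]]]]] := local_lift aL1 aLM aLf act1 actM actL
  aTP e_neq0 eG eH chif lat aC1 aCM sE.
move=> [ff [[rho1 rhoM ev1G] [ev1C rhoC] [ev1s rhos] [kD kM kC ksp kG]]].
exists N, f.
have [sg sgP] := @invariant_section K L iK G1 H aL aL1 aLM fixL aLK n a act actL actX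
  C aC s b aC1 aCM s0 sX bE N f R1 cR ev1 rho st kap rho1 rhoM ev1G ev1C rhoC
  ev1s rhos kD kM kC ksp kG ff.
by exists sg; split.
Qed.

(** * Permutation lattices *)

Section LatticeAction.

Variables (gT : finGroupType) (M : glatticeType gT).

Fact lact_is_zmod_morphism g : zmod_morphism (@lact gT M g).
Proof.
move=> x y; have e := @lactD gT M g.
have l0 : lact g (0 : M) = 0 by apply: (addrI (lact g 0)); rewrite -e !addr0.
rewrite e; congr (_ + _); apply: (addrI (lact g y)).
by rewrite -e !subrr l0.
Qed.

HB.instance Definition _ g :=
  GRing.isZmodMorphism.Build M M (@lact gT M g) (lact_is_zmod_morphism g).

Lemma lattice_torsion_free (x : M) k : x *+ k.+1 = 0 -> x = 0.
Proof.
have [n [b [bi bK biK]]] := @lattice_basis gT M.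
rewrite -[x]biK -sumrMnl => h; apply: big1 => i _.
have : [ffun i => bi x i *+ k.+1] = [ffun=> 0].
  apply: (can_inj bK); rewrite (eq_bigr (fun i => b i *~ bi x i *+ k.+1)).
    by rewrite h big1 // => j _; rewrite ffunE mulr0z.
  by move=> j _; rewrite ffunE -mulr_natr natz mulrzA.
move/ffunP/(_ i); rewrite !ffunE => /eqP; rewrite -mulr_natr mulf_eq0 natz orbF => /eqP->.
by rewrite mulr0z.
Qed.

End LatticeAction.

(** N is a normal subgroup and G acts modulo N through the set-theoretic
    lift tau. *)
Section Orbits.

Variables (pT G : finGroupType) (N : {group pT}) (tau : G -> pT).
Hypothesis nN : forall g n, n \in N -> exists2 n', n' \in N & (g * n = n' * g)%g.
Hypothesis tau1 : tau 1%g \in N.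
Hypothesis tauM : forall g h, exists2 n, n \in N & tau (g * h)%g = (n * (tau g * tau h))%g.

Definition fixed_by (P : glatticeType pT) (p : P) := forall n, n \in N -> lact n p = p.

Lemma lact_fixed (P : glatticeType pT) g (p : P) : fixed_by p -> fixed_by (lact g p).
Proof.
move=> fp n Nn; have [n' Nn' e] := nN g^-1 Nn; rewrite -lactM.
have -> : (n * g = g * n')%g.
  by apply: (mulgI g^-1%g); rewrite mulgA e mulgKV mulKg.
by rewrite lactM fp.
Qed.

Lemma lact_tauM (P : glatticeType pT) g h (p : P) : fixed_by p ->
  lact (tau (g * h)%g) p = lact (tau g) (lact (tau h) p).
Proof.
move=> fp; have [n Nn ->] := tauM g h.
by rewrite -lactM [LHS]lactM; apply: (lact_fixed (tau g * tau h)%g fp Nn).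
Qed.

(** The N-invariants of a permutation lattice have the orbit sums as a basis,
    permuted by G. To stay with an index type that is an initial segment,
    orbits are named by representatives; the other indices are inert. *)
Lemma orbit_basis (P : glatticeType pT) : permutation_lattice P ->
  exists (C : finType) (aC : G -> C -> C) (B : C -> P) (co : P -> C -> int),
  [/\ (forall c, aC 1%g c = c) /\ (forall g h c, aC (g * h)%g c = aC g (aC h c)),
      (forall c, fixed_by (B c)) /\ (forall g c, lact (tau g) (B c) = B (aC g c)),
      forall x y c, co (x + y) c = co x c + co y c,
      forall p, fixed_by p -> p = \sum_c B c *~ co p c
    & forall g p c, fixed_by p -> co (lact (tau g) p) (aC g c) = co p c].
Proof.
move=> [k [b [[bi bK biK] bperm]]].
have bI : injective b.
  move=> i j bij; pose d (l : 'I_k) : {ffun 'I_k -> int} := [ffun m => (m == l)%:R].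
  have dE l : \sum_m b m *~ d l m = b l.
    rewrite (bigD1 l) //= ffunE eqxx mulr1z big1 ?addr0 // => m ml.
    by rewrite ffunE (negbTE ml) mulr0z.
  have /ffunP/(_ i) : d i = d j by apply: (can_inj bK); rewrite !dE.
  by rewrite !ffunE eqxx; case: eqP.
have coD x y : bi (x + y) = bi x + bi y.
  apply: (can_inj bK); rewrite biK -{1}[x]biK -{1}[y]biK -big_split.
  by apply: eq_bigr => i _; rewrite ffunE mulrzDr.
have /fin_all_exists[ag agP] : forall g,
    exists ag : {ffun 'I_k -> 'I_k}, forall i, lact g (b i) = b (ag i).
  move=> g; have /fin_all_exists[h hP] := bperm g.
  by exists [ffun i => h i] => i; rewrite ffunE.
have agM g h i : ag (g * h)%g i = ag g (ag h i).
  by apply: bI; rewrite -!agP lactM.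
have ag1 i : ag 1%g i = i by apply: bI; rewrite -agP lact1.
have agK g : cancel (ag g) (ag g^-1%g) by move=> i; rewrite -agM mulVg ag1.
have coG g p i : bi (lact g p) (ag g i) = bi p i.
  have : bi (lact g p) = [ffun j => bi p (ag g^-1%g j)].
    apply: (can_inj bK); rewrite biK -{1}[p]biK raddf_sum.
    rewrite [RHS](reindex_inj (can_inj (agK g))); apply: eq_bigr => j _.
    by rewrite raddfMz /= agP ffunE agK.
  by move/ffunP->; rewrite ffunE agK.
pose O i := [set ag n i | n in N].
pose rep i := odflt i [pick j in O i].
have repP i : exists2 n, n \in N & rep i = ag n i.
  rewrite /rep; case: pickP => [j /imsetP[n Nn ->]|/(_ i)]; first by exists n.
  by case/imsetP; exists 1%g; rewrite ?group1 ?ag1.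
have repN n i : n \in N -> rep (ag n i) = rep i.
  move=> Nn; have -> : rep i = odflt (ag n i) [pick j in O i].
    rewrite /rep; case: pickP => // /(_ i).
    by case/imsetP; exists 1%g; rewrite ?group1 ?ag1.
  rewrite /rep; congr odflt; apply: eq_pick => j.
  apply/imsetP/imsetP => -[m Nm ->].
    by exists (m * n)%g; rewrite ?groupM ?agM.
  by exists (m * n^-1)%g; rewrite ?groupM ?groupV // -agM mulgKV.
have rep2 i : rep (rep i) = rep i by have [n Nn e] := repP i; rewrite {1}e repN.
have repG g i : rep (ag g (rep i)) = rep (ag g i).
  have [n Nn ->] := repP i; have [n' Nn' e] := nN g Nn.
  by rewrite -agM e agM repN.
have repM g h i : rep (ag (tau (g * h)%g) i) = rep (ag (tau g) (rep (ag (tau h) i))).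
  by have [n Nn ->] := tauM g h; rewrite repG !agM repN.
pose aC g c := if rep c == c then rep (ag (tau g) c) else c.
pose B c := \sum_(i | rep i == c) b i.
have B0 c : rep c != c -> B c = 0.
  by move=> rc; apply: big_pred0 => i; apply: contraNF rc => /eqP<-; rewrite rep2.
exists 'I_k, aC, B, (fun p c => if rep c == c then bi p c else 0); split.
- split=> [c|g h c]; rewrite /aC.
    by case: eqP => // rc; rewrite repN.
  by case: (rep c =P c) => rc; rewrite ?rep2 ?eqxx ?repM //; case: eqP.
- have Bg (a : pT) c : rep c = c -> lact a (B c) = B (rep (ag a c)).
    move=> rc; rewrite raddf_sum /B.
    rewrite [RHS](reindex_inj (can_inj (agK a))); apply: eq_big => [i|i _]; last exact: agP.
    apply/eqP/eqP => [<-|e]; first by rewrite repG.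
    have := congr1 (fun j => rep (ag a^-1%g j)) e.
    by rewrite !repG !agK rc.
  split=> [c n Nn|g c].
    have [rc|rc] := eqVneq (rep c) c; last by rewrite (B0 _ rc) raddf0.
    by rewrite Bg // repN // rc.
  rewrite /aC; case: eqP => rc; first exact: Bg.
  by rewrite B0 ?raddf0 //; apply/eqP.
- by move=> x y c; case: eqP => _; rewrite ?addr0 // coD ffunE.
- move=> p fp; rewrite -{1}[p]biK (partition_big rep xpredT) //=.
  apply: eq_bigr => c _; case: eqP => rc.
    rewrite /B mulrz_suml; apply: eq_bigr => i /eqP ic.
    congr (_ *~ _); have [n Nn] := repP i; rewrite ic => ->.
    by rewrite -[RHS](coG n^-1%g) agK fp ?groupV.
  by rewrite big_pred0 // => i; apply/eqP => ic; apply: rc; rewrite -ic rep2.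
- move=> g p c fp; rewrite /aC; case: (rep c =P c) => rc; last by case: eqP.
  rewrite rep2 eqxx; have [n Nn ->] := repP (ag (tau g) c).
  by rewrite -[RHS](coG (tau g)) -[RHS](coG n) (lact_fixed (tau g) fp Nn).
Qed.

End Orbits.

(** * Extending homomorphisms to the multiplicative group *)

(** Hilbert's Theorem 90 for the units indexed by a finite G-set. The solution is
    a Poincare series, nonzero for some argument by Dedekind independence. *)
Lemma hilbert90_perm (G : finGroupType) (F : fieldType) (act : G -> {rmorphism F -> F})
    (C : finType) (aC : G -> C -> C) (a : G -> C -> F) :
  (forall u, act 1%g u = u) -> (forall g h u, act (g * h)%g u = act g (act h u)) ->
  (forall g, (forall u, act g u = u) -> g = 1%g) ->
  (forall c, aC 1%g c = c) -> (forall g h c, aC (g * h)%g c = aC g (aC h c)) ->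
  (forall g c, a g c != 0) ->
  (forall g h c, a (g * h)%g c = act g (a h c) * a g (aC h c)) ->
  exists u : C -> F, (forall c, u c != 0) /\ forall g c, act g (u c) = a g c * u (aC g c).
Proof.
move=> act1 actM actf aC1 aCM a0 aM.
pose O c := [set aC g c | g : G].
have OG g c : O (aC g c) = O c.
  apply/setP => d; apply/imsetP/imsetP => -[h _ ->].
    by exists (h * g)%g; rewrite // aCM.
  by exists (h * g^-1)%g; rewrite // -aCM mulgKV.
pose uu (v : F) c := \sum_k (a k (aC k^-1%g c))^-1 * act k v.
have uuG v g c : act g (uu v c) = a g c * uu v (aC g c).
  rewrite rmorph_sum mulr_sumr [RHS](reindex_inj (mulgI g)) /=.
  apply: eq_bigr => k _; rewrite rmorphM -actM mulrA; congr (_ * _).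
  rewrite invMg -!aCM mulgKV aM -aCM mulgV aC1 fmorphV invfM mulrCA mulfV ?mulr1 //.
have ex c : exists v, uu v c != 0.
  pose d k := (a k (aC k^-1%g c))^-1.
  have d0 : d 1%g != 0 by rewrite invr_eq0.
  by have [v v0] := @dedekind_neq0 _ _ act act1 actM actf d 1%g d0; exists v.
(* the same v has to serve for all points of an orbit *)
pose vO (S : {set C}) := if [pick c | O c == S] is Some c
  then epsilon (inhabits 0) (fun v => uu v c != 0) else 0.
have vOP c : uu (vO (O c)) c != 0.
  rewrite /vO; case: pickP => [d /eqP Od|/(_ c)]; last by rewrite eqxx.
  have dP := epsilon_spec (inhabits 0) (fun v => uu v d != 0) (ex d).
  have /imsetP[g _ ->] : c \in O d.
    by rewrite Od; apply/imsetP; exists 1%g; rewrite ?aC1.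
  set v := epsilon _ _ in dP *.
  apply: contraNneq dP => e; rewrite -(fmorph_eq0 (act g)) uuG.
  by rewrite e mulr0.
exists (fun c => uu (vO (O c)) c); split=> // g c.
by rewrite uuG OG.
Qed.

Section MultiplicativeMaps.

Variables (V : zmodType) (S : V -> Prop) (F : fieldType) (phi : V -> F).
Hypothesis SB : forall x y, S x -> S y -> S (x - y).
Hypothesis S0 : S 0.
Hypothesis phiD : forall x y, S x -> S y -> phi (x + y) = phi x * phi y.
Hypothesis phi_neq0 : forall x, S x -> phi x != 0.

Let SN x : S x -> S (- x). Proof. by move=> Sx; rewrite -sub0r; apply: SB. Qed.

Let SD x y : S x -> S y -> S (x + y).
Proof. by move=> Sx Sy; rewrite -[y]opprK; apply: SB => //; apply: SN. Qed.

Lemma phi0 : phi 0 = 1.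
Proof. by apply: (mulfI (phi_neq0 S0)); rewrite -phiD // addr0 mulr1. Qed.

Let SMn x k : S x -> S (x *+ k).
Proof. by move=> Sx; elim: k => [|k IH]; rewrite ?mulr0n // mulrS; apply: SD. Qed.

Let phiMn x k : S x -> phi (x *+ k) = phi x ^+ k.
Proof.
move=> Sx; elim: k => [|k IH]; first by rewrite mulr0n phi0.
by rewrite mulrS exprS phiD ?IH //; apply: SMn.
Qed.

Lemma SMz x (k : int) : S x -> S (x *~ k).
Proof. by case: k => k Sx; [apply: SMn | apply/SN/SMn]. Qed.

Lemma phiMz x (k : int) : S x -> phi (x *~ k) = phi x ^ k.
Proof.
case: k => k Sx; first exact: phiMn.
rewrite NegzE mulrNz; have Sk : S (x *~ k.+1) by apply: SMn.
apply: (mulfI (phi_neq0 Sk)); rewrite -phiD ?subrr ?phi0; [|exact: Sk|exact: SN].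
by rewrite -NegzE [phi (_ *~ _)](phiMn k.+1 Sx) mulfV // expf_neq0 // phi_neq0.
Qed.

Lemma phi_sum (I : finType) (x : I -> V) (k : I -> int) : (forall i, S (x i)) ->
  phi (\sum_i x i *~ k i) = \prod_i phi (x i) ^ k i.
Proof.
move=> Sx; suff [] : phi (\sum_i x i *~ k i) = \prod_i phi (x i) ^ k i
                     /\ S (\sum_i x i *~ k i) by [].
apply: (big_rec2 (fun v u => phi v = u /\ S v)) => [|i v u _ [<- Sv]].
  by rewrite phi0.
by rewrite phiD ?phiMz //; [split=> //; apply: SD => //; apply: SMz | apply: SMz].
Qed.

End MultiplicativeMaps.

Section Factorization.

Variables (pT G : finGroupType) (N : {group pT}) (tau : G -> pT).
Hypothesis nN : forall g n, n \in N -> exists2 n', n' \in N & (g * n = n' * g)%g.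
Hypothesis tau1 : tau 1%g \in N.
Hypothesis tauM : forall g h, exists2 n, n \in N & tau (g * h)%g = (n * (tau g * tau h))%g.

Lemma can_additive (U V : zmodType) (f : {additive U -> V}) g :
  cancel f g -> cancel g f -> {morph g : x y / x + y}.
Proof. by move=> fK gK x y; apply: (can_inj fK); rewrite raddfD !gK. Qed.

Lemma can_equivariant (U V : glatticeType pT) (f : U -> V) g :
  equivariant f -> cancel f g -> cancel g f -> equivariant g.
Proof. by move=> fE fK gK a x; apply: (can_inj fK); rewrite fE !gK. Qed.

(** The isomorphisms E + P1 = E' + Q1 and E' + N' = P2 make E an equivariant
    retract of Q1 + P2; the generators are the images of the orbit sums there. *)
Lemma summand_generators (E E' : glatticeType pT) :
  similar E E' -> invertible_lattice E' ->
  exists (D : finType) (aD : G -> D -> D) (eb : D -> E) (nn : E -> D -> int),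
  [/\ (forall d, aD 1%g d = d) /\ (forall g h d, aD (g * h)%g d = aD g (aD h d)),
      (forall d, fixed_by N (eb d)) /\ (forall g d, lact (tau g) (eb d) = eb (aD g d)),
      forall x y d, nn (x + y) d = nn x d + nn y d,
      forall x, fixed_by N x -> x = \sum_d eb d *~ nn x d
    & forall g x d, fixed_by N x -> nn (lact (tau g) x) (aD g d) = nn x d].
Proof.
move=> [P1 [Q1 [_ pQ1 [f1 [f1E [g1 f1K g1K]]]]]] [N' [P2 [pP2 [f2 [f2E [g2 f2K g2K]]]]]].
have g1D := can_additive f1K g1K; have g1E := can_equivariant f1E f1K g1K.
have g2D := can_additive f2K g2K; have g2E := can_equivariant f2E f2K g2K.
have g10 : g1 0 = 0 by rewrite -(raddf0 f1) f1K.
have g20 : g2 0 = 0 by rewrite -(raddf0 f2) f2K.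
have [D1 [a1 [B1 [c1 [[a11 a1M] [B1f B1G] c1D c1S c1G]]]]] := orbit_basis nN tau1 tauM pQ1.
have [D2 [a2 [B2 [c2 [[a21 a2M] [B2f B2G] c2D c2S c2G]]]]] := orbit_basis nN tau1 tauM pP2.
pose j1 (e : E) : Q1 := (f1 (e, 0)).2.
pose j2 (e : E) : P2 := f2 ((f1 (e, 0)).1, 0).
pose q1 (x : Q1) : E := (g1 (0, x)).1.
pose q2 (x : P2) : E := (g1 ((g2 x).1, 0)).1.
have pl (U V : zmodType) (x y : U) : (x + y, 0) = (x, 0) + (y, 0) :> U * V.
  by rewrite -{1}[0]addr0.
have pr (U V : zmodType) (x y : V) : (0, x + y) = (0, x) + (0, y) :> U * V.
  by rewrite -{1}[0]addr0.
have j1D x y : j1 (x + y) = j1 x + j1 y by rewrite /j1 pl raddfD.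
have j2D x y : j2 (x + y) = j2 x + j2 y by rewrite /j2 pl raddfD /= pl raddfD.
have q1D x y : q1 (x + y) = q1 x + q1 y by rewrite /q1 pr g1D.
have q2D x y : q2 (x + y) = q2 x + q2 y by rewrite /q2 g2D /= pl g1D.
have j1G g x : j1 (lact g x) = lact g (j1 x).
  by rewrite /j1 -[in LHS](raddf0 (lact g : {additive P1 -> P1})) (f1E g (x, 0)).
have j2G g x : j2 (lact g x) = lact g (j2 x).
  rewrite /j2 -[in X in f1 (_, X)](raddf0 (lact g : {additive P1 -> P1})) (f1E g (x, 0)).
  rewrite -[in LHS](raddf0 (lact g : {additive N' -> N'})).
  exact: (f2E g ((f1 (x, 0)).1, 0)).
have q1G g x : q1 (lact g x) = lact g (q1 x).
  by rewrite /q1 -[in LHS](raddf0 (lact g : {additive E' -> E'})) (g1E g (0, x)).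
have q2G g x : q2 (lact g x) = lact g (q2 x).
  rewrite /q2 g2E -[in LHS](raddf0 (lact g : {additive Q1 -> Q1})).
  by rewrite (g1E g ((g2 x).1, 0)).
have jq x : x = q1 (j1 x) + q2 (j2 x).
  have e : f1 (x, 0) = (0, (f1 (x, 0)).2) + ((f1 (x, 0)).1, 0).
    by case: (f1 (x, 0)) => u v; congr (_, _); rewrite ?addr0 ?add0r.
  by rewrite /q1 /q2 /j1 /j2 f2K -[RHS](congr1 fst (g1D _ _)) -e f1K.
have q1z x k : q1 (x *~ k) = q1 x *~ k.
  have q1m : zmod_morphism q1.
    move=> u v; apply: (addIr (q1 v)); rewrite subrK -q1D subrK //.
  pose q1a : {additive Q1 -> E} := HB.pack q1 (GRing.isZmodMorphism.Build _ _ _ q1m).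
  exact: (raddfMz q1a).
have q2z x k : q2 (x *~ k) = q2 x *~ k.
  have q2m : zmod_morphism q2.
    move=> u v; apply: (addIr (q2 v)); rewrite subrK -q2D subrK //.
  pose q2a : {additive P2 -> E} := HB.pack q2 (GRing.isZmodMorphism.Build _ _ _ q2m).
  exact: (raddfMz q2a).
have q10 : q1 0 = 0 by rewrite /q1 -[(0, 0)]/(0 : E' * Q1) g10.
have q20 : q2 0 = 0 by rewrite /q2 g20 -[(_, 0)]/(0 : E' * Q1) g10.
pose aD g (d : D1 + D2) : D1 + D2 :=
  match d with inl u => inl (a1 g u) | inr u => inr (a2 g u) end.
pose eb (d : D1 + D2) := match d with inl u => q1 (B1 u) | inr u => q2 (B2 u) end.
pose nn x (d : D1 + D2) := match d with inl u => c1 (j1 x) u | inr u => c2 (j2 x) u end.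
exists (D1 + D2)%type, aD, eb, nn; split.
- by split=> [[d|d]|g h [d|d]] /=; rewrite ?a11 ?a21 ?a1M ?a2M.
- split=> [[d|d] n Nn|g [d|d]] /=.
  + by rewrite -q1G (B1f d n Nn).
  + by rewrite -q2G (B2f d n Nn).
  + by rewrite -q1G B1G.
  + by rewrite -q2G B2G.
- by move=> x y [d|d] /=; rewrite ?j1D ?j2D ?c1D ?c2D.
- move=> x fx; rewrite big_sumType /= {1}[x]jq; congr (_ + _).
    have fj : fixed_by N (j1 x) by move=> n Nn; rewrite -j1G fx.
    rewrite {1}[j1 x]c1S // (big_morph q1 q1D q10).
    by apply: eq_bigr => d _; rewrite q1z.
  have fj : fixed_by N (j2 x) by move=> n Nn; rewrite -j2G fx.
  rewrite {1}[j2 x]c2S // (big_morph q2 q2D q20).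
  by apply: eq_bigr => d _; rewrite q2z.
- move=> g x [d|d] fx /=; rewrite ?j1G ?j2G ?c1G ?c2G //.
    by move=> n Nn; rewrite -j1G fx.
  by move=> n Nn; rewrite -j2G fx.
Qed.

Variables (F : fieldType) (act : G -> {rmorphism F -> F}).
Hypothesis act1 : forall u, act 1%g u = u.
Hypothesis actM : forall g h u, act (g * h)%g u = act g (act h u).
Hypothesis actf : forall g, (forall u, act g u = u) -> g = 1%g.

(** Let 0 -> M -> P -> E -> 0 be a flabby resolution, with E similar to an
    invertible lattice. The obstruction to extending f to the permutation lattice P is a cocycle on the
    permuted generators of E, hence vanishes by Hilbert's Theorem 90. The
    extension restricted to a permuted basis of P factors f. *)
Lemma multiplicative_factors (M : glatticeType pT) (f : M -> F) :
  flabby_class_invertible M -> (forall x : M, fixed_by N x) ->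
  (forall x y, f (x + y) = f x * f y) -> (forall x, f x != 0) ->
  (forall g x, f (lact (tau g) x) = act g (f x)) ->
  exists (C : finType) (aC : G -> C -> C) (s : C -> F) (b : M -> C -> int),
  [/\ (forall c, aC 1%g c = c) /\ (forall g h c, aC (g * h)%g c = aC g (aC h c)),
      (forall c, s c != 0) /\ (forall g c, s (aC g c) = act g (s c)),
      forall x y c, b (x + y) c = b x c + b y c,
      forall g x c, b (lact (tau g) x) (aC g c) = b x c
    & forall x, f x = \prod_c s c ^ b x c].
Proof.
move=> [E' [[_ [P [E [[pP _ [i [p [iE pE [iI pK pS]]]]] simE]]]] invE]] MN fD f0 fE.
have [D [aD [eb [nn [[aD1 aDM] [ebf ebG] nnD nnS nnG]]]]] := summand_generators simE invE.
have [C [aC [B [co [[aC1 aCM] [Bf BG] coD coS coG]]]]] := orbit_basis nN tau1 tauM pP.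
have /fin_all_exists[w wE] : forall d, exists y, eb d = p y by move=> d; apply: pS.
have pi m : p (i m) = 0 by apply/pK; exists m.
have wf d : fixed_by N (w d).
  move=> n Nn; have /pK[m mE] : p (lact n (w d) - w d) = 0.
    by rewrite raddfB pE -wE ebf // subrr.
  have wn : lact n (w d) = w d + i m by rewrite -mE addrC subrK.
  have wnk k : lact (n ^+ k)%g (w d) = w d + i (m *+ k).
    elim: k => [|k IH]; first by rewrite expg0 lact1 mulr0n raddf0 addr0.
    rewrite expgS lactM IH raddfD /= -iE wn MN // -addrA -raddfD.
    by rewrite mulrS.
  have := wnk #[n]%g; rewrite expg_order lact1 -{1}[w d]addr0 => /addrI/esym/eqP.
  rewrite -(raddf0 i) (inj_eq iI) => /eqP; rewrite -[#[n]%g]prednK ?order_gt0 //.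
  by move/lattice_torsion_free => m0; rewrite wn m0 raddf0 addr0.
have nn0 d : nn 0 d = 0 by apply: (addrI (nn 0 d)); rewrite -nnD !addr0.
have ex x : fixed_by N x -> exists m, x - \sum_d w d *~ nn (p x) d = i m.
  move=> fx; have : p (x - \sum_d w d *~ nn (p x) d) = 0.
    rewrite raddfB raddf_sum.
    rewrite (eq_bigr (fun d => eb d *~ nn (p x) d)) => [|d _].
      by rewrite -nnS ?subrr // => n Nn; rewrite -pE fx.
    by rewrite raddfMz /= wE.
  by case/pK => m ->; exists m.
pose mm x := epsilon (inhabits 0) (fun m => x - \sum_d w d *~ nn (p x) d = i m).
have mmP x : fixed_by N x -> x - \sum_d w d *~ nn (p x) d = i (mm x).
  by move=> fx; apply: (epsilon_spec (inhabits 0) _ (ex x fx)).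
have /fin_all_exists[al alP] : forall g, exists al : D -> M, forall d,
    lact (tau g) (w d) = i (al d) + w (aD g d).
  move=> g; apply: (@fin_all_exists _ _ (fun d m =>
    lact (tau g) (w d) = i m + w (aD g d))) => d.
  have /pK[m mE] : p (lact (tau g) (w d) - w (aD g d)) = 0.
    by rewrite raddfB pE -!wE ebG subrr.
  by exists m; rewrite -mE subrK.
have alM g h d : al (g * h)%g d = lact (tau g) (al h d) + al g (aD h d).
  apply: iI; apply: (addIr (w (aD (g * h)%g d))); rewrite -alP.
  rewrite (lact_tauM nN tauM g h (wf d)) [lact (tau h) _]alP lactD [lact _ (w _)]alP aDM raddfD -iE.
  by rewrite addrA.
have [u [u0 uG]] := hilbert90_perm act1 actM actf aD1 aDM (fun g d => f0 (al g d))
  (fun g h d => etrans (congr1 f (alM g h d)) (etrans (fD _ _) (congr1 (fun v => v * _) (fE _ _)))).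
pose S (x : P) := fixed_by N x.
have SB x y : S x -> S y -> S (x - y) by move=> fx fy n Nn; rewrite raddfB /= fx ?fy.
have S0 : S 0 by move=> n _; rewrite raddf0.
pose ff x := f (mm x) * \prod_d u d ^ nn (p x) d.
have mmD x y : S x -> S y -> mm (x + y) = mm x + mm y.
  move=> fx fy; have fxy : S (x + y) by move=> n Nn; rewrite raddfD /= fx ?fy.
  apply: iI; rewrite raddfD -!mmP // addrACA -opprD; congr (_ - _).
  by rewrite -big_split; apply: eq_bigr => d _; rewrite raddfD nnD mulrzDr.
have ffD x y : S x -> S y -> ff (x + y) = ff x * ff y.
  move=> fx fy; rewrite /ff mmD // fD mulrACA -big_split; congr (_ * _).
  by apply: eq_bigr => d _; rewrite raddfD nnD expfzDr.
have ff0 x : S x -> ff x != 0.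
  by move=> _; rewrite mulf_neq0 //; apply/prodf_neq0 => d _; rewrite expfz_neq0.
have fSum (I : finType) (v : I -> M) (k : I -> int) :
    f (\sum_d v d *~ k d) = \prod_d f (v d) ^ k d.
  exact: (phi_sum (S := fun _ => True)).
have ffi m : ff (i m) = f m.
  have fim : S (i m) by move=> n Nn; rewrite -iE MN.
  rewrite /ff pi big1 ?mulr1 => [|d _]; last by rewrite nn0 expr0z.
  congr (f _); apply: iI; rewrite -mmP // pi big1 ?subr0 // => d _.
  by rewrite nn0 mulr0z.
have ffG g x : S x -> ff (lact (tau g) x) = act g (ff x).
  move=> fx; have fpx : fixed_by N (p x) by move=> n Nn; rewrite -pE fx.
  have fgx : S (lact (tau g) x) by apply: lact_fixed.
  have aDK k : cancel (aD k) (aD k^-1%g) by move=> d; rewrite -aDM mulVg aD1.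
  have mmG : mm (lact (tau g) x) = lact (tau g) (mm x) + \sum_d al g d *~ nn (p x) d.
    apply: iI; rewrite -mmP // raddfD /= iE -mmP // raddfB /= -addrA; congr (_ + _).
    rewrite (raddf_sum (lact (tau g) : {additive P -> P})) (raddf_sum i).
    rewrite [X in - X](reindex_inj (can_inj (aDK g))) -!sumrN -big_split.
    apply: eq_bigr => d _; rewrite pE nnG //.
    rewrite (raddfMz (lact (tau g) : {additive P -> P})) (raddfMz i) /= alP mulrzDl opprD.
    by rewrite addrAC addNr add0r.
  rewrite /ff mmG fD fE fSum rmorphM -mulrA; congr (_ * _).
  rewrite [X in _ * X](reindex_inj (can_inj (aDK g))) -big_split rmorph_prod.
  by apply: eq_bigr => d _; rewrite pE nnG // fmorphXz uG expfzMl.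
exists C, aC, (fun c => ff (B c)), (fun x c => co (i x) c); split=> //.
- by split=> [c|g c]; [apply: ff0; apply: Bf | rewrite -BG ffG //; apply: Bf].
- by move=> x y c; rewrite raddfD coD.
- by move=> g x c; rewrite iE coG // => n Nn; rewrite -iE MN.
- move=> x; rewrite -ffi {1}[i x]coS; last by move=> n Nn; rewrite -iE MN.
  by rewrite (phi_sum SB S0 ffD ff0).
Qed.

End Factorization.

(** * Adjoining roots of unity *)

Lemma irreducible_divisor (F : fieldType) (p : {poly F}) : (1 < size p)%N ->
  exists2 q, q %| p & irreducible_poly q.
Proof.
have [k] := ubnP (size p); elim: k p => // k IH p; rewrite ltnS => pk p1.
case: (classic (irreducible_poly p)) => [|nirr]; first by exists p.
have p0 : p != 0 by rewrite -size_poly_gt0 ltnW.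
have [q [q1 qp nqp]] : exists q : {poly F}, [/\ size q != 1, q %| p & ~~ (q %= p)].
  apply: NNPP => nex; apply: nirr; split=> // q q1 qp; apply: contraT => nqp.
  by case: nex; exists q.
have q0 : q != 0 by rewrite (dvdpN0 qp p0).
have ltq : (size q < size p)%N.
  by rewrite ltn_neqAle dvdp_leq // andbT (dvdp_size_eqp qp).
have [||r rq ri] := IH q; first exact: leq_trans ltq pk.
  by rewrite ltn_neqAle eq_sym q1 size_poly_gt0.
by exists r => //; apply: dvdp_trans rq qp.
Qed.

Lemma irreducible_root (F E : fieldType) (i : {rmorphism F -> E}) (p q : {poly F}) z :
  irreducible_poly p -> root (map_poly i p) z -> root (map_poly i q) z = (p %| q).
Proof.
move=> pirr pz; apply/idP/idP => [qz|]; last first.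
  by rewrite -(dvdp_map i); move: pz; rewrite !root_factor_theorem => /dvdp_trans; apply.
have [cpq|] := boolP (coprimep p q).
  by have := coprimep_root (etrans (coprimep_map i p q) cpq) pz; rewrite (rootP qz) eqxx.
rewrite coprimep_def => g1; rewrite -(eqp_dvdl _ (pirr _ g1 (dvdp_gcdl p q))).
exact: dvdp_gcdr.
Qed.

Lemma minPoly_base (F : fieldType) (L : fieldExtType F) (x : L) :
  exists2 p : {poly F}, map_poly (in_alg L) p = minPoly 1 x & irreducible_poly p.
Proof.
have /polyOver1P[p pE] := minPolyOver 1 x; exists p => //; split.
  by rewrite -(size_map_poly (in_alg L)) -pE size_minPoly ltnS adjoin_degreeE dimv1 divn1 adim_gt0.
move=> q q1 qp; rewrite -(eqp_map (in_alg L)) -pE.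
have := @minPoly_irr _ _ 1%AS x (map_poly (in_alg L) q).
rewrite alg_polyOver pE dvdp_map qp => /(_ isT isT) /orP[] //.
by rewrite -size_poly_eq1 size_map_poly (negbTE q1).
Qed.

(** A primitive root of unity and any other root of its minimal polynomial
    satisfy the same equations over the base field. *)
Lemma conjugate_prim_root (F E E' : fieldType) (i : {rmorphism F -> E})
    (i' : {rmorphism F -> E'}) (p : {poly F}) z z' m :
  irreducible_poly p -> root (map_poly i p) z -> root (map_poly i' p) z' ->
  m.-primitive_root z -> m.-primitive_root z'.
Proof.
move=> pirr pz pz' zP; have m0 := prim_order_gt0 zP.
have rE k : (z ^+ k == 1) = (z' ^+ k == 1).
  have e (R : fieldType) (j : {rmorphism F -> R}) (w : R) :
      root (map_poly j ('X^k - 1)) w = (w ^+ k == 1).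
    by rewrite rmorphB rmorph1 /= map_polyXn rootE !hornerE subr_eq0.
  by rewrite -(e _ i) -(e _ i') (irreducible_root _ pirr pz) (irreducible_root _ pirr pz').
apply/andP; split=> //; apply/forallP => j; rewrite unity_rootE -rE.
rewrite -(prim_order_dvd zP); apply/eqP; apply/idP/eqP => [/(dvdn_leq (ltn0Sn j)) le|->] //.
by apply/eqP; rewrite eqn_leq le ltn_ord.
Qed.

(** To L is adjoined a root z of an irreducible factor of the minimal polynomial
    of zeta. Being conjugate to zeta, z is again a primitive root of unity, so
    that the extension is generated by all the roots of two separable
    polynomials, and is a Galois extension of K. *)
Lemma splitting_compositum (K : fieldType) (L : splittingFieldType K) (Om : fieldExtType K)
    (zeta : Om) m (p : {poly K}) :
  galois 1 {:L} -> m.-primitive_root zeta ->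
  map_poly (in_alg Om) p = minPoly 1 zeta -> irreducible_poly p ->
  exists (E : splittingFieldType K) (f : 'AHom(L, E)) (z : E),
    [/\ galois 1 {:E}, root (map_poly (in_alg E) p) z & m.-primitive_root z].
Proof.
move=> galL zP pE pirr.
have pzeta : root (map_poly (in_alg Om) p) zeta by rewrite pE root_minPoly.
have p1 : (1 < size p)%N by case: pirr.
have pL1 : (1 < size (map_poly (in_alg L) p))%N by rewrite size_map_poly.
have [q qp qirr] := irreducible_divisor pL1.
have [E0 _ [z qz genz]] := irredp_FAdjoin qirr.
pose E : fieldExtType K := baseFieldType E0.
pose iE : {rmorphism L -> E} := in_alg E0.
have iE_linear : linear (locked iE).
  by move=> c u v; rewrite -[in LHS]mulr_algl rmorphD rmorphM -lock mulr_algl.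
pose iEM := GRing.isLinear.Build _ _ _ _ _ iE_linear.
pose iEL : {linear _ -> _} := HB.pack (locked iE : _ -> _) iEM.
have iE_ahom : ahom_in {:L} (linfun iEL).
  by apply/ahom_inP; split=> [u v|]; rewrite !lfunE (rmorphM, rmorph1).
pose f : 'AHom(L, E) := AHom iE_ahom.
have fE l : f l = iE l by rewrite lfunE /= -lock.
clearbody f.
have pz : root (map_poly (in_alg E) p) (z : E).
  have -> : map_poly (in_alg E) p = map_poly iE (map_poly (in_alg L) p).
    rewrite -map_poly_comp; apply: eq_map_poly => c.
    by rewrite -[RHS]/(iE (in_alg L c)) -fE [RHS]rmorph_alg.
  by move: qz; rewrite !root_factor_theorem => /dvdp_trans; apply; rewrite dvdp_map.
have zP' : m.-primitive_root (z : E) := conjugate_prim_root pirr pzeta pz zP.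
have [d [dK dsep [rs drs genL]]] := elimT splitting_galoisField galL.
have genE : <<1 & rcons (map f rs) (z : E)>>%VS = fullv.
  apply/vspaceP => u; rewrite memvf adjoin_rcons.
  have : (u : E0) \in <<1; z>>%VS by rewrite genz memvf.
  case/Fadjoin_polyP => r /polyOver1P[r0 ->] ->.
  have -> : (map_poly (in_alg E0) r0).[z] = (map_poly f r0).[z : E].
    by congr (_.[_]); apply: eq_map_poly => l; rewrite fE.
  apply: mempx_Fadjoin; apply/polyOverP => i; rewrite coef_map /=.
  rewrite -(aimg1 f) -aimg_adjoin_seq genL; exact: memv_img (memvf _).
pose zs := [seq (z : E) ^+ i | i <- index_iota 0 m].
have zsE : \prod_(y <- zs) ('X - y%:P) = 'X^m - 1 by rewrite big_map factor_Xn_sub_1.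
have drsE : map_poly f d %= \prod_(y <- map f rs) ('X - y%:P).
  suff -> : \prod_(y <- map f rs) ('X - y%:P) = map_poly f (\prod_(y <- rs) ('X - y%:P)).
    by rewrite eqp_map.
  rewrite big_map rmorph_prod; apply: eq_bigr => y _.
  by rewrite [RHS]rmorphB /= map_polyX map_polyC.
have dE : map_poly f d \is a polyOver 1%VS.
  by apply/polyOverP => i; rewrite coef_map -(aimg1 f) memv_img // (polyOverP dK).
have XE : 'X^m - 1 \is a @polyOver E 1%VS by rewrite rpredB ?rpredX ?polyOverX ?rpred1.
have genE' : <<1 & map f rs ++ zs>>%VS = fullv :> {vspace E}.
  apply/eqP; rewrite eqEsubv subvf -genE; apply/Fadjoin_seqP; split=> [|y].
    exact: subv_adjoin_seq.
  rewrite mem_rcons inE => yrs; apply: seqv_sub_adjoin; rewrite mem_cat.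
  case/orP: yrs => [/eqP->|->] //; apply/orP; right.
  by rewrite -root_prod_XsubC zsE rootE !hornerE (prim_expr_order zP') subrr.
have splE : splitting_field_axiom E.
  exists (map_poly f d * ('X^m - 1)); first exact: rpredM.
  by exists (map f rs ++ zs) => //; rewrite big_cat zsE eqp_mulr.
pose E' : splittingFieldType K := HB.pack E (FieldExt_isSplittingField.Build K E splE).
exists E', f, z; split=> //; apply/and3P; split; [exact: sub1v| |exact: normalFieldf].
rewrite -[X in separable _ X]genE'; apply: separable_Fadjoin_seq; apply/allP => y.
rewrite mem_cat => /orP[yr|yz]; apply/separable_elementP.
  exists (map_poly f d); split=> //; last by rewrite separable_map.
  by rewrite (eqp_root drsE) root_prod_XsubC.
exists ('X^m - 1); split=> //; first by rewrite -zsE root_prod_XsubC.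
exact: separable_Xn_sub_1 (prim_root_natf_neq0 zP').
Qed.

Section GaloisAction.

Variables (K : fieldType) (E : splittingFieldType K).

(** Products of Galois automorphisms compose from left to right; inverting
    them gives a left action. *)
Definition gal_act (g : gal_of {:E}) : {rmorphism E -> E} := gal_repr g^-1%g.

Lemma gal_actE g u : gal_act g u = (g^-1)%g u. Proof. by []. Qed.

Lemma gal_act1 u : gal_act 1%g u = u.
Proof. by rewrite gal_actE invg1 gal_id. Qed.

Lemma gal_actM g h u : gal_act (g * h)%g u = gal_act g (gal_act h u).
Proof. by rewrite gal_actE invMg galM ?memvf. Qed.

Lemma gal_act_inj g h : (forall u, gal_act g u = gal_act h u) -> g = h.
Proof. by move=> e; apply: invg_inj; apply/eqP/gal_eqP => u _; apply: e. Qed.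

Lemma gal_full (g : gal_of {:E}) : g \in 'Gal({:E} / 1)%g.
Proof. by rewrite gal_kHom ?sub1v // k1AHom. Qed.

Lemma gal_act_fixed (U : {subfield E}) u : galois 1 {:E} ->
  (forall g, (forall v, v \in U -> gal_act g v = v) -> gal_act g u = u) -> u \in U.
Proof.
move=> galE fu; have galU : galois U {:E} by apply: galoisS galE; rewrite sub1v subvf.
rewrite -(elimT galois_fixedField galU); apply/fixedFieldP; first exact: memvf.
move=> g gU; rewrite -[g]invgK; apply: fu => v vU.
by rewrite gal_actE invgK (fixed_gal _ gU) ?subvf.
Qed.

Lemma gal_act_base g (k : K) : gal_act g k%:A = k%:A.
Proof. exact: rmorph_alg. Qed.

End GaloisAction.

Section Restriction.

Variables (K : fieldType) (L E : splittingFieldType K) (f : 'AHom(L, E)).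
Hypothesis galE : galois 1 {:E}.
Hypothesis galL : galois 1 {:L}.
Hypothesis abL : abelian 'Gal({:L} / 1)%g.

(** The minimal polynomial over K of an element of L splits in L, so conjugates
    of elements of f(L) stay in f(L). *)
Lemma gal_act_restrict g : exists s : gal_of {:L}, forall l, gal_act g (f l) = f (s l).
Proof.
have im l : exists l', gal_act g (f l) = f l'.
  have [rs rsE] := splitting_field_normal 1 l.
  have : root (map_poly f (minPoly 1 l)) (gal_act g (f l)).
    have [p pE _] := minPoly_base l.
    have fpE : map_poly f (minPoly 1 l) = map_poly (in_alg E) p.
      by rewrite -pE -map_poly_comp; apply: eq_map_poly => k; apply: rmorph_alg.
    have gpE : map_poly (gal_act g) (map_poly (in_alg E) p) = map_poly (in_alg E) p.
      by rewrite -map_poly_comp; apply: eq_map_poly => k; apply: gal_act_base.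
    by rewrite fpE -gpE fmorph_root -fpE fmorph_root root_minPoly.
  rewrite (eqP rsE) rmorph_prod.
  rewrite (eq_bigr (fun y => 'X - (f y)%:P)) => [|y _]; last first.
    by rewrite rmorphB /= map_polyX map_polyC.
  rewrite -(big_map f xpredT (fun y => 'X - y%:P)) root_prod_XsubC.
  by case/mapP => l' _ ->; exists l'.
pose h := (f^-1 \o gal_repr (g^-1)%g \o f)%VF.
have hE l : f (h l) = gal_act g (f l).
  have [l' e] := im l; rewrite e /h !comp_lfunE; congr (f _).
  exact: (etrans (congr1 (f^-1)%VF e) (lker0_lfunK (AHom_lker0 f) l')).
have h_ahom : ahom_in {:L} h.
  apply/ahom_inP; split=> [u v _ _|]; apply: (fmorph_inj f).
    rewrite [LHS](hE (u * v)) !rmorphM; congr (_ * _); exact/esym/hE.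
  by rewrite [LHS](hE 1) !rmorph1.
exists (gal {:L} (AHom h_ahom)) => l.
by rewrite (galK (subvf _)) ?memvf // -hE.
Qed.

Definition restr g := epsilon (inhabits 1%g)
  (fun s : gal_of {:L} => forall l, gal_act g (f l) = f (s l)).

Lemma restrE g l : gal_act g (f l) = f (restr g l).
Proof. exact: (epsilon_spec (inhabits 1%g) _ (gal_act_restrict g)). Qed.

Lemma restr_eq g (s : gal_of {:L}) : (forall l, gal_act g (f l) = f (s l)) -> restr g = s.
Proof.
move=> e; apply/eqP/gal_eqP => l _; apply: (fmorph_inj f).
exact: etrans (esym (restrE g l)) (e l).
Qed.

Lemma restr1 : restr 1%g = 1%g.
Proof. by apply: restr_eq => l; rewrite gal_act1 gal_id. Qed.

(** Since gal_act is a left action, restr reverses products; the Galois group of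
    L being abelian, it is a morphism nevertheless. *)
Lemma restrM g h : restr (g * h)%g = (restr g * restr h)%g.
Proof.
have -> : (restr g * restr h = restr h * restr g)%g.
  exact: (centsP abL) (gal_full _) _ (gal_full _).
by apply: restr_eq => l; rewrite gal_actM !restrE galM ?memvf.
Qed.

(** The image is the full Galois group as its fixed field is K. *)
Lemma restr_onto s : exists g, restr g = s.
Proof.
have rG : group_set [set restr g | g : gal_of {:E}].
  apply/group_setP; split; first by apply/imsetP; exists 1%g; rewrite ?restr1.
  move=> _ _ /imsetP[g _ ->] /imsetP[h _ ->].
  by apply/imsetP; exists (g * h)%g; rewrite ?restrM.
have fix1 : fixedField (Group rG) = 1%AS.
  apply/eqP; rewrite eqEsubv sub1v andbT; apply/subvP => l /mem_fixedFieldP[_ fl].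
  have : f l \in 1%AS.
    apply: gal_act_fixed => // g _; rewrite restrE fl //.
    by apply/imsetP; exists g.
  case/vlineP => k /eqP; rewrite -(rmorph_alg f) (inj_eq (fmorph_inj f)) => /eqP->.
  by rewrite rpredZ ?mem1v.
have : s \in Group rG by rewrite -(gal_fixedField (Group rG)) fix1 gal_full.
by case/imsetP => g _ ->; exists g.
Qed.

Lemma restr_ker_fixed u : (forall g, restr g = 1%g -> gal_act g u = u) -> exists l, u = f l.
Proof.
move=> fu; have : u \in [aspace of limg f].
  apply: gal_act_fixed => // g gf; apply: fu; apply: restr_eq => l.
  by rewrite gal_id; apply: gf; apply: memv_img (memvf _).
by case/memv_imgP => l _ ->; exists l.
Qed.

End Restriction.

(** Which powers of a primitive root of unity are conjugate to it depends only
    on its minimal polynomial, so the Galois group of E raises z to powers of t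
    as soon as a generator of the cyclotomic extension raises zeta to the t. *)
Lemma cyclotomic_conjugation (K : fieldType) (Om E : splittingFieldType K)
    (zeta : Om) (z : E) m (p : {poly K}) :
  m.-primitive_root zeta -> m.-primitive_root z ->
  map_poly (in_alg Om) p = minPoly 1 zeta -> irreducible_poly p ->
  root (map_poly (in_alg E) p) z -> galois 1 {:E} ->
  cyclic_extension 1%AS <<1; zeta>>%AS ->
  exists (tau : gal_of {:E}) (t : nat),
    gal_act tau z = z ^+ t /\ forall g, exists k, gal_act g z = z ^+ (t ^ k).
Proof.
move=> zetaP zP pE pirr pz galE /andP[gal1 /cyclicP[x0 x0E]].
have zO : zeta \in <<1; zeta>>%AS by rewrite memv_adjoin.
have rE (F : fieldType) (i : {rmorphism K -> F}) (w : F) s :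
    root (map_poly i p) w -> root (map_poly i p) (w ^+ s) = (p %| p \Po 'X^s).
  move=> pw; rewrite -(irreducible_root _ pirr pw) map_comp_poly map_polyXn /=.
  by rewrite /root horner_comp hornerXn.
have pzeta : root (map_poly (in_alg Om) p) zeta by rewrite pE root_minPoly.
have pzE s : root (minPoly 1 zeta) (zeta ^+ s) = root (map_poly (in_alg E) p) (z ^+ s).
  by rewrite -pE !rE.
have x0G : x0 \in 'Gal(<<1; zeta>> / 1)%g by rewrite x0E cycle_id.
have [t tE] : exists t : 'I_m, x0 zeta = zeta ^+ t.
  have [t e] : {i : 'I_m | x0 zeta = zeta ^+ i}; last by exists t.
  by apply: (prim_rootP zetaP); rewrite -rmorphXn /= (prim_expr_order zetaP) rmorph1.
have x0X k : (x0 ^+ k)%g zeta = zeta ^+ (t ^ k).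
  elim: k => [|k IH]; first by rewrite expg0 gal_id.
  by rewrite expgS galM // tE rmorphXn /= IH -exprM expnSr.
have [x xG xz] : exists2 x, x \in 'Gal({:E} / 1)%g & x z = z ^+ t.
  apply: (normalField_root_minPoly (sub1v _) (normalFieldf _) (memvf _)).
  have : map_poly (in_alg E) p %= minPoly 1 z.
    have := @minPoly_dvdp _ _ 1%AS z (map_poly (in_alg E) p).
    rewrite alg_polyOver pz => /(_ isT isT) d.
    have [p' p'E p'irr] := minPoly_base z.
    rewrite -p'E dvdp_map in d; rewrite -p'E eqp_map eqp_sym.
    by apply: pirr => //; case: p'irr; case: (size p') => [|[]].
  move/eqp_root <-; rewrite -pzE -tE.
  exact: root_minPoly_gal (sub1v _) x0G zO.
exists x^-1%g, t; split=> [|g]; first by rewrite gal_actE invgK.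
have [s sE] : {i : 'I_m | gal_act g z = z ^+ i}.
  by apply: (prim_rootP zP); rewrite -rmorphXn (prim_expr_order zP) rmorph1.
have : root (minPoly 1 zeta) (zeta ^+ s).
  rewrite pzE -sE; suff <- : map_poly (gal_act g) (map_poly (in_alg E) p) = map_poly (in_alg E) p.
    by rewrite fmorph_root.
  by rewrite -map_poly_comp; apply: eq_map_poly => k; apply: gal_act_base.
have /and3P[s1 _ nrm] := gal1.
case/(normalField_root_minPoly s1 nrm zO) => y.
rewrite x0E => /cycleP[k ->]; rewrite x0X => /eqP.
rewrite (eq_prim_root_expr zetaP) => e; exists k.
by rewrite sE; apply/eqP; rewrite (eq_prim_root_expr zP) eq_sym.
Qed.

(** * Coordinates on a lattice *)

Section Coordinates.

Variables (gT : finGroupType) (M : glatticeType gT) (n : nat) (x : 'I_n -> M).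
Hypothesis basis_x : zbasis x.
Variable a : gT -> 'M[int]_n.
Hypothesis aP : forall s j, lact s (x j) = \sum_(i < n) x i *~ a s i j.

Lemma zbasis_inj (c d : 'I_n -> int) :
  \sum_i x i *~ c i = \sum_i x i *~ d i -> c =1 d.
Proof.
have [x' xK _] := basis_x => e i.
have /ffunP/(_ i) : [ffun i => c i] = [ffun i => d i]; last by rewrite !ffunE.
apply: (can_inj xK); rewrite (eq_bigr (fun i => x i *~ c i)) => [|k _]; last by rewrite ffunE.
by rewrite e; apply: eq_bigr => k _; rewrite ffunE.
Qed.

Definition coords (y : M) : 'I_n -> int :=
  epsilon (inhabits (fun _ => 0)) (fun c => y = \sum_i x i *~ c i).

Lemma coordsE y : y = \sum_i x i *~ coords y i.
Proof.
apply: (epsilon_spec (inhabits (fun _ => 0)) (fun c => y = \sum_i x i *~ c i)).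
by have [x' _ xK] := basis_x; exists (x' y); rewrite xK.
Qed.

Lemma coordsD y z i : coords (y + z) i = coords y i + coords z i.
Proof.
apply: (zbasis_inj (d := fun i => coords y i + coords z i)).
rewrite -coordsE {1}[y]coordsE {1}[z]coordsE -big_split.
by apply: eq_bigr => k _; rewrite mulrzDr.
Qed.

Lemma coords_lact s y i : coords (lact s y) i = \sum_j a s i j * coords y j.
Proof.
apply: (zbasis_inj (d := fun i => \sum_j a s i j * coords y j)).
rewrite -coordsE {1}[y]coordsE raddf_sum.
transitivity (\sum_j \sum_k x k *~ (a s k j * coords y j)).
  apply: eq_bigr => j _; rewrite raddfMz /= aP mulrz_suml.
  by apply: eq_bigr => k _; rewrite mulrzA.
by rewrite exchange_big; apply: eq_bigr => k _; rewrite mulrz_sumr.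
Qed.

Lemma coords_basis j i : coords (x j) i = (i == j)%:R.
Proof.
apply: (zbasis_inj (d := fun i => (i == j)%:R)); rewrite -coordsE (bigD1 j) //= eqxx.
by rewrite mulr1z big1 ?addr0 // => k kj; rewrite (negbTE kj) mulr0z.
Qed.

Lemma lact_mx_eq s t : (forall j, lact s (x j) = lact t (x j)) -> a s = a t.
Proof.
move=> st; apply/matrixP => i j.
exact: zbasis_inj (etrans (esym (aP s j)) (etrans (st j) (aP t j))) i.
Qed.

Lemma lact_mx1 : a 1%g = 1%:M.
Proof.
apply/matrixP => i j; rewrite mxE -coords_basis -[x j in RHS]lact1 coords_lact.
rewrite (bigD1 j) //= coords_basis eqxx mulr1 big1 ?addr0 // => k kj.
by rewrite coords_basis (negbTE kj) mulr0.
Qed.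

Lemma lact_mxM s t : a (s * t)%g = a s *m a t.
Proof.
have colE u i j : a u i j = coords (lact u (x j)) i.
  rewrite coords_lact (bigD1 j) //= coords_basis eqxx mulr1 big1 ?addr0 // => k kj.
  by rewrite coords_basis (negbTE kj) mulr0.
apply/matrixP => i j; rewrite mxE colE lactM coords_lact.
by apply: eq_bigr => k _; rewrite -colE.
Qed.

Lemma lact_ext s t : (forall j, lact s (x j) = lact t (x j)) ->
  forall y : M, lact s y = lact t y.
Proof.
move=> st y; rewrite [y]coordsE !raddf_sum; apply: eq_bigr => j _.
by rewrite !raddfMz /= st.
Qed.

End Coordinates.

(** * Descent to the fixed field *)

(** Scalar extension identifies F with the invariants over L', so that the section
    and the point at which it is evaluated both transport along it. *)
Lemma retract_descent (K L' : fieldType) (L : fieldExtType K) n (j : {rmorphism L -> L'})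
    (T : Type) (act : T -> {rmorphism ratfun L' n -> ratfun L' n}) (F : {pred ratfun L n})
    N (f : 'I_N -> ratfun L' n) (sg : ratfun L' n -> {fraction {mpoly K[N]}}) :
  let fixed u := forall g, act g u = u in
  (forall u, reflect (fixed (extend_ratfun n j u)) (u \in F)) ->
  (forall u, fixed u -> exists v, u = extend_ratfun n j v) ->
  (forall k g, act g (ratfun_const L' n (j k%:A)) = ratfun_const L' n (j k%:A)) ->
  (forall k, fixed (f k)) ->
  (forall k, sg (ratfun_const L' n (j k%:A)) = tofrac k%:MP) ->
  (forall u v, fixed u -> fixed v -> sg (u + v) = sg u + sg v) ->
  (forall u v, fixed u -> fixed v -> sg (u * v) = sg u * sg v) ->
  (forall u, fixed u ->
     specializes (mmap (ratfun_const L' n \o (j \o in_alg L)) f) (sg u) u) ->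
  retract_rational (const_embed L n) F.
Proof.
move=> fixed FP surj fixK fixf sgK sgD sgM sgS.
set io := extend_ratfun n j in FP surj.
have ioK k : io (const_embed L n k) = ratfun_const L' n (j k%:A) by exact: extend_const.
clearbody io.
have /fin_all_exists[y yE] : forall k, exists v, f k = io v by move=> k; apply: surj.
apply: (@retract_criterion _ _ _ F N y (fun u => sg (io u))).
- by move=> k; apply/FP => g; rewrite ioK fixK.
- move=> u v /FP fu /FP fv; apply/FP => g.
  by rewrite rmorphB rmorphB [X in X - _](fu g) [X in _ - X](fv g).
- move=> u v /FP fu /FP fv; apply/FP => g.
  by rewrite rmorphM rmorphM [X in X * _](fu g) [X in _ * X](fv g).
- by move=> u /FP fu; apply/FP => g; rewrite fmorphV fmorphV [X in X^-1](fu g).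
- by move=> k; apply/FP => g; rewrite -yE fixf.
- by move=> k; rewrite ioK sgK.
- by move=> u v /FP fu /FP fv; rewrite rmorphD sgD.
- by move=> u v /FP fu /FP fv; rewrite rmorphM sgM.
move=> u /FP fu; have [p [q [q0 sgE uE]]] := sgS _ fu.
have evE r : mmap (ratfun_const L' n \o (j \o in_alg L)) f r = io (mmap (const_embed L n) y r).
  apply: (@rmorph_mpoly_eq _ _ _ (mmap (ratfun_const L' n \o (j \o in_alg L)) f)
            (io \o mmap (const_embed L n) y)) => [c|i].
    by rewrite /= !mmapC -[RHS]/(io (const_embed L n c)) ioK.
  by rewrite /= !mmapX !mmap1U yE.
exists p, q; split=> //; first by rewrite -(fmorph_eq0 io) -evE.
by apply: (fmorph_inj io); rewrite fmorph_div -!evE.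
Qed.

(** * The invariants over the compositum *)

(** L' is L with a root of unity adjoined, G1 its group over K and r the
    restriction to L. *)
Section Compositum.

Variables (K L' : fieldType) (L : fieldExtType K) (j : {rmorphism L -> L'}).
Variables (P G1 pi2 : finGroupType) (sL : P -> {rmorphism L -> L}).
Variables (A : G1 -> {rmorphism L' -> L'}) (r : G1 -> P) (m : nat) (z : L') (tau0 : G1) (t : nat).
Hypothesis A1 : forall u, A 1%g u = u.
Hypothesis AM : forall g h u, A (g * h)%g u = A g (A h u).
Hypothesis Af : forall g, (forall u, A g u = u) -> g = 1%g.
Hypothesis fixA : forall u, (forall g, A g u = u) -> exists k, u = j k%:A.
Hypothesis AK : forall g k, A g (j k%:A) = j k%:A.
Hypothesis rM : forall g h, r (g * h)%g = (r g * r h)%g.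
Hypothesis r_onto : forall s, exists g, r g = s.
Hypothesis rE : forall g l, A g (j l) = j (sL (r g) l).
Hypothesis r_ker : forall u, (forall g, r g = 1%g -> A g u = u) -> exists l, u = j l.
Hypothesis ab2 : abelian [set: pi2].
Hypothesis m2 : forall h : pi2, (h ^+ m = 1)%g.
Hypothesis zP : m.-primitive_root z.
Hypothesis tauz : A tau0 z = z ^+ t.
Hypothesis zG : forall g, exists k, A g z = z ^+ (t ^ k).
Variables (M : glatticeType (P * pi2)%type) (n : nat) (x : 'I_n -> M) (a : P * pi2 -> 'M[int]_n).
Hypothesis rhoM : flabby_class_invertible M.
Hypothesis basis_x : zbasis x.
Hypothesis aP : forall s i, lact s (x i) = \sum_(k < n) x k *~ a s k i.

Lemma r1 : r 1%g = 1%g.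
Proof. by apply: (mulgI (r 1%g)); rewrite -rM !mulg1. Qed.

Lemma sL1 l : sL 1%g l = l.
Proof. by apply: (fmorph_inj j); rewrite -r1 -rE A1. Qed.

Lemma sLM s s' l : sL (s * s')%g l = sL s (sL s' l).
Proof.
have [[g <-] [g' <-]] := (r_onto s, r_onto s').
by apply: (fmorph_inj j); rewrite -rM -!rE AM.
Qed.

Definition lact_ker := [set s : P * pi2 | [forall i, lact s (x i) == x i]].

Lemma lact_kerP s : reflect (forall y : M, lact s y = y) (s \in lact_ker).
Proof.
rewrite inE; apply: (iffP forallP) => [h y|h i]; last by rewrite h.
rewrite -[RHS]lact1; apply: (lact_ext basis_x) => i.
by rewrite lact1; apply/eqP.
Qed.

Lemma lact_ker_group_set : group_set lact_ker.
Proof.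
apply/group_setP; split=> [|s s' /lact_kerP h /lact_kerP h'].
  by apply/lact_kerP => y; rewrite lact1.
by apply/lact_kerP => y; rewrite lactM h' h.
Qed.

Definition lact_kerG := Group lact_ker_group_set.

Definition ker2 := [set h : pi2 | (1%g, h) \in lact_ker].

Lemma ker2P h : reflect (forall y : M, lact (1%g, h) y = y) (h \in ker2).
Proof. by rewrite [h \in _]inE; apply: lact_kerP. Qed.

Lemma ker2_group_set : group_set ker2.
Proof.
apply/group_setP; split=> [|h h' /ker2P hP /ker2P h'P]; apply/ker2P => y.
  exact: lact1.
have -> : (1%g, h * h')%g = ((1%g, h) * (1%g, h'))%g :> P * pi2.
  by congr (_, _); rewrite /= mulg1.
by rewrite lactM h'P hP.
Qed.

Definition ker2G := Group ker2_group_set.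

Local Notation H := (coset_of ker2G).
Local Notation G := (G1 * H)%type.

(** The group that acts is G1 * H, where H is the image of pi2 in the
    automorphisms of the lattice: it is faithful on L'(M). It acts on lattices
    through the set-theoretic map lift, which is a morphism modulo the kernel
    lact_ker only. *)
Definition lift (g : G) : P * pi2 := (r g.1, repr g.2).

Lemma ker2_cosetM (h h' : pi2) :
  coset ker2G (h * h')%g = (coset ker2G h * coset ker2G h')%g.
Proof.
have nH := subsetP (sub_abelian_norm ab2 (subsetT ker2G)).
by apply: coset_morphM; apply: nH; rewrite inE.
Qed.

Lemma lact_coset (s : P) (h h' : pi2) : coset ker2G h = coset ker2G h' ->
  forall y : M, lact (s, h) y = lact (s, h') y.
Proof.
move=> hh' y; have : (h * h'^-1)%g \in ker2G.
  apply: coset_idr; last by rewrite ker2_cosetM hh' -ker2_cosetM mulgV coset_id.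
  by apply: (subsetP (sub_abelian_norm ab2 (subsetT ker2G))); rewrite inE.
move/ker2P => kP; rewrite -[RHS]kP -lactM; congr (lact _ y).
by congr (_, _); rewrite /= ?mul1g ?mulgKV.
Qed.

Lemma lact_lift g s h (y : M) : r g.1 = s -> g.2 = coset ker2G h ->
  lact (lift g) y = lact (s, h) y.
Proof. by move=> <- gh; apply: lact_coset; rewrite coset_reprK. Qed.

Lemma lact_lift1 (y : M) : lact (lift 1%g) y = y.
Proof.
by rewrite (@lact_lift _ 1%g 1%g) ?r1 ?coset_id ?group1 // lact1.
Qed.

Lemma lact_liftM g g' (y : M) : lact (lift (g * g')%g) y = lact (lift g) (lact (lift g') y).
Proof.
rewrite -lactM; apply: lact_lift; first exact: rM.
by rewrite ker2_cosetM !coset_reprK.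
Qed.

Definition lift_mx g := a (lift g).

Lemma lift_mx1 : lift_mx 1%g = 1%:M.
Proof.
rewrite -(lact_mx1 basis_x aP); apply: (lact_mx_eq basis_x aP) => i.
by rewrite lact1 lact_lift1.
Qed.

Lemma lift_mxM g g' : lift_mx (g * g')%g = lift_mx g *m lift_mx g'.
Proof.
rewrite -(lact_mxM basis_x aP); apply: (lact_mx_eq basis_x aP) => i.
by rewrite lactM lact_liftM.
Qed.

Let A2 (g : G) := A g.1.

Definition inv_act (g : G) : {rmorphism ratfun L' n -> ratfun L' n} :=
  mono_act (aL := A2) A1 (fun g h => AM g.1 h.1) lift_mx1 lift_mxM g.

Lemma inv_act_faithful g : (forall u, inv_act g u = u) -> g = 1%g.
Proof.
case: g => g h gu.
have g1 : g = 1%g.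
  apply: Af => l; apply: (fmorph_inj (ratfun_const L' n)).
  by rewrite -[RHS]gu [RHS]mono_actC.
have hK : repr h \in ker2.
  apply/ker2P => y; rewrite -[RHS]lact1; apply: (lact_ext basis_x) => i; rewrite lact1.
  have <- : lact (lift (g, h)) (x i) = lact (1%g, repr h) (x i).
    by apply: lact_lift; rewrite ?coset_reprK // g1 r1.
  rewrite aP [RHS](coordsE basis_x); apply: eq_bigr => k _; congr (_ *~ _).
  move: k; apply: (@laurent_inj L').
  rewrite -[LHS](mono_actX A1 (fun g h => AM g.1 h.1) lift_mx1 lift_mxM (g, h) i).
  rewrite [LHS]gu -['X_i]/('X_[U_(i)]) -laurent_mnm; apply: eq_laurent => k.
  by rewrite (coords_basis basis_x) mnm1E eq_sym natz.
by rewrite g1 -[h]coset_reprK coset_id.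
Qed.

Lemma additive_coords (b : M -> int) (y : M) : (forall u v, b (u + v) = b u + b v) ->
  b y = \sum_i b (x i) * coords x y i.
Proof.
move=> bD; have b_mor : zmod_morphism b.
  by move=> u v; apply: (addIr (b v)); rewrite -bD !subrK.
pose ba : {additive M -> int} := HB.pack b (GRing.isZmodMorphism.Build _ _ b b_mor).
rewrite {1}[y](coordsE basis_x) -[b]/(ba : M -> int) raddf_sum.
by apply: eq_bigr => i _; rewrite raddfMz -mulrzr intz.
Qed.

Lemma ker_normal (g : P * pi2) k : k \in lact_kerG ->
  exists2 k', k' \in lact_kerG & (g * k = k' * g)%g.
Proof.
move/lact_kerP=> kP; exists (g * k * g^-1)%g; last by rewrite mulgKV.
by apply/lact_kerP => y; rewrite !lactM kP -lactM mulgV lact1.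
Qed.

Lemma liftM_ker g g' : exists2 k, k \in lact_kerG & lift (g * g')%g = (k * (lift g * lift g'))%g.
Proof.
exists (lift (g * g')%g * (lift g * lift g')^-1)%g; last by rewrite mulgKV.
by apply/lact_kerP => y; rewrite lactM lact_liftM -!lactM mulgV lact1.
Qed.

Definition pi_act (s : P * pi2) : {rmorphism ratfun L n -> ratfun L n} :=
  mono_act (aL := fun s : P * pi2 => sL s.1) sL1 (fun s s' => sLM s.1 s'.1)
    (lact_mx1 basis_x aP) (lact_mxM basis_x aP) s.

(** As each pair in P * pi2 comes from a pair in G1 * H with the same effect on
    L(M), both groups have the same invariants in L(M). *)
Lemma lift_equivariant (g : G) (s : P * pi2) u : r g.1 = s.1 -> g.2 = coset ker2G s.2 ->
  extend_ratfun n j (pi_act s u) = inv_act g (extend_ratfun n j u).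
Proof.
move=> gs gs2; apply: (@extend_equivariant _ _ _ _ (a s) (sL s.1) (A g.1)) => [l|i|l|i|l].
- exact: mono_actC.
- exact: mono_actX.
- exact: mono_actC.
- rewrite [LHS]mono_actX; apply: eq_laurent => k.
  congr ((_ : 'M_n) _ _); apply: (lact_mx_eq basis_x aP) => l.
  by rewrite (lact_lift _ gs gs2); case: (s).
- by rewrite rE gs.
Qed.

Lemma pi_actE s u : pi_act s u = mul_act (sL s.1) (a s) u.
Proof. exact: mono_actE. Qed.

Lemma fixed_fieldP u : reflect (forall g, inv_act g (extend_ratfun n j u) = extend_ratfun n j u)
  (u \in fixed_field (fun s : P * pi2 => sL s.1 : L -> L) a).
Proof.
rewrite inE; apply: (iffP forallP) => [fu g|fu s].
  have e := eqP (fu (r g.1, repr g.2)).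
  have gE : g.2 = coset ker2G (repr g.2) by rewrite coset_reprK.
  rewrite -pi_actE in e.
  exact: etrans (esym (lift_equivariant (s := (r g.1, repr g.2)) u erefl gE)) (congr1 _ e).
have [g gE] := r_onto s.1; apply/eqP; rewrite -pi_actE.
apply: (fmorph_inj (extend_ratfun n j)).
exact: etrans (lift_equivariant (g := (g, coset ker2G s.2)) u gE erefl) (fu _).
Qed.

(** The kernel of the restriction to L acts on the coefficients only. *)
Lemma inv_act_descent u : (forall g, inv_act g u = u) -> exists v, u = extend_ratfun n j v.
Proof.
move=> fu; have Kgrp : group_set [set g | r g == 1%g].
  by apply/group_setP; split=> [|g h]; rewrite !inE ?r1 // rM => /eqP-> /eqP->; rewrite mulg1.
pose Kr := Group Kgrp.
apply: (@extend_descent _ _ n j (subg_of Kr) (fun k => A (sgval k))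
          (fun k => inv_act (sgval k, 1%g))) => [l|k k' l|l fl|k l|k i|k].
- exact: A1.
- exact: AM.
- apply: r_ker => g rg; have gK : g \in Kr by rewrite inE rg.
  by rewrite -[RHS](fl (subg Kr g)) subgK.
- exact: mono_actC.
- rewrite [LHS]mono_actX -['X_i]/('X_[U_(i)]) -laurent_mnm; apply: eq_laurent => l.
  have -> : lift_mx (sgval k, 1%g) = 1%:M.
    rewrite -(lact_mx1 basis_x aP); apply: (lact_mx_eq basis_x aP) => i'.
    rewrite lact1 (@lact_lift _ 1%g 1%g) ?coset_id ?group1 //; first exact: lact1.
    by have := subgP k; rewrite inE => /eqP.
  by rewrite mxE mnm1E eq_sym natz.
- exact: fu.
Qed.

Lemma compositum_retract :
  retract_rational (const_embed L n) (fixed_field (fun s : P * pi2 => sL s.1 : L -> L) a).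
Proof.
have act1 u : inv_act 1%g u = u by apply: mono_act1.
have actM g h u : inv_act (g * h)%g u = inv_act g (inv_act h u) by apply: mono_actM.
have actC g l : inv_act g (ratfun_const L' n l) = ratfun_const L' n (A2 g l) by apply: mono_actC.
have actX g i : inv_act g (tofrac 'X_i) = laurent L' (fun k => lift_mx g k i) by apply: mono_actX.
have lift1_ker : lift 1%g \in lact_kerG by apply/lact_kerP => y; apply: lact_lift1.
pose fM (y : M) := laurent L' (coords x y).
have fM_D y y' : fM (y + y') = fM y * fM y'.
  by rewrite -laurentD; apply: eq_laurent => i; rewrite (coordsD basis_x).
have fM_act g y : fM (lact (lift g) y) = inv_act g (fM y).
  rewrite [RHS]mono_act_laurent; apply: eq_laurent => i.
  by rewrite (coords_lact basis_x aP).
have ker_triv (y : M) : fixed_by lact_kerG y by move=> k /lact_kerP.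
have [C [aC [s [b [[aC1 aCM] [s0 sG] bD bG fE]]]]] := multiplicative_factors
  ker_normal lift1_ker liftM_ker act1 actM inv_act_faithful rhoM ker_triv
  fM_D (fun y => laurent_neq0 _ _) fM_act.
have abH : abelian [set: H].
  apply/centsP => h _ h' _; rewrite /commute -[h]coset_reprK -[h']coset_reprK.
  by rewrite -!ker2_cosetM; congr (coset _ _); apply: (centsP ab2); rewrite inE.
have mH (h : H) : (h ^+ m = 1)%g.
  have hX k : (h ^+ k)%g = coset ker2G (repr h ^+ k)%g.
    elim: k => [|k IH]; first by rewrite !expg0 coset_id.
    by rewrite !expgS ker2_cosetM -IH coset_reprK.
  by rewrite hX m2 coset_id.
have XE i : tofrac 'X_i = \prod_c s c ^ b (x i) c.
  rewrite -fE -['X_i]/('X_[U_(i)]) -laurent_mnm; apply: eq_laurent => k.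
  by rewrite (coords_basis basis_x) mnm1E eq_sym natz.
have bE g i c : \sum_k lift_mx g k i * b (x k) (aC g c) = b (x i) c.
  rewrite -(bG g) (additive_coords _ (fun u v => bD u v (aC g c))).
  apply: eq_bigr => k _; rewrite mulrC (coords_lact basis_x aP) (bigD1 i) //=.
  rewrite (coords_basis basis_x) eqxx mulr1 big1 ?addr0 // => l li.
  by rewrite (coords_basis basis_x) (negbTE li) mulr0.
have [N [f [sg [ff [sgK sgD sgM sgS]]]]] :=
  @cyclotomic_section K L' (j \o in_alg L) G1 H A n lift_mx inv_act m z tau0 t C aC s
    (fun i => b (x i)) A1 AM Af fixA AK act1 actM inv_act_faithful actC actX abH mH zP
    tauz zG aC1 aCM s0 sG XE bE.
apply: (@retract_descent _ _ _ _ j G inv_act _ N f sg) => //.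
- exact: fixed_fieldP.
- exact: inv_act_descent.
- by move=> k g; rewrite actC /A2 AK.
Qed.

End Compositum.

Theorem theorem1p13
  (K : fieldType) (L : splittingFieldType K) (pi2 : finGroupType)
  (galL : galois 1 {:L})
  (abelian1 : abelian 'Gal({:L} / 1)%g)
  (abelian2 : abelian [set: pi2])
  (coprime12 : coprime #|'Gal({:L} / 1)%g| #|[set: pi2]|)
  (charK : [pchar K] =i pred0 \/
           exists2 p : nat, p \in [pchar K] & ~~ (p %| #|[set: pi2]|)%N)
  (Omega : splittingFieldType K) (zeta : Omega)
  (zetaP : (exponent [set: pi2]).-primitive_root zeta)
  (cyclicK : cyclic_extension 1%AS <<1; zeta>>%AS)
  (M : glatticeType (gal_of {:L} * pi2)%type)
  (rhoM : flabby_class_invertible M)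
  (n : nat) (x : 'I_n -> M) (basis_x : zbasis x)
  (a : gal_of {:L} * pi2 -> 'M[int]_n)
  (aP : forall (s : gal_of {:L} * pi2) (j : 'I_n),
      lact s (x j) = \sum_(i < n) x i *~ a s i j) :
  retract_rational (const_embed L n)
    (fixed_field (fun s : gal_of {:L} * pi2 => s.1 : L -> L) a).
Proof.
have [p pE pirr] := minPoly_base zeta.
have [E [j [z [galE pz zP]]]] := splitting_compositum galL zetaP pE pirr.
have [tau0 [t [tauz zG]]] := cyclotomic_conjugation zetaP zP pE pirr pz galE cyclicK.
have m2 (h : pi2) : (h ^+ exponent [set: pi2] = 1)%g.
  by rewrite expg_exponent // inE.
apply: (@compositum_retract K E L j (gal_of {:L}) (gal_of {:E}) pi2
  (fun s => gal_repr s) (@gal_act K E) (restr j) _ z tau0 t (@gal_act1 K E)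
  (@gal_actM K E) _ _ _ _ _ _ _ abelian2 m2 zP tauz zG M n x a rhoM basis_x aP).
- by move=> g fg; apply: gal_act_inj => u; rewrite fg gal_act1.
- move=> u fu; have : u \in 1%AS by apply: gal_act_fixed.
  by case/vlineP => k ->; exists k; apply/esym; apply: (rmorph_alg j).
- move=> g k; have e := rmorph_alg j k.
  exact: etrans (congr1 (gal_act g) e) (etrans (gal_act_base g k) (esym e)).
- exact: restrM.
- exact: restr_onto.
- exact: restrE.
- exact: restr_ker_fixed.
Qed.
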